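(* (1) For each field $\mathbf{k}$ of characteristic $\neq 2$, the morphism $\tau\colon\mathbb{A}^1_{\mathbf{k}}\to\mathrm{SL}_2$ given by $$t\mapsto\begin{pmatrix}t^3-3t & t^4-4t^2-1\\ 1+\frac{t^2(17t^6-56t^4-137t^2+452)}{16} & \frac{t(17t^8-73t^6-149t^4+609t^2+172)}{16}\end{pmatrix}$$ is a closed embedding. (2) If $\mathbf{k}=\mathbb{R}$, then $\tau$ is not equivalent to the standard embedding $\tau_1\colon\mathbb{A}^1_{\mathbb{R}}\hookrightarrow\mathrm{SL}_2$, $t\mapsto\begin{pmatrix}1 & 0\\ t & 1\end{pmatrix}$, because the fundamental group $\pi_1(\mathrm{SL}_2(\mathbb{R})\setminus\tau(\mathbb{R}))$ is not isomorphic to $\pi_1(\mathrm{SL}_2(\mathbb{R})\setminus\tau_1(\mathbb{R}))$, the latter being a free group.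
   Context: $\mathrm{SL}_2$ is the affine variety over $\mathbf{k}$ of $2\times2$ matrices of determinant $1$. Two closed embeddings $\rho,\rho'\colon X\hookrightarrow Y$ are equivalent if there is an automorphism $\varphi$ of the algebraic $\mathbf{k}$-variety $Y$ with $\rho'=\varphi\circ\rho$. Fundamental groups are taken with respect to the Euclidean topology on $\mathrm{SL}_2(\mathbb{R})$. *)

(* Defs.v *)
From HB Require Import structures.
From mathcomp Require Import all_boot all_order all_algebra generic_quotient.
From mathcomp Require Import all_classical all_reals all_analysis.
From mathcomp Require Import lra ring.
(* The notations of mpoly clash with those of mathcomp-analysis. *)
From mathcomp Require Import -(notations) mpoly.

Set Implicit Arguments.
Unset Strict Implicit.
Unset Printing Implicit Defensive.

Import Order.TTheory GRing.Theory Num.Theory numFieldNormedType.Exports.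

Local Open Scope classical_set_scope.
Local Open Scope ring_scope.
Local Open Scope quotient_scope.

Local Notation "{ 'mpoly' k [ n ] }" := (mpoly n k).
Local Notation "''X_' i" := (mpolyX _ (mnm1 i)).

(* An affine scheme of finite type over k, embedded in affine n-space, is given
   by its ideal in k[X_0, ..., X_(n-1)].  As k is arbitrary (possibly finite),
   k-points do not determine schemes or morphisms, so both are described by
   polynomials. *)
Record affine_scheme (k : fieldType) (n : nat) := AffineScheme {
  ideal : set {mpoly k[n]};
  ideal0 : ideal 0;
  idealD : forall p q, ideal p -> ideal q -> ideal (p + q);
  idealM : forall p q, ideal q -> ideal (p * q) }.

Lemma zero_idealD (k : fieldType) n (p q : {mpoly k[n]}) :
  [set 0] p -> [set 0] q -> [set 0] (p + q).
Proof. by move=> -> ->; rewrite /= addr0. Qed.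

Lemma zero_idealM (k : fieldType) n (p q : {mpoly k[n]}) :
  [set 0] q -> [set 0] (p * q).
Proof. by move=> ->; rewrite /= mulr0. Qed.

Definition affine_space (k : fieldType) (n : nat) : affine_scheme k n :=
  @AffineScheme k n [set 0] erefl (@zero_idealD k n) (@zero_idealM k n).

Section Hypersurface.
Context (k : fieldType) (n : nat) (f : {mpoly k[n]}).

Definition principal_ideal : set {mpoly k[n]} := [set q | exists r, q = r * f].

Lemma principal_ideal0 : principal_ideal 0.
Proof. by exists 0; rewrite mul0r. Qed.

Lemma principal_idealD p q :
  principal_ideal p -> principal_ideal q -> principal_ideal (p + q).
Proof. by move=> [r ->] [s ->]; exists (r + s); rewrite mulrDl. Qed.

Lemma principal_idealM p q : principal_ideal q -> principal_ideal (p * q).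
Proof. by move=> [r ->]; exists (p * r); rewrite mulrA. Qed.

Definition hypersurface : affine_scheme k n :=
  AffineScheme principal_ideal0 principal_idealD principal_idealM.
End Hypersurface.

Definition ord4 (i : nat) : 'I_4 := inord i.

(* The coordinates 0, 1, 2, 3 are the entries (1,1), (1,2), (2,1), (2,2). *)
Definition SL2 (k : fieldType) : affine_scheme k 4 :=
  hypersurface ('X_(ord4 0) * 'X_(ord4 3) - 'X_(ord4 1) * 'X_(ord4 2) - 1).

Section Morphisms.
Context (k : fieldType).

(* Morphisms are given by tuples of polynomials on the ambient affine spaces;
   two tuples define the same morphism out of X when they agree modulo the
   ideal of X. *)
Definition is_morphism m n (X : affine_scheme k m) (Y : affine_scheme k n)
    (p : n.-tuple {mpoly k[m]}) : Prop :=
  forall q, ideal Y q -> ideal X (comp_mpoly p q).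

Definition eq_morphism m n (X : affine_scheme k m)
    (p p' : n.-tuple {mpoly k[m]}) : Prop :=
  forall i, ideal X (tnth p i - tnth p' i).

Definition id_morphism n : n.-tuple {mpoly k[n]} := [tuple 'X_i | i < n].

Definition comp_morphism l m n (q : n.-tuple {mpoly k[m]})
    (p : m.-tuple {mpoly k[l]}) : n.-tuple {mpoly k[l]} :=
  [tuple comp_mpoly p (tnth q i) | i < n].

Definition is_isomorphism m n (X : affine_scheme k m) (Y : affine_scheme k n)
    (p : n.-tuple {mpoly k[m]}) : Prop :=
  is_morphism X Y p /\
  exists q : m.-tuple {mpoly k[n]},
    [/\ is_morphism Y X q,
        eq_morphism X (comp_morphism q p) (id_morphism m) &
        eq_morphism Y (comp_morphism p q) (id_morphism n)].

Definition closed_subscheme n (Z Y : affine_scheme k n) : Prop :=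
  ideal Y `<=` ideal Z.

Definition closed_embedding m n (X : affine_scheme k m) (Y : affine_scheme k n)
    (p : n.-tuple {mpoly k[m]}) : Prop :=
  is_morphism X Y p /\
  exists Z : affine_scheme k n, closed_subscheme Z Y /\ is_isomorphism X Z p.

Definition equivalent_embeddings m n (X : affine_scheme k m)
    (Y : affine_scheme k n) (p p' : n.-tuple {mpoly k[m]}) : Prop :=
  exists phi : n.-tuple {mpoly k[n]},
    is_isomorphism Y Y phi /\ eq_morphism X p' (comp_morphism phi p).

Definition rational_points n (X : affine_scheme k n) : set 'rV[k]_n :=
  [set x | forall q, ideal X q -> meval (x 0) q = 0].

Definition on_points m n (p : n.-tuple {mpoly k[m]}) (x : 'rV[k]_m) :
    'rV[k]_n :=
  \row_i meval (x 0) (tnth p i).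

End Morphisms.

Definition tau (k : fieldType) : 4.-tuple {mpoly k[1]} :=
  let t : {mpoly k[1]} := 'X_ord0 in
  [tuple t ^+ 3 - 3 * t;
         t ^+ 4 - 4 * t ^+ 2 - 1;
         1 + 16^-1 *: (t ^+ 2 *
               (17 * t ^+ 6 - 56 * t ^+ 4 - 137 * t ^+ 2 + 452));
         16^-1 *: (t *
               (17 * t ^+ 8 - 73 * t ^+ 6 - 149 * t ^+ 4 + 609 * t ^+ 2 + 172))].

Definition tau1 (k : fieldType) : 4.-tuple {mpoly k[1]} :=
  let t : {mpoly k[1]} := 'X_ord0 in [tuple 1; 0; t; 1].

(* SL_2(R) minus the image of A^1(R) under p.  Real points are row vectors in
   R^4, whose library topology is the Euclidean one. *)
Definition SL2_complement (R : realType) (p : 4.-tuple {mpoly R[1]}) :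
    set 'rV[R]_4 :=
  rational_points (SL2 R) `\`
    (on_points p @` rational_points (affine_space R 1)).

Definition isomorphic_groups (G H : groupType) : Prop :=
  exists f : {multiplicative G -> H}, bijective f.

(* Universal property of a basis B; a multiplicative map between groups is a
   group homomorphism. *)
Definition free_group (G : groupType) : Prop :=
  exists B : set G, forall (H : groupType) (f : B -> H),
    exists phi : {multiplicative G -> H},
      (forall b : B, phi (\val b) = f b) /\
      forall psi : {multiplicative G -> H},
        (forall b : B, psi (\val b) = f b) -> psi =1 phi.

Lemma within_comp (X Y Z : topologicalType) (A : set X) (B : set Y)
    (f : X -> Y) (g : Y -> Z) :
  {within B, continuous g} -> {within A, continuous f} ->
  (forall x, A x -> B (f x)) -> {within A, continuous (g \o f)}.
Proof.
move=> /subspace_continuousP cg /subspace_continuousP cf AB.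
apply/subspace_continuousP => x Ax W /(cg _ (AB _ Ax)) gW.
rewrite /nbhs /= /within /=.
have := cf _ Ax _ gW; rewrite /nbhs /= /within /=.
by apply: filterS => y fy Ay; apply: fy => //; apply: AB.
Qed.

Lemma pair_continuous (X Y Z : topologicalType) (f : X -> Y) (g : X -> Z) :
  continuous f -> continuous g -> continuous (fun x => (f x, g x)).
Proof.
by move=> cf cg x; apply: (cvg_pair (G := nbhs (f x)) (H := nbhs (g x)));
  [exact: cf|exact: cg].
Qed.

Lemma continuous_minR (R : realType) (f g : R -> R) :
  continuous f -> continuous g -> continuous (fun t => Num.min (f t) (g t)).
Proof. by move=> cf cg t; exact: (@continuous_min R R f g t (cf t) (cg t)). Qed.

Lemma continuous_maxR (R : realType) (f g : R -> R) :
  continuous f -> continuous g -> continuous (fun t => Num.max (f t) (g t)).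
Proof. by move=> cf cg t; exact: (@continuous_max R R f g t (cf t) (cg t)). Qed.

Local Ltac lra_minmax :=
  repeat match goal with
  | |- context [Order.min ?a ?b] =>
      lazymatch a with context [Order.min _ _] => fail | _ => idtac end;
      case: (leP a b) => ?
  | |- context [Order.max ?a ?b] => case: (leP a b) => ?
  end; lra.

Lemma within_glue (R : realType) (X Y : topologicalType) (Q : set X)
    (u : X -> R) (c : R) (f g : X -> Y) :
  closed Q -> continuous u ->
  {within Q `&` [set x | u x <= c], continuous f} ->
  {within Q `&` [set x | c <= u x], continuous g} ->
  (forall x, Q x -> u x = c -> f x = g x) ->
  {within Q, continuous (fun x => if u x <= c then f x else g x)}.
Proof.
move=> clQ cu cf cg fg.
have -> : Q = (Q `&` [set x | u x <= c]) `|` (Q `&` [set x | c <= u x]).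
  rewrite -setIUr; apply/seteqP; split => x; last by case.
  by move=> Qx; split=> //; case: (leP (u x) c) => h; [left|right; exact: ltW].
apply: withinU_continuous.
- apply: closedI => //.
  by apply: (closed_comp (f := u) (fun x _ => cu x) (@closed_le R c)).
- apply: closedI => //.
  by apply: (closed_comp (f := u) (fun x _ => cu x) (@closed_ge R c)).
- apply: subspace_eq_continuous cf => x; rewrite inE => -[_ /= h].
  by rewrite /from_subspace h.
- apply: subspace_eq_continuous cg => x; rewrite inE => -[Qx /= h].
  rewrite /from_subspace.
  by case: ifP => // h'; rewrite (fg x) //; apply/eqP; rewrite eq_le h h'.
Qed.

(* The fundamental group of the subspace U of T at x0.  A loop is a function on
   R of which only the restriction to [0, 1] matters, and homotopies fix the
   end points. *)
Section FundamentalGroup.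
Context (R : realType) (T : topologicalType) (U : set T) (x0 : U).

Local Notation unit_itv := `[0 : R, 1]%classic.
Local Notation unit_square := (`[0 : R, 1]%classic `*` `[0 : R, 1]%classic).

Record loop := Loop {
  loop_fun :> R -> T;
  loop_continuous : {within unit_itv, continuous loop_fun};
  loop_in : forall t, 0 <= t <= 1 -> U (loop_fun t);
  loop0 : loop_fun 0 = \val x0;
  loop1 : loop_fun 1 = \val x0 }.

Arguments loop_continuous : clear implicits.
Arguments loop_in : clear implicits.
Arguments loop0 : clear implicits.
Arguments loop1 : clear implicits.

HB.instance Definition _ := gen_eqMixin loop.
HB.instance Definition _ := gen_choiceMixin loop.

Definition homotopic (f g : loop) : Prop := exists H : R * R -> T,
  [/\ {within unit_square, continuous H},
      forall s t, 0 <= s <= 1 -> 0 <= t <= 1 -> U (H (s, t)),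
      forall t, 0 <= t <= 1 -> H (0, t) = f t,
      forall t, 0 <= t <= 1 -> H (1, t) = g t &
      forall s, 0 <= s <= 1 -> H (s, 0) = \val x0 /\ H (s, 1) = \val x0].

Lemma itvP1 (t : R) : unit_itv t <-> 0 <= t <= 1.
Proof. by rewrite /= in_itv. Qed.

Lemma closed_square : closed unit_square.
Proof.
have -> : unit_square = (fst @^-1` unit_itv) `&` (snd @^-1` unit_itv) by [].
by apply: closedI; apply: closed_comp; try exact: itv_closed; move=> p _;
  [exact: cvg_fst|exact: cvg_snd].
Qed.

Lemma homotopic_reparam (g f1 f2 : loop) (phi psi : R -> R) :
  continuous phi -> continuous psi ->
  (forall t, 0 <= t <= 1 -> 0 <= phi t <= 1) ->
  (forall t, 0 <= t <= 1 -> 0 <= psi t <= 1) ->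
  phi 0 = psi 0 -> phi 1 = psi 1 ->
  (forall t, 0 <= t <= 1 -> f1 t = g (phi t)) ->
  (forall t, 0 <= t <= 1 -> f2 t = g (psi t)) ->
  homotopic f1 f2.
Proof.
move=> cphi cpsi Iphi Ipsi e0 e1 f1E f2E.
pose m (p : R * R) := (1 - p.1) * phi p.2 + p.1 * psi p.2.
have I0 : 0 <= (0 : R) <= 1 by rewrite lexx ler01.
have I1 : 0 <= (1 : R) <= 1 by rewrite lexx ler01.
have mI s t : 0 <= s <= 1 -> 0 <= t <= 1 -> 0 <= m (s, t) <= 1.
  move=> /andP[s0 s1] It; have /andP[a0 a1] := Iphi _ It.
  by have /andP[b0 b1] := Ipsi _ It; rewrite /m /=; apply/andP; split; nra.
exists (g \o m); split.
- apply: within_comp (loop_continuous g) _ _.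
    apply: continuous_subspaceT => p; rewrite /m.
    apply: cvgD; apply: cvgM; [|
      by apply: continuous_comp; [exact: cvg_snd|exact: cphi]
      |exact: cvg_fst|
      by apply: continuous_comp; [exact: cvg_snd|exact: cpsi]].
    by apply: cvgB; [exact: cvg_cst|exact: cvg_fst].
  by move=> [s t] [/= /itvP1 Is /itvP1 It]; apply/itvP1/mI.
- by move=> s t Is It; apply: loop_in; apply: mI.
- by move=> t It /=; rewrite f1E// /m /=; congr (g _); ring.
- by move=> t It /=; rewrite f2E// /m /=; congr (g _); ring.
- move=> s Is /=; split; [rewrite -(loop0 f1) f1E//|rewrite -(loop1 f1) f1E//].
    by rewrite /m /= -e0; congr (g _); ring.
  by rewrite /m /= -e1; congr (g _); ring.
Qed.

Lemma homotopic_refl f : homotopic f f.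
Proof. by apply: (@homotopic_reparam f f f id id) => // x; exact: cvg_id. Qed.

Lemma homotopic_sym f g : homotopic f g -> homotopic g f.
Proof.
case=> H [cH UH H0 H1 Hb]; exists (H \o (fun p => (1 - p.1, p.2))); split.
- apply: within_comp cH _ _.
    apply: continuous_subspaceT; apply: pair_continuous => p; last exact: cvg_snd.
    by apply: cvgB; [exact: cvg_cst|exact: cvg_fst].
  by move=> [s t] [/= /itvP1 Is /itvP1 It]; split; apply/itvP1 => //=; lra.
- by move=> s t Is It; apply: UH => //=; lra.
- by move=> t It /=; rewrite subr0 H1.
- by move=> t It /=; rewrite subrr H0.
- by move=> s Is /=; apply: Hb; lra.
Qed.

Lemma homotopic_trans f g h : homotopic f g -> homotopic g h -> homotopic f h.
Proof.
case=> H [cH UH H0 H1 Hb] [K [cK UK K0 K1 Kb]].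
pose a (p : R * R) := (2 * p.1, p.2); pose b (p : R * R) := (2 * p.1 - 1, p.2).
exists (fun p => if p.1 <= 2^-1 then H (a p) else K (b p)); split.
- apply: within_glue.
  + exact: closed_square.
  + by move=> p; exact: cvg_fst.
  + apply: within_comp cH _ _.
      apply: continuous_subspaceT; apply: pair_continuous => p; last exact: cvg_snd.
      by apply: cvgM; [exact: cvg_cst|exact: cvg_fst].
    move=> [s t] [[/= /itvP1 Is /itvP1 It] /= hs].
    by split; apply/itvP1 => //=; lra.
  + apply: within_comp cK _ _.
      apply: continuous_subspaceT; apply: pair_continuous => p; last exact: cvg_snd.
      apply: cvgB; last exact: cvg_cst.
      by apply: cvgM; [exact: cvg_cst|exact: cvg_fst].
    move=> [s t] [[/= /itvP1 Is /itvP1 It] /= hs].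
    by split; apply/itvP1 => //=; lra.
  + move=> [s t] [/= _ /itvP1 It] -> /=; rewrite /a /b /=.
    by rewrite divff ?pnatr_eq0// subrr H1// K0.
- by move=> s t Is It /=; case: (leP s 2^-1) => hs; [apply: UH|apply: UK] => //=; lra.
- by move=> t It /=; rewrite invr_ge0 ler0n /a /= mulr0 H0.
- move=> t It /=; rewrite ifN; last by rewrite -ltNge; lra.
  by rewrite /b /= -[X in (X, _)]/(2 * 1 - 1) (_ : 2 * 1 - 1 = 1) ?K1//; ring.
- by move=> s Is /=; case: (leP s 2^-1) => hs; [apply: Hb|apply: Kb] => /=; lra.
Qed.

Section Concat.
Variables f g : loop.

Definition concat_fun (t : R) :=
  if t <= 2^-1 then f (2 * t) else g (2 * t - 1).

Lemma concat_continuous : {within unit_itv, continuous concat_fun}.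
Proof.
apply: (within_glue (u := idfun) (f := f \o (fun t => 2 * t))
  (g := g \o (fun t => 2 * t - 1))).
- exact: itv_closed.
- by move=> p; exact: cvg_id.
- apply: within_comp (loop_continuous f) _ _.
    by apply: continuous_subspaceT => p; apply: cvgM; [exact: cvg_cst|exact: cvg_id].
  by move=> t [/itvP1 It /= ht]; apply/itvP1; lra.
- apply: within_comp (loop_continuous g) _ _.
    apply: continuous_subspaceT => p; apply: cvgB; last exact: cvg_cst.
    by apply: cvgM; [exact: cvg_cst|exact: cvg_id].
  by move=> t [/itvP1 It /= ht]; apply/itvP1; lra.
- by move=> t _ /= ->; rewrite divff ?pnatr_eq0// subrr loop1 loop0.
Qed.

Lemma concat_in t : 0 <= t <= 1 -> U (concat_fun t).
Proof.
by move=> It; rewrite /concat_fun; case: leP => ht; apply: loop_in; lra.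
Qed.

Lemma concat0 : concat_fun 0 = \val x0.
Proof. by rewrite /concat_fun invr_ge0 ler0n mulr0 loop0. Qed.

Lemma concat1 : concat_fun 1 = \val x0.
Proof.
rewrite /concat_fun ifN; last by rewrite -ltNge; lra.
by rewrite (_ : 2 * 1 - 1 = 1) ?loop1//; ring.
Qed.

Definition concat := Loop concat_continuous concat_in concat0 concat1.
End Concat.

Section Reverse.
Variable f : loop.

Lemma reverse_continuous : {within unit_itv, continuous (fun t => f (1 - t))}.
Proof.
rewrite -[X in continuous X]/(f \o (fun t => 1 - t)).
apply: within_comp (loop_continuous f) _ _.
  by apply: continuous_subspaceT => p; apply: cvgB; [exact: cvg_cst|exact: cvg_id].
by move=> t /itvP1 It; apply/itvP1; lra.
Qed.

Lemma reverse_in t : 0 <= t <= 1 -> U (f (1 - t)).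
Proof. by move=> It; apply: loop_in; lra. Qed.

Lemma reverse0 : f (1 - 0) = \val x0. Proof. by rewrite subr0 loop1. Qed.
Lemma reverse1 : f (1 - 1) = \val x0. Proof. by rewrite subrr loop0. Qed.

Definition reverse := Loop reverse_continuous reverse_in reverse0 reverse1.
End Reverse.

Lemma cst_continuous_within : {within unit_itv, continuous (fun=> \val x0)}.
Proof. by apply: continuous_subspaceT => t; exact: cvg_cst. Qed.

Definition cst_loop : loop :=
  Loop cst_continuous_within (fun _ _ => set_valP x0) erefl erefl.

Lemma concat_homotopic f f' g g' :
  homotopic f f' -> homotopic g g' -> homotopic (concat f g) (concat f' g').
Proof.
case=> H [cH UH H0 H1 Hb] [K [cK UK K0 K1 Kb]].
pose a (p : R * R) := (p.1, 2 * p.2); pose b (p : R * R) := (p.1, 2 * p.2 - 1).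
exists (fun p => if p.2 <= 2^-1 then H (a p) else K (b p)); split.
- apply: within_glue.
  + exact: closed_square.
  + by move=> p; exact: cvg_snd.
  + apply: within_comp cH _ _.
      apply: continuous_subspaceT; apply: pair_continuous => p; first exact: cvg_fst.
      by apply: cvgM; [exact: cvg_cst|exact: cvg_snd].
    move=> [s t] [[/= /itvP1 Is /itvP1 It] /= hs].
    by split; apply/itvP1 => //=; lra.
  + apply: within_comp cK _ _.
      apply: continuous_subspaceT; apply: pair_continuous => p; first exact: cvg_fst.
      apply: cvgB; last exact: cvg_cst.
      by apply: cvgM; [exact: cvg_cst|exact: cvg_snd].
    move=> [s t] [[/= /itvP1 Is /itvP1 It] /= hs].
    by split; apply/itvP1 => //=; lra.
  + move=> [s t] [/= /itvP1 Is _] -> /=; rewrite /a /b /=.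
    rewrite divff ?pnatr_eq0// subrr.
    by have [_ ->] := Hb _ Is; have [-> _] := Kb _ Is.
- by move=> s t Is It /=; case: (leP t 2^-1) => hs; [apply: UH|apply: UK] => //=; lra.
- move=> t It /=; rewrite /concat_fun /a /b; case: (leP t 2^-1) => hs;
    [rewrite H0|rewrite K0] => //=; lra.
- move=> t It /=; rewrite /concat_fun /a /b; case: (leP t 2^-1) => hs;
    [rewrite H1|rewrite K1] => //=; lra.
- move=> s Is /=; rewrite invr_ge0 ler0n ifN; last by rewrite -ltNge; lra.
  rewrite /a /b /= mulr0 (_ : 2 * 1 - 1 = 1); last by ring.
  by have [-> _] := Hb _ Is; have [_ ->] := Kb _ Is.
Qed.

Lemma reverse_homotopic f g :
  homotopic f g -> homotopic (reverse f) (reverse g).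
Proof.
case=> H [cH UH H0 H1 Hb]; exists (H \o (fun p => (p.1, 1 - p.2))); split.
- apply: within_comp cH _ _.
    apply: continuous_subspaceT; apply: pair_continuous => p; first exact: cvg_fst.
    by apply: cvgB; [exact: cvg_cst|exact: cvg_snd].
  by move=> [s t] [/= /itvP1 Is /itvP1 It]; split; apply/itvP1 => //=; lra.
- by move=> s t Is It; apply: UH => //=; lra.
- by move=> t It /=; rewrite H0//; lra.
- by move=> t It /=; rewrite H1//; lra.
- by move=> s Is /=; rewrite subr0 subrr; have [-> ->] := Hb _ Is.
Qed.

Lemma concatA f g h :
  homotopic (concat f (concat g h)) (concat (concat f g) h).
Proof.
pose phi (t : R) : R := Num.min (Num.min (2 * t) (t + 4^-1)) ((t + 1) / 2).
apply: (@homotopic_reparam (concat f (concat g h)) _ _ id phi).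
- by move=> t; exact: cvg_id.
- apply: continuous_minR; first apply: continuous_minR; move=> t.
  + by apply: cvgM; [exact: cvg_cst|exact: cvg_id].
  + by apply: cvgD; [exact: cvg_id|exact: cvg_cst].
  + apply: cvgM; last exact: cvg_cst.
    by apply: cvgD; [exact: cvg_id|exact: cvg_cst].
- by [].
- by move=> t It; rewrite /phi; lra_minmax.
- by rewrite /phi; lra_minmax.
- by rewrite /phi; lra_minmax.
- by [].
- move=> t It; rewrite /= /concat_fun /= /concat_fun /phi.
  have [t2|t2] := leP t 2^-1.
    have [t4|t4] := leP (2 * t) 2^-1.
      have -> : Num.min (Num.min (2 * t) (t + 4^-1)) ((t + 1) / 2) = 2 * t.
        by lra_minmax.
      by rewrite t4.
    have -> : Num.min (Num.min (2 * t) (t + 4^-1)) ((t + 1) / 2) = t + 4^-1.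
      by lra_minmax.
    rewrite ifN; last by rewrite -ltNge; lra.
    rewrite ifT; last lra.
    by congr (g _); field.
  have -> : Num.min (Num.min (2 * t) (t + 4^-1)) ((t + 1) / 2) = (t + 1) / 2.
    by lra_minmax.
  rewrite ifN; last by rewrite -ltNge; lra.
  rewrite ifN; last by rewrite -ltNge; lra.
  by congr (h _); field.
Qed.

Lemma concat1l f : homotopic (concat cst_loop f) f.
Proof.
pose phi (t : R) : R := Num.max 0 (2 * t - 1).
apply: (@homotopic_reparam f _ _ phi id).
- apply: continuous_maxR => t; first exact: cvg_cst.
  apply: cvgB; last exact: cvg_cst.
  by apply: cvgM; [exact: cvg_cst|exact: cvg_id].
- by move=> t; exact: cvg_id.
- by move=> t It; rewrite /phi; lra_minmax.
- by [].
- by rewrite /phi; lra_minmax.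
- by rewrite /phi; lra_minmax.
- move=> t It; rewrite /= /concat_fun /= /phi; case: leP => ht.
    by rewrite (_ : Num.max _ _ = 0) ?loop0//; lra_minmax.
  by congr (f _); lra_minmax.
- by [].
Qed.

Lemma concat1r f : homotopic (concat f cst_loop) f.
Proof.
pose phi (t : R) : R := Num.min 1 (2 * t).
apply: (@homotopic_reparam f _ _ phi id).
- apply: continuous_minR => t; first exact: cvg_cst.
  by apply: cvgM; [exact: cvg_cst|exact: cvg_id].
- by move=> t; exact: cvg_id.
- by move=> t It; rewrite /phi; lra_minmax.
- by [].
- by rewrite /phi; lra_minmax.
- by rewrite /phi; lra_minmax.
- move=> t It; rewrite /= /concat_fun /= /phi; case: leP => ht.
    by congr (f _); lra_minmax.
  by rewrite (_ : Num.min _ _ = 1) ?loop1//; lra_minmax.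
- by [].
Qed.

Lemma concatV f : homotopic (concat f (reverse f)) cst_loop.
Proof.
pose phi (t : R) : R := Num.min (2 * t) (2 - 2 * t).
apply: (@homotopic_reparam f _ _ phi (fun=> 0)).
- apply: continuous_minR => t.
    by apply: cvgM; [exact: cvg_cst|exact: cvg_id].
  apply: cvgB; first exact: cvg_cst.
  by apply: cvgM; [exact: cvg_cst|exact: cvg_id].
- by move=> t; exact: cvg_cst.
- by move=> t It; rewrite /phi; lra_minmax.
- by move=> t _; rewrite lexx ler01.
- by rewrite /phi; lra_minmax.
- by rewrite /phi; lra_minmax.
- move=> t It; rewrite /= /concat_fun /= /phi.
  by case: leP => ht; congr (f _); lra_minmax.
- by move=> t _; rewrite loop0.
Qed.

Lemma reverseK f : homotopic (reverse (reverse f)) f.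
Proof.
apply: (@homotopic_reparam f _ _ id id) => //; try by move=> t; exact: cvg_id.
by move=> t _ /=; congr (f _); ring.
Qed.

Lemma concatVl f : homotopic (concat (reverse f) f) cst_loop.
Proof.
apply: homotopic_trans (concatV (reverse f)).
by apply: concat_homotopic (homotopic_refl _) _; apply/homotopic_sym/reverseK.
Qed.

Definition homotopicb (f g : loop) : bool := `[< homotopic f g >].

Lemma homotopicb_equiv : equiv_class_of homotopicb.
Proof.
split=> [f|f g|g f h].
- exact/asboolP/homotopic_refl.
- by apply/asboolP/asboolP; exact: homotopic_sym.
- by move=> /asboolP fg /asboolP gh; apply/asboolP; exact: homotopic_trans gh.
Qed.

Canonical homotopy_equiv := EquivRelPack homotopicb_equiv.

Definition pi1 : Type := {eq_quot homotopy_equiv}.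
HB.instance Definition _ := Choice.on pi1.
HB.instance Definition _ := EqQuotient.on pi1.

Definition pi1_class (f : loop) : pi1 := \pi_pi1 f.
Definition pi1_mul (a b : pi1) : pi1 := pi1_class (concat (repr a) (repr b)).
Definition pi1_one : pi1 := pi1_class cst_loop.
Definition pi1_inv (a : pi1) : pi1 := pi1_class (reverse (repr a)).

Lemma pi1_classP f g : pi1_class f = pi1_class g <-> homotopic f g.
Proof.
split=> [/eqmodP/asboolP//|h].
by apply/eqmodP/asboolP.
Qed.

Lemma pi1_classK a : pi1_class (repr a) = a.
Proof. exact: reprK. Qed.

Lemma repr_pi1_class f : homotopic (repr (pi1_class f)) f.
Proof. by apply/pi1_classP; rewrite pi1_classK. Qed.

Lemma pi1_mul_class f g :
  pi1_mul (pi1_class f) (pi1_class g) = pi1_class (concat f g).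
Proof. by apply/pi1_classP; apply: concat_homotopic; exact: repr_pi1_class. Qed.

Lemma pi1_inv_class f : pi1_inv (pi1_class f) = pi1_class (reverse f).
Proof. by apply/pi1_classP/reverse_homotopic/repr_pi1_class. Qed.

Lemma pi1_mulA : associative pi1_mul.
Proof.
move=> a b c; rewrite -[a]pi1_classK -[b]pi1_classK -[c]pi1_classK.
by rewrite !pi1_mul_class; apply/pi1_classP/concatA.
Qed.

Lemma pi1_mul1 : left_id pi1_one pi1_mul.
Proof.
by move=> a; rewrite -[a]pi1_classK pi1_mul_class; apply/pi1_classP/concat1l.
Qed.

Lemma pi1_1mul : right_id pi1_one pi1_mul.
Proof.
by move=> a; rewrite -[a]pi1_classK pi1_mul_class; apply/pi1_classP/concat1r.
Qed.

Lemma pi1_mulVl : left_inverse pi1_one pi1_inv pi1_mul.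
Proof.
move=> a; rewrite -[a]pi1_classK pi1_inv_class pi1_mul_class.
exact/pi1_classP/concatVl.
Qed.

Lemma pi1_mulVr : right_inverse pi1_one pi1_inv pi1_mul.
Proof.
move=> a; rewrite -[a]pi1_classK pi1_inv_class pi1_mul_class.
exact/pi1_classP/concatV.
Qed.

HB.instance Definition _ :=
  isGroup.Build pi1 pi1_mulA pi1_mul1 pi1_1mul pi1_mulVl pi1_mulVr.

End FundamentalGroup.

Arguments pi1 R {T U} x0.

(* Main.v *)
Require Import Defs.
From mathcomp Require Import all_boot all_order all_algebra.
From mathcomp Require Import all_classical all_reals all_analysis.
From HB Require Import structures.
From mathcomp Require Import lra ring.
From mathcomp Require Import -(notations) mpoly.
From Corelib Require Import -(notations) Setoid Morphisms.

(* The first row of a matrix makes SL_2(R) a line bundle over R^2 minus 0, so it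
   is homeomorphic to (R^2 minus 0) x R; a suitable fibre coordinate turns tau into
   the polynomial knot (t^3 - 3t, t^4 - 4t^2 - 1, 115t - 11t^5) and tau_1 into a
   fibre. The complement of tau_1 is thus a twice punctured plane times R, and its
   group is free on two generators. The plane diagram of the knot is a trefoil with
   the origin in an unbounded region, so its complement, which also omits the axis
   over 0, has group <x, y, h | xyx = yxy>. Only half of this is needed: whenever
   elements x, y, h of a group G satisfy xyx = yxy, a flat G-bundle on the
   complement has them as holonomies of loops. For a suitable generalized dihedral
   group G these three elements do not lie in a subgroup generated by two elements,
   so the fundamental group is not free on two generators. Finally, tau is a closed
   embedding because t is a polynomial over Z[1/2] in its coordinates. *)

Import Order.TTheory GRing.Theory Num.Theory numFieldNormedType.Exports.
Local Open Scope classical_set_scope.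
Local Open Scope ring_scope.

Set Implicit Arguments.
Unset Strict Implicit.
Unset Printing Implicit Defensive.

(** * The fundamental groupoid *)

(** Both fundamental groups have abelianization Z^2, so abelian invariants cannot separate them. The
    trefoil group is itself generated by two elements; it is the omitted axis over the origin, with
    its free generator h, that raises the rank to three, and a finite quotient not generated by two
    elements detects this. As a quotient suffices, the knot side needs no presentation: a bundle is
    encoded by group-valued labels on finitely many charts, and each relation becomes a check of
    local constancy near a crossing. Holonomy asks of the charts only that they be open and cover,
    which allows the large pieces [Top] and [Bottom] of the knot complement; generation by chart
    loops asks for convex charts and serves the punctured plane. *)

Ltac lra_minmax :=
  repeat match goal with
  | |- context [Order.min ?a ?b] =>
      lazymatch a with context [Order.min _ _] => fail | _ => idtac end;
      case: (leP a b) => ?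
  | |- context [Order.max ?a ?b] =>
      lazymatch b with context [Order.min _ _] => fail | _ => idtac end;
      case: (leP a b) => ?
  end; lra.

Lemma within_setT (X Y : topologicalType) (f : X -> Y) :
  {within setT, continuous f} -> continuous f.
Proof. by rewrite continuous_subspace_setT. Qed.

Lemma continuous_glue (R : realType) (X Y : topologicalType)
    (u : X -> R) (c : R) (f g : X -> Y) :
  continuous u -> continuous f -> continuous g ->
  (forall x, u x = c -> f x = g x) ->
  continuous (fun x => if u x <= c then f x else g x).
Proof.
move=> cu cf cg fg; apply: within_setT; apply: within_glue => //.
- exact: continuous_subspaceT.
- exact: continuous_subspaceT.
- by move=> x _; exact: fg.
Qed.

Lemma continuous_affine (R : realType) (a b : R) :
  continuous (fun t : R => a * t + b).
Proof.
move=> t; apply: cvgD; last exact: cvg_cst.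
by apply: cvgM; [exact: cvg_cst|exact: cvg_id].
Qed.

Definition clamp (R : realType) (t : R) : R := Num.max 0 (Num.min 1 t).

Lemma clampP (R : realType) (t : R) : 0 <= clamp t <= 1.
Proof. by rewrite /clamp; lra_minmax. Qed.

Lemma clamp_id (R : realType) (t : R) : 0 <= t <= 1 -> clamp t = t.
Proof. by rewrite /clamp => ?; lra_minmax. Qed.

Lemma clamp0 (R : realType) : clamp (0 : R) = 0.
Proof. by rewrite clamp_id// lexx ler01. Qed.

Lemma clamp1 (R : realType) : clamp (1 : R) = 1.
Proof. by rewrite clamp_id// lexx ler01. Qed.

Lemma continuous_clamp (R : realType) : continuous (@clamp R).
Proof.
apply: continuous_maxR => [t|]; first exact: cvg_cst.
by apply: continuous_minR => t; [exact: cvg_cst|exact: cvg_id].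
Qed.

Section Paths.
Context (R : realType) (T : topologicalType) (U : set T).

(** Paths and homotopies are continuous, with values in [U], on the whole of R or R * R, so that
    continuity within a subset rarely has to be handled; [clamp] extends functions given on [0, 1]
    only. *)
Record cpath (x y : T) := CPath {
  cpath_fun :> R -> T;
  cpath_continuous : continuous cpath_fun;
  cpath_in : forall t, U (cpath_fun t);
  cpath0 : cpath_fun 0 = x;
  cpath1 : cpath_fun 1 = y }.

Definition cpath_homotopic x y (p q : cpath x y) : Prop :=
  exists H : R * R -> T,
  [/\ continuous H, forall z, U (H z),
      forall t, 0 <= t <= 1 -> H (0, t) = p t,
      forall t, 0 <= t <= 1 -> H (1, t) = q t &
      forall s, 0 <= s <= 1 -> H (s, 0) = x /\ H (s, 1) = y].

(** Straight-line homotopy between the real functions [phi] and [psi], carried into [U] by [g]. They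
    may leave [0, 1], as [g] lies in [U] on all of R. The groupoid laws are instances of this. *)
Lemma cpath_homotopic_reparam x y (g : R -> T) (p q : cpath x y) (phi psi : R -> R) :
  continuous g -> (forall t, U (g t)) ->
  continuous phi -> continuous psi ->
  phi 0 = psi 0 -> phi 1 = psi 1 ->
  (forall t, 0 <= t <= 1 -> p t = g (phi t)) ->
  (forall t, 0 <= t <= 1 -> q t = g (psi t)) ->
  cpath_homotopic p q.
Proof.
move=> cg Ug cphi cpsi e0 e1 pE qE.
pose m (z : R * R) := (1 - z.1) * phi z.2 + z.1 * psi z.2.
have I0 : 0 <= (0 : R) <= 1 by rewrite lexx ler01.
have I1 : 0 <= (1 : R) <= 1 by rewrite lexx ler01.
exists (g \o m); split.
- move=> z; apply: continuous_comp; last exact: cg.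
  apply: cvgD; apply: cvgM; [|
      by apply: continuous_comp; [exact: cvg_snd|exact: cphi]
      |exact: cvg_fst|
      by apply: continuous_comp; [exact: cvg_snd|exact: cpsi]].
  by apply: cvgB; [exact: cvg_cst|exact: cvg_fst].
- by move=> z; exact: Ug.
- by move=> t It /=; rewrite pE// /m /=; congr (g _); ring.
- by move=> t It /=; rewrite qE// /m /=; congr (g _); ring.
- move=> s Is /=; split.
    by rewrite -[RHS](cpath0 p) pE// /m /= -e0; congr (g _); ring.
  by rewrite -[RHS](cpath1 p) pE// /m /= -e1; congr (g _); ring.
Qed.

Lemma cpath_homotopic_refl x y (p : cpath x y) : cpath_homotopic p p.
Proof.
apply: (@cpath_homotopic_reparam _ _ p p p id id) => //; try by move=> ?; exact: cvg_id.
- exact: cpath_continuous.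
- exact: cpath_in.
Qed.

Lemma cpath_homotopic_ext x y (p q : cpath x y) : p =1 q -> cpath_homotopic p q.
Proof.
move=> pq; apply: (@cpath_homotopic_reparam _ _ p p q id id) => //;
  try by move=> ?; exact: cvg_id.
- exact: cpath_continuous.
- exact: cpath_in.
Qed.

Lemma cpath_homotopic_sym x y (p q : cpath x y) :
  cpath_homotopic p q -> cpath_homotopic q p.
Proof.
case=> H [cH UH H0 H1 Hb]; exists (H \o (fun z => (1 - z.1, z.2))); split.
- move=> z; apply: continuous_comp; last exact: cH.
  apply: (@pair_continuous (R * R)%type) => {}z; last exact: cvg_snd.
  by apply: cvgB; [exact: cvg_cst|exact: cvg_fst].
- by move=> z; exact: UH.
- by move=> t It /=; rewrite subr0 H1.
- by move=> t It /=; rewrite subrr H0.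
- by move=> s Is /=; apply: Hb; lra.
Qed.

Lemma cpath_homotopic_trans x y (p q r : cpath x y) :
  cpath_homotopic p q -> cpath_homotopic q r -> cpath_homotopic p r.
Proof.
case=> H [cH UH H0 H1 Hb] [K [cK UK K0 K1 Kb]].
(* [H] and [K] are known to agree only for t in [0, 1]; clamping t makes them agree on the whole
   line where they are glued. *)
pose c (z : R * R) := (z.1, clamp z.2).
have cc : continuous c.
  apply: (@pair_continuous (R * R)%type) => z; first exact: cvg_fst.
  by apply: continuous_comp; [exact: cvg_snd|exact: continuous_clamp].
pose a (z : R * R) := (2 * z.1, z.2); pose b (z : R * R) := (2 * z.1 - 1, z.2).
exists (fun z => if z.1 <= 2^-1 then H (c (a z)) else K (c (b z))); split.
- apply: continuous_glue.
  + by move=> z; exact: cvg_fst.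
  + move=> z; apply: continuous_comp; last exact: cH.
    apply: continuous_comp; last exact: cc.
    apply: (@pair_continuous (R * R)%type) => {}z; last exact: cvg_snd.
    by apply: cvgM; [exact: cvg_cst|exact: cvg_fst].
  + move=> z; apply: continuous_comp; last exact: cK.
    apply: continuous_comp; last exact: cc.
    apply: (@pair_continuous (R * R)%type) => {}z; last exact: cvg_snd.
    apply: cvgB; last exact: cvg_cst.
    by apply: cvgM; [exact: cvg_cst|exact: cvg_fst].
  + move=> z /= zE; rewrite /c /a /b /= zE divff ?pnatr_eq0// subrr H1 ?clampP//.
    by rewrite K0// clampP.
- by move=> z; case: ifP.
- move=> t It /=; rewrite invr_ge0 ler0n /c /a /= mulr0 clamp_id// H0//.
- move=> t It /=; rewrite ifN; last by rewrite -ltNge; lra.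
  rewrite /c /b /= (_ : _ - 1 = 1); last by rewrite -[X in X - 1]/(2 * 1); ring.
  by rewrite clamp_id// K1.
- move=> s Is /=; rewrite /c /=; case: (leP s 2^-1) => hs;
   rewrite clamp0 clamp1; [apply: Hb|apply: Kb] => /=; lra.
Qed.

Section Cat.
Variables (x y z : T) (p : cpath x y) (q : cpath y z).

Definition cpcat_fun (t : R) :=
  if t <= 2^-1 then p (2 * t) else q (2 * t - 1).

Lemma cpcat_continuous : continuous cpcat_fun.
Proof.
apply: (continuous_glue (u := idfun) (f := p \o (fun t => 2 * t))
  (g := q \o (fun t => 2 * t - 1))).
- by move=> ?; exact: cvg_id.
- move=> t; apply: continuous_comp; last exact: cpath_continuous.
  by apply: cvgM; [exact: cvg_cst|exact: cvg_id].
- move=> t; apply: continuous_comp; last exact: cpath_continuous.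
  exact: continuous_affine.
- by move=> t /= ->; rewrite divff ?pnatr_eq0// subrr cpath1 cpath0.
Qed.

Lemma cpcat_in t : U (cpcat_fun t).
Proof. by rewrite /cpcat_fun; case: ifP => _; exact: cpath_in. Qed.

Lemma cpcat0 : cpcat_fun 0 = x.
Proof. by rewrite /cpcat_fun invr_ge0 ler0n mulr0 cpath0. Qed.

Lemma cpcat1 : cpcat_fun 1 = z.
Proof.
rewrite /cpcat_fun ifN; last by rewrite -ltNge; lra.
by rewrite (_ : 2 * 1 - 1 = 1) ?cpath1//; ring.
Qed.

Definition cpcat := CPath cpcat_continuous cpcat_in cpcat0 cpcat1.
End Cat.

Section Inverse.
Variables (x y : T) (p : cpath x y).

Lemma cpinv_continuous : continuous (fun t : R => p (1 - t)).
Proof.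
move=> t; apply: (@continuous_comp R R T (fun t : R => 1 - t) p); last first.
  exact: cpath_continuous.
by apply: cvgB; [exact: cvg_cst|exact: cvg_id].
Qed.

Lemma cpinv0 : p (1 - 0) = y. Proof. by rewrite subr0 cpath1. Qed.
Lemma cpinv1 : p (1 - 1) = x. Proof. by rewrite subrr cpath0. Qed.

Definition cpinv := CPath cpinv_continuous (fun t => cpath_in p (1 - t)) cpinv0 cpinv1.
End Inverse.

Definition cpcst x (Ux : U x) : cpath x x :=
  CPath (@cst_continuous R T x) (fun=> Ux) erefl erefl.

Lemma cpcat_homotopic x y z (p p' : cpath x y) (q q' : cpath y z) :
  cpath_homotopic p p' -> cpath_homotopic q q' ->
  cpath_homotopic (cpcat p q) (cpcat p' q').
Proof.
case=> H [cH UH H0 H1 Hb] [K [cK UK K0 K1 Kb]].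
pose c (z : R * R) := (clamp z.1, z.2).
have cc : continuous c.
  apply: (@pair_continuous (R * R)%type) => w; last exact: cvg_snd.
  by apply: continuous_comp; [exact: cvg_fst|exact: continuous_clamp].
pose a (w : R * R) := (w.1, 2 * w.2); pose b (w : R * R) := (w.1, 2 * w.2 - 1).
exists (fun w => if w.2 <= 2^-1 then H (c (a w)) else K (c (b w))); split.
- apply: continuous_glue.
  + by move=> w; exact: cvg_snd.
  + move=> w; apply: continuous_comp; last exact: cH.
    apply: continuous_comp; last exact: cc.
    apply: (@pair_continuous (R * R)%type) => {}w; first exact: cvg_fst.
    by apply: cvgM; [exact: cvg_cst|exact: cvg_snd].
  + move=> w; apply: continuous_comp; last exact: cK.
    apply: continuous_comp; last exact: cc.
    apply: (@pair_continuous (R * R)%type) => {}w; first exact: cvg_fst.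
    apply: cvgB; last exact: cvg_cst.
    by apply: cvgM; [exact: cvg_cst|exact: cvg_snd].
  + move=> w /= wE; rewrite /c /a /b /= wE divff ?pnatr_eq0// subrr.
    by have [_ ->] := Hb _ (clampP w.1); have [-> _] := Kb _ (clampP w.1).
- by move=> w; case: ifP.
- move=> t It /=; rewrite /c /cpcat_fun /a /b /= clamp0; case: (leP t 2^-1) => hs;
    [rewrite H0|rewrite K0] => //=; lra.
- move=> t It /=; rewrite /c /cpcat_fun /a /b /= clamp1; case: (leP t 2^-1) => hs;
    [rewrite H1|rewrite K1] => //=; lra.
- move=> s Is /=; rewrite invr_ge0 ler0n ifN; last by rewrite -ltNge; lra.
  rewrite /c /a /b /= clamp_id// mulr0 (_ : 2 * 1 - 1 = 1); last by ring.
  by have [-> _] := Hb _ Is; have [_ ->] := Kb _ Is.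
Qed.

Lemma cpinv_homotopic x y (p q : cpath x y) :
  cpath_homotopic p q -> cpath_homotopic (cpinv p) (cpinv q).
Proof.
case=> H [cH UH H0 H1 Hb]; exists (H \o (fun z => (z.1, 1 - z.2))); split.
- move=> z; apply: continuous_comp; last exact: cH.
  apply: (@pair_continuous (R * R)%type) => {}z; first exact: cvg_fst.
  by apply: cvgB; [exact: cvg_cst|exact: cvg_snd].
- by move=> z; exact: UH.
- by move=> t It /=; rewrite H0//; lra.
- by move=> t It /=; rewrite H1//; lra.
- by move=> s Is /=; rewrite subr0 subrr; have [-> ->] := Hb _ Is.
Qed.

Lemma cpcatA x y z w (p : cpath x y) (q : cpath y z) (r : cpath z w) :
  cpath_homotopic (cpcat p (cpcat q r)) (cpcat (cpcat p q) r).
Proof.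
(* The right side runs through [p], [q], [r] in times 1/4, 1/4, 1/2, the left side in times 1/2,
   1/4, 1/4. The piecewise linear change of time has slopes 2, 1, 1/2; being concave, it is the
   minimum of its pieces. *)
pose phi (t : R) : R := Num.min (Num.min (2 * t) (t + 4^-1)) ((t + 1) / 2).
apply: (@cpath_homotopic_reparam _ _ (cpcat p (cpcat q r)) _ _ id phi).
- exact: cpath_continuous.
- exact: cpath_in.
- by move=> t; exact: cvg_id.
- apply: continuous_minR; first apply: continuous_minR; move=> t.
  + by apply: cvgM; [exact: cvg_cst|exact: cvg_id].
  + by apply: cvgD; [exact: cvg_id|exact: cvg_cst].
  + apply: cvgM; last exact: cvg_cst.
    by apply: cvgD; [exact: cvg_id|exact: cvg_cst].
- by rewrite /phi; lra_minmax.
- by rewrite /phi; lra_minmax.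
- by [].
- move=> t It; rewrite /= /cpcat_fun /= /cpcat_fun /phi.
  have [t2|t2] := leP t 2^-1.
    have [t4|t4] := leP (2 * t) 2^-1.
      have -> : Num.min (Num.min (2 * t) (t + 4^-1)) ((t + 1) / 2) = 2 * t.
        by lra_minmax.
      by rewrite t4.
    have -> : Num.min (Num.min (2 * t) (t + 4^-1)) ((t + 1) / 2) = t + 4^-1.
      by lra_minmax.
    rewrite ifN; last by rewrite -ltNge; lra.
    rewrite ifT; last lra.
    by congr (q _); field.
  have -> : Num.min (Num.min (2 * t) (t + 4^-1)) ((t + 1) / 2) = (t + 1) / 2.
    by lra_minmax.
  rewrite ifN; last by rewrite -ltNge; lra.
  rewrite ifN; last by rewrite -ltNge; lra.
  by congr (r _); field.
Qed.

Lemma cpcat1p x y (Ux : U x) (p : cpath x y) :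
  cpath_homotopic (cpcat (cpcst Ux) p) p.
Proof.
pose phi (t : R) : R := Num.max 0 (2 * t - 1).
apply: (@cpath_homotopic_reparam _ _ p _ _ phi id).
- exact: cpath_continuous.
- exact: cpath_in.
- apply: continuous_maxR => t; first exact: cvg_cst.
  exact: continuous_affine.
- by move=> t; exact: cvg_id.
- by rewrite /phi; lra_minmax.
- by rewrite /phi; lra_minmax.
- move=> t It; rewrite /= /cpcat_fun /= /phi; case: leP => ht.
    by rewrite (_ : Num.max _ _ = 0) ?cpath0//; lra_minmax.
  by congr (p _); lra_minmax.
- by [].
Qed.

Lemma cpcatp1 x y (Uy : U y) (p : cpath x y) :
  cpath_homotopic (cpcat p (cpcst Uy)) p.
Proof.
pose phi (t : R) : R := Num.min 1 (2 * t).
apply: (@cpath_homotopic_reparam _ _ p _ _ phi id).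
- exact: cpath_continuous.
- exact: cpath_in.
- apply: continuous_minR => t; first exact: cvg_cst.
  by apply: cvgM; [exact: cvg_cst|exact: cvg_id].
- by move=> t; exact: cvg_id.
- by rewrite /phi; lra_minmax.
- by rewrite /phi; lra_minmax.
- move=> t It; rewrite /= /cpcat_fun /= /phi; case: leP => ht.
    by congr (p _); lra_minmax.
  by rewrite (_ : Num.min _ _ = 1) ?cpath1//; lra_minmax.
- by [].
Qed.

Lemma cpcatpV x y (Ux : U x) (p : cpath x y) :
  cpath_homotopic (cpcat p (cpinv p)) (cpcst Ux).
Proof.
pose phi (t : R) : R := Num.min (2 * t) (2 - 2 * t).
apply: (@cpath_homotopic_reparam _ _ p _ _ phi (fun=> 0)).
- exact: cpath_continuous.
- exact: cpath_in.
- apply: continuous_minR => t.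
    by apply: cvgM; [exact: cvg_cst|exact: cvg_id].
  apply: cvgB; first exact: cvg_cst.
  by apply: cvgM; [exact: cvg_cst|exact: cvg_id].
- by move=> t; exact: cvg_cst.
- by rewrite /phi; lra_minmax.
- by rewrite /phi; lra_minmax.
- move=> t It; rewrite /= /cpcat_fun /= /phi.
  by case: leP => ht; congr (p _); lra_minmax.
- by move=> t _; rewrite cpath0.
Qed.

Lemma cpinvK x y (p : cpath x y) : cpath_homotopic (cpinv (cpinv p)) p.
Proof. by apply: cpath_homotopic_ext => t /=; congr (p _); ring. Qed.

Lemma cpcatVp x y (Uy : U y) (p : cpath x y) :
  cpath_homotopic (cpcat (cpinv p) p) (cpcst Uy).
Proof.
apply: cpath_homotopic_trans (cpcatpV Uy (cpinv p)).
by apply: cpcat_homotopic (cpath_homotopic_refl _) _; apply/cpath_homotopic_sym/cpinvK.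
Qed.

End Paths.

(** With these instances, identities in the fundamental groupoid are proved by rewriting up to
    homotopy. *)
#[export] Instance cpath_homotopic_equivalence (R : realType) (T : topologicalType)
  (U : set T) x y : Equivalence (@cpath_homotopic R T U x y).
Proof.
split; [exact: cpath_homotopic_refl|exact: cpath_homotopic_sym|].
exact: cpath_homotopic_trans.
Qed.

#[export] Instance cpcat_proper (R : realType) (T : topologicalType)
  (U : set T) x y z : Proper (respectful (@cpath_homotopic R T U x y)
    (respectful (@cpath_homotopic R T U y z) (@cpath_homotopic R T U x z)))
      (@cpcat R T U x y z).
Proof. by move=> p p' pp' q q' qq'; exact: cpcat_homotopic. Qed.

#[export] Instance cpinv_proper (R : realType) (T : topologicalType)
  (U : set T) x y : Proper (respectful (@cpath_homotopic R T U x y)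
    (@cpath_homotopic R T U y x)) (@cpinv R T U x y).
Proof. by move=> p p' pp'; exact: cpinv_homotopic. Qed.

Section PathClass.
Context (R : realType) (T : topologicalType) (U : set T) (x0 : U).

Local Notation loops := (cpath R U (\val x0) (\val x0)).

Definition cpath_loop (p : loops) : loop R x0 :=
  Loop (continuous_subspaceT (@cpath_continuous _ _ _ _ _ p)) (fun t _ =>
    cpath_in p t) (cpath0 p) (cpath1 p).

Definition cpath_class (p : loops) : pi1 R x0 := pi1_class (cpath_loop p).

Lemma loop_clamp_continuous (l : loop R x0) : continuous (l \o @clamp R).
Proof.
apply: within_setT; apply: within_comp (@loop_continuous _ _ _ _ l) _ _.
  exact/continuous_subspaceT/continuous_clamp.
by move=> t _; apply/itvP1/clampP.
Qed.

Lemma loop_clamp0 (l : loop R x0) : (l \o @clamp R) 0 = \val x0.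
Proof. by rewrite /= clamp0 loop0. Qed.

Lemma loop_clamp1 (l : loop R x0) : (l \o @clamp R) 1 = \val x0.
Proof. by rewrite /= clamp1 loop1. Qed.

Definition loop_cpath (l : loop R x0) : loops :=
  CPath (@loop_clamp_continuous l) (fun t => loop_in l (clampP t))
    (loop_clamp0 l) (loop_clamp1 l).

Lemma homotopic_ext (l l' : loop R x0) :
  (forall t, 0 <= t <= 1 -> l t = l' t) -> homotopic l l'.
Proof.
by move=> ll'; apply: (@homotopic_reparam _ _ _ _ l l l' id id) => // t;
   [exact: cvg_id|exact: cvg_id|move=> /ll'].
Qed.

Lemma cpath_class_surj (a : pi1 R x0) : exists p, a = cpath_class p.
Proof.
exists (loop_cpath (repr a)); rewrite -[LHS]pi1_classK; apply/pi1_classP.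
by apply: homotopic_ext => t It /=; rewrite clamp_id.
Qed.

Lemma cpath_classP (p q : loops) : cpath_class p =
  cpath_class q <-> cpath_homotopic p q.
Proof.
rewrite /cpath_class; rewrite pi1_classP; split; last first.
  case=> H [cH UH H0 H1 Hb]; exists H; split => //.
  exact: continuous_subspaceT.
case=> H [cH UH H0 H1 Hb].
pose c (z : R * R) := (clamp z.1, clamp z.2).
exists (H \o c); split.
- apply: within_setT; apply: within_comp cH _ _.
    apply: continuous_subspaceT; apply: (@pair_continuous (R * R)%type) => z.
      by apply: continuous_comp; [exact: cvg_fst|exact: continuous_clamp].
    by apply: continuous_comp; [exact: cvg_snd|exact: continuous_clamp].
  by move=> z _; split; apply/itvP1/clampP.
- by move=> z; apply: UH; exact: clampP.
- by move=> t It; rewrite /c /= clamp0 clamp_id// H0.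
- by move=> t It; rewrite /c /= clamp1 clamp_id// H1.
- by move=> s Is; rewrite /c /= clamp0 clamp1 clamp_id//; exact: Hb.
Qed.

Lemma cpath_class_cat (p q : loops) :
  cpath_class (cpcat p q) = (cpath_class p * cpath_class q)%g.
Proof.
rewrite [RHS]pi1_mul_class; apply/pi1_classP; exact: homotopic_ext.
Qed.

(** The source of homomorphisms out of [pi1]: a path is chosen in each class, and invariance of [F]
    makes the choice immaterial. *)
Lemma cpath_hom (G : groupType) (F : loops -> G) :
  (forall p q, cpath_homotopic p q -> F p = F q) ->
  (forall p q, F (cpcat p q) = (F p * F q)%g) ->
  exists phi : {multiplicative pi1 R x0 -> G}, forall p, phi (cpath_class p) = F p.
Proof.
move=> Fh FM.
have [r rK] := choice cpath_class_surj.
have phiM : {morph F \o r : a b / (a * b)%g}.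
  move=> a b /=; rewrite -FM; apply: Fh; apply/cpath_classP.
  by rewrite cpath_class_cat -!rK.
exists (HB.pack_for {multiplicative pi1 R x0 -> G} (F \o r)
  (isMultiplicative.Build _ _ (F \o r) phiM)).
by move=> p; apply: Fh; apply/cpath_classP; rewrite -rK.
Qed.

End PathClass.

Lemma isomorphic_of_inverse (G H : groupType) (f : {multiplicative G -> H})
  (g : H -> G) : cancel f g -> cancel g f -> isomorphic_groups G H.
Proof. by move=> fK gK; exists f; exists g. Qed.

Lemma isomorphic_sym (G H : groupType) :
  isomorphic_groups G H -> isomorphic_groups H G.
Proof.
case=> f [g fK gK].
have gM : {morph g : a b / (a * b)%g}.
  by move=> a b; apply: (can_inj fK); rewrite gK gmulfM !gK.
by exists (HB.pack_for {multiplicative H ->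
  G} g (isMultiplicative.Build _ _ g gM)); exists f.
Qed.

Lemma isomorphic_trans (G H K : groupType) :
  isomorphic_groups G H -> isomorphic_groups H K -> isomorphic_groups G K.
Proof. by case=> f bf [g bg]; exists (g \o f); exact: bij_comp. Qed.

(** * Change of base point and homeomorphisms *)

Section Maps.
Context (R : realType).

Section BaseChange.
Context (T : topologicalType) (U : set T) (x y : U) (c : cpath R U (\val x) (\val y)).

Lemma pi1_base_change : isomorphic_groups (pi1 R x) (pi1 R y).
Proof.
have Ux := set_valP x; have Uy := set_valP y.
pose F (p : cpath R U (\val x) (\val x)) := cpcat (cpinv c) (cpcat p c).
pose G (q : cpath R U (\val y) (\val y)) := cpcat c (cpcat q (cpinv c)).
have GF p : cpath_homotopic (G (F p)) p.
  rewrite /G /F -!cpcatA (cpcatpV Ux) (cpcatp1 Ux) cpcatA (cpcatpV Ux).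
  exact: cpcat1p.
have FG p : cpath_homotopic (F (G p)) p.
  rewrite /G /F -!cpcatA (cpcatVp Uy) (cpcatp1 Uy) cpcatA (cpcatVp Uy).
  exact: cpcat1p.
have Fh p q : cpath_homotopic p q -> cpath_homotopic (F p) (F q).
  by rewrite /F => ->; reflexivity.
have Gh p q : cpath_homotopic p q -> cpath_homotopic (G p) (G q).
  by rewrite /G => ->; reflexivity.
have FM p q : cpath_homotopic (F (cpcat p q)) (cpcat (F p) (F q)).
  rewrite /F -!cpcatA [cpcat c (cpcat _ _)]cpcatA (cpcatpV Ux) (cpcat1p Ux).
  reflexivity.
have GM p q : cpath_homotopic (G (cpcat p q)) (cpcat (G p) (G q)).
  rewrite /G -!cpcatA [cpcat (cpinv c) (cpcat _ _)]cpcatA (cpcatVp Uy) (cpcat1p Uy).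
  reflexivity.
have [|p q|phi phiE] := @cpath_hom _ _ _ x (pi1 R y) (@cpath_class _ _ _ y \o F).
- by move=> p q /Fh pq /=; exact/cpath_classP.
- by rewrite /= -cpath_class_cat; apply/cpath_classP.
have [|p q|psi psiE] := @cpath_hom _ _ _ y (pi1 R x) (@cpath_class _ _ _ x \o G).
- by move=> p q /Gh pq /=; exact/cpath_classP.
- by rewrite /= -cpath_class_cat; apply/cpath_classP.
apply: (isomorphic_of_inverse (f := phi) (g := psi)) => a.
  by have [p ->] := cpath_class_surj a; rewrite phiE psiE; apply/cpath_classP.
by have [p ->] := cpath_class_surj a; rewrite psiE phiE; apply/cpath_classP.
Qed.
End BaseChange.

Section Image.
Context (T T' : topologicalType) (U : set T) (U' : set T') (f : T -> T').
Hypothesis cf : {within U, continuous f}.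
Hypothesis fU : forall x, U x -> U' (f x).

Lemma within_continuous_comp (X : topologicalType) (p : X -> T) :
  continuous p -> (forall t, U (p t)) -> continuous (f \o p).
Proof.
move=> cp Up; apply: within_setT; apply: within_comp cf _ _ => //.
exact: continuous_subspaceT.
Qed.

Definition cpath_image x y x' y' (ex : f x = x') (ey : f y = y')
    (p : cpath R U x y) : cpath R U' x' y' :=
  CPath (within_continuous_comp (@cpath_continuous _ _ _ _ _ p) (@cpath_in _ _ _ _ _ p))
    (fun t => fU (cpath_in p t))
    (etrans (congr1 f (cpath0 p)) ex) (etrans (congr1 f (cpath1 p)) ey).

Lemma cpath_image_homotopic x y x' y' (ex : f x = x') (ey : f y = y') p q :
  cpath_homotopic p q -> cpath_homotopic (cpath_image ex ey p) (cpath_image ex ey q).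
Proof.
case=> H [cH UH H0 H1 Hb]; exists (f \o H); split.
- exact: within_continuous_comp.
- by move=> z; exact: fU.
- by move=> t It /=; rewrite H0.
- by move=> t It /=; rewrite H1.
- by move=> s Is /=; have [-> ->] := Hb _ Is.
Qed.

Lemma cpath_image_cat x y z x' y' z' (ex : f x = x') (ey : f y = y') (ez : f z = z')
   (p : cpath R U x y) (q : cpath R U y z) :
  cpath_homotopic (cpath_image ex ez (cpcat p q)) (cpcat (cpath_image ex ey p)
    (cpath_image ey ez q)).
Proof. by apply: cpath_homotopic_ext => t /=; rewrite /cpcat_fun /=; case: ifP. Qed.

End Image.

(** Everything is asked on [U] and [U'] only, because the inverse coordinates on SL_2 divide by a^2
    + b^2 and misbehave on the axis. *)
Lemma pi1_homeomorphic (T T' : topologicalType) (U : set T) (U' : set T')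
    (f : T -> T') (g : T' -> T) (x : U) (y : U') :
  {within U, continuous f} -> {within U', continuous g} ->
  (forall x, U x -> U' (f x)) -> (forall y, U' y -> U (g y)) ->
  (forall x, U x -> g (f x) = x) -> (forall y, U' y -> f (g y) = y) ->
  f (\val x) = \val y -> isomorphic_groups (pi1 R x) (pi1 R y).
Proof.
move=> cf cg fU gU gfK fgK fxy.
have gyx : g (\val y) = \val x by rewrite -fxy gfK//; exact: set_valP.
have [p q pq|p q|phi phiE] := @cpath_hom R _ _ x (pi1 R y)
    (@cpath_class _ _ _ y \o cpath_image cf fU fxy fxy).
- by apply/cpath_classP/cpath_image_homotopic.
- by rewrite /= -cpath_class_cat; apply/cpath_classP/cpath_image_cat.
have [p q pq|p q|psi psiE] := @cpath_hom R _ _ y (pi1 R x)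
    (@cpath_class _ _ _ x \o cpath_image cg gU gyx gyx).
- by apply/cpath_classP/cpath_image_homotopic.
- by rewrite /= -cpath_class_cat; apply/cpath_classP/cpath_image_cat.
apply: (isomorphic_of_inverse (f := phi) (g := psi)) => a.
  have [p ->] := cpath_class_surj a; rewrite phiE psiE; apply/cpath_classP.
  by apply: cpath_homotopic_ext => t /=; rewrite gfK//; exact: cpath_in.
have [p ->] := cpath_class_surj a; rewrite psiE phiE; apply/cpath_classP.
by apply: cpath_homotopic_ext => t /=; rewrite fgK//; exact: cpath_in.
Qed.

End Maps.

(** * Holonomy of flat bundles *)

(** The points of [a, b] where [P] holds form a set that is both open and closed, and an interval is
    connected. This principle replaces all subdivisions of paths into small pieces. *)
Lemma itv_locally_constant (R : realType) (P : R -> Prop) (a b : R) : a <= b ->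
  (forall t, a <= t <= b -> \forall t' \near t, a <= t' <= b -> (P t' <-> P t)) ->
  P a -> P b.
Proof.
move=> ab Ploc Pa.
have itvP t : `[a, b]%classic t <-> a <= t <= b by rewrite /= in_itv.
(* Both sets contain everything outside [a, b], so that their interiors in R witness openness
   relative to [a, b]. *)
pose C := [set t | `[a, b]%classic t -> ~ P t].
pose D := [set t | `[a, b]%classic t -> P t].
have PD t : P t -> `[a, b]%classic t -> D^° t.
  move=> Pt /itvP /Ploc; rewrite /interior /=; apply: filterS => t' h /itvP /h.
  by case=> _; exact.
have PC t : ~ P t -> `[a, b]%classic t -> C^° t.
  move=> Pt /itvP /Ploc; rewrite /interior /=; apply: filterS => t' h /itvP /h.
  by case=> h1 _ /h1.
have I0 : `[a, b]%classic a by apply/itvP; rewrite lexx ab.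
have I1 : `[a, b]%classic b by apply/itvP; rewrite lexx ab.
suff : [set t | `[a, b]%classic t /\ P t] = `[a, b]%classic.
  by move=> h; move: (I1); rewrite -h => -[].
apply: segment_connected; first by exists a.
- exists D^°; first exact: open_interior.
  apply/seteqP; split => t; first by case=> It Pt; split => //; exact: PD.
  by case=> It /interior_subset; rewrite /D /=; move/(_ It).
- exists (~` C^°); first by apply: open_closedC; exact: open_interior.
  apply/seteqP; split => t.
    by case=> It Pt; split => // /interior_subset; rewrite /C /= => /(_ It).
  case=> It Ct; split => //; apply: contrapT => nP; apply: Ct; exact: PC.
Qed.

Lemma continuous_near (X Y : topologicalType) (p : X -> Y) (t : X) (Q : Y -> Prop) :
  continuous p -> (\forall y \near p t, Q y) -> \forall t' \near t, Q (p t').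
Proof. by move=> cp h; exact: (cp t Q h). Qed.

(* The functions [f i] are trivializations, relative to a fictitious global one,
   of a flat G-bundle over U: they may jump, but their quotients are locally
   constant on overlaps of charts. *)
Section Holonomy.
Context (R : realType) (T : topologicalType) (U : set T) (G : groupType) (I : Type).
Context (V : I -> set T) (f : I -> T -> G).
Hypothesis Vcover : forall x, U x -> exists i, V i x.
Hypothesis Vopen : forall i x, V i x -> nbhs x (V i).
Hypothesis floc : forall i j x, U x -> V i x -> V j x ->
  \forall y \near x, U y -> ((f i y)^-1 * f j y = (f i x)^-1 * f j x)%g.

(** Parallel transport: [s] is the lift in the fictitious global trivialization, [s t * f i (p t)]
    its coordinate in chart [i], and a lift is horizontal when its chart coordinates are locally
    constant. *)
Definition holonomy_lift (p : R -> T) (b : R) (s : R -> G) := forall i t,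
  0 <= t <= b -> V i (p t) ->
  \forall t' \near t, 0 <= t' <= b -> (s t' * f i (p t') = s t * f i (p t))%g.

Lemma holonomy_lift_chart (p : R -> T) b s i c d :
  holonomy_lift p b s -> 0 <= c -> c <= d -> d <= b ->
  (forall t, c <= t <= d -> V i (p t)) ->
  (s d * f i (p d) = s c * f i (p c))%g.
Proof.
move=> ls c0 cd db Vp.
apply: (itv_locally_constant (P := fun t =>
  (s t * f i (p t) = s c * f i (p c))%g) cd) => //.
move=> t It; have It0 : 0 <= t <= b by lra.
have := ls i t It0 (Vp t It); apply: filterS => t' h It'; rewrite h//; lra.
Qed.

Section OnePath.
Context (p : R -> T).
Hypothesis cp : continuous p.
Hypothesis Up : forall t, U (p t).

Lemma floc_path i j t : V i (p t) -> V j (p t) ->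
  \forall t' \near t, ((f i (p t'))^-1 * f j (p t') = (f i (p t))^-1 * f j (p t))%g.
Proof.
move=> Vi Vj; have := continuous_near cp (floc (Up t) Vi Vj).
by apply: filterS => t' /(_ (Up t')).
Qed.

Lemma holonomy_lift_uniq b s s' : 0 <= b ->
  holonomy_lift p b s -> holonomy_lift p b s' -> s 0 = s' 0 -> s b = s' b.
Proof.
move=> b0 ls ls' s0; apply: (itv_locally_constant (P := fun t => s t = s' t) b0) => //.
move=> t It; have [i Vi] := Vcover (Up t).
have {}ls := ls i t It Vi; have {}ls' := ls' i t It Vi.
near=> t' => It'.
have e : (s t' * f i (p t') = s t * f i (p t))%g by move: It'; near: t'.
have e' : (s' t' * f i (p t') = s' t * f i (p t))%g by move: It'; near: t'.
split=> /= ss.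
  by apply: (mulIg (f i (p t))); rewrite -e -e' ss.
by apply: (mulIg (f i (p t'))); rewrite e e' ss.
Unshelve. all: by end_near. Qed.

(** A lift is shortened by restriction, and lengthened within one chart by keeping its coordinate
    there constant. Both directions are needed to show that existence of a lift is a locally
    constant property of its length. *)
Lemma holonomy_lift_extend i b c s : 0 <= b -> 0 <= c ->
  (forall t, Num.min b c <= t <= Num.max b c -> V i (p t)) ->
  holonomy_lift p b s -> exists2 s', holonomy_lift p c s' & s' 0 = s 0.
Proof.
move=> b0 c0; have [cb|bc] := leP c b.
  move=> _ ls; exists s => // j t It Vj.
  have Itb : 0 <= t <= b by lra.
  have := ls j t Itb Vj; apply: filterS => t' h It'; apply: h; lra.
move=> Vp ls.
pose s' t : G := if t <= b then s t else (s b * f i (p b) * (f i (p t))^-1)%g.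
exists s'; last by rewrite /s' b0.
have s'E t : b <= t -> s' t = (s b * f i (p b) * (f i (p t))^-1)%g.
  rewrite /s'; case: (leP t b) => // tb bt.
  have -> : t = b by apply/le_anti; rewrite tb bt.
  by rewrite mulgK.
move=> j t /andP[t0 tc] Vj.
have [tb|bt] := ltP t b.
  have Itb : 0 <= t <= b by lra.
  have h := ls j t Itb Vj.
  near=> t' => /andP[t0' tc'].
  have tb' : t' < b by near: t'; exact: lt_nbhsl.
  rewrite /s' (ltW tb) (ltW tb').
  suff: 0 <= t' <= b -> (s t' * f j (p t') = s t * f j (p t))%g.
    by apply; rewrite t0' (ltW tb').
  by near: t'.
have hi : \forall t' \near t, b <= t' -> (s' t' * f j (p t') = s' t * f j (p t))%g.
  have Vi : V i (p t) by apply: Vp; rewrite bt tc.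
  have := floc_path Vi Vj; apply: filterS => t' h bt'.
  by rewrite !s'E// -!mulgA h.
have lo : \forall t' \near t, 0 <= t' <= b -> (s' t' * f j (p t') = s' t * f j (p t))%g.
  move: bt; rewrite le_eqVlt => /predU1P[bt|bt].
    have Itb : 0 <= t <= b by lra.
    have := ls j t Itb Vj; apply: filterS => t' h It'; rewrite /s'.
    by case/andP: (It') => _ ->; case/andP: Itb => _ ->; exact: h.
  near=> t' => /andP[_]; rewrite leNgt => /negP[]; near: t'; exact: lt_nbhsr.
near=> t' => /andP[t0' tc'].
have [tb|bt'] := leP t' b; last by move: (ltW bt'); near: t'.
suff: 0 <= t' <= b -> (s' t' * f j (p t') = s' t * f j (p t))%g by apply; rewrite t0'.
by near: t'.
Unshelve. all: by end_near. Qed.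

Lemma near_chart i t : V i (p t) -> \forall t' \near t,
  forall u, Num.min t t' <= u <= Num.max t t' -> V i (p u).
Proof.
move=> /Vopen /(continuous_near cp) /nbhs_ballP[e /= e0 he]; near=> t' => u hu.
apply: he; have : ball t e t' by near: t'; exact: nbhsx_ballx.
rewrite /ball /=; move: hu; case: (leP t t') => ? /andP[? ?];
  rewrite !ltr_norml => /andP[? ?];
 apply/andP; split; lra.
Unshelve. all: by end_near. Qed.

Lemma holonomy_lift_exists b : 0 <= b -> exists2 s, holonomy_lift p b s & s 0 = 1%g.
Proof.
move=> b0; apply: (itv_locally_constant
   (P := fun b => exists2 s, holonomy_lift p b s & s 0 = 1%g) b0); last first.
  exists (fun=> 1%g) => // i t It Vi; near=> t' => It'.
  by have -> : t' = t by lra.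
move=> t /andP[t0 tb]; have [i Vi] := Vcover (Up t).
near=> t' => /andP[t0' tb'].
have Vt : forall u, Num.min t t' <= u <= Num.max t t' -> V i (p u).
  by near: t'; exact: near_chart.
split=> /= -[s ls s0].
  have Vt' u : Num.min t' t <= u <= Num.max t' t -> V i (p u).
    by rewrite minC maxC; exact: Vt.
  have [s' ls' s0'] := holonomy_lift_extend t0' t0 Vt' ls.
  by exists s' => //; rewrite s0'.
have [s' ls' s0'] := holonomy_lift_extend t0 t0' Vt ls.
by exists s' => //; rewrite s0'.
Unshelve. all: by end_near. Qed.

End OnePath.

Definition holonomy x y (p : cpath R U x y) : G :=
  projT1 (cid2 (holonomy_lift_exists (@cpath_continuous _ _ _ _ _ p) (cpath_in
    p) ler01)) 1.

Lemma holonomyE x y (p : cpath R U x y) s :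
  holonomy_lift p 1 s -> s 0 = 1%g -> holonomy p = s 1.
Proof.
rewrite /holonomy; case: cid2 => s' /= ls' s0' ls s0.
apply: (@holonomy_lift_uniq p) ls' ls _ => //; first exact: cpath_in.
by rewrite s0' s0.
Qed.

Lemma holonomy_chart x y (p : cpath R U x y) i :
  (forall t, 0 <= t <= 1 -> V i (p t)) -> holonomy p = (f i x * (f i y)^-1)%g.
Proof.
move=> Vp; rewrite /holonomy; case: cid2 => s /= ls s0.
have := holonomy_lift_chart ls (lexx 0) ler01 (lexx 1) Vp.
by rewrite s0 mul1g cpath0 cpath1 => <-; rewrite mulgK.
Qed.

Lemma near_affine (a b t : R) (Q : R -> Prop) :
  (\forall u \near a * t + b, Q u) -> \forall u \near t, Q (a * u + b).
Proof. by move=> h; apply: (continuous_near (@continuous_affine R a b) h). Qed.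

Lemma holonomy_cat x y z (p : cpath R U x y) (q : cpath R U y z) :
  holonomy (cpcat p q) = (holonomy p * holonomy q)%g.
Proof.
have [sp lp p0] := holonomy_lift_exists (@cpath_continuous _ _ _ _ _ p)
  (cpath_in p) ler01.
have [sq lq q0] := holonomy_lift_exists (@cpath_continuous _ _ _ _ _ q)
  (cpath_in q) ler01.
rewrite (holonomyE lp p0) (holonomyE lq q0).
(* Left multiplication by a constant preserves lifts, so the lift along [q] can be made to start
   where the one along [p] ends. *)
pose s t : G := if t <= 2^-1 then sp (2 * t) else (sp 1%R * sq (2 * t - 1)%R)%g.
rewrite (@holonomyE _ _ _ s).
- rewrite /s ifN; last by rewrite -ltNge; lra.
  by congr (_ * sq _)%g; ring.
- have sE t : 2^-1 <= t ->
  s t = (sp 1%R * sq (2 * t - 1)%R)%g /\ cpcat p q t = q (2 * t - 1).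
    rewrite /s /= /cpcat_fun; case: (leP t 2^-1) => // h h'.
    have -> : t = 2^-1 by lra.
    by rewrite divff ?pnatr_eq0// subrr q0 mulg1 cpath0 cpath1.
  have sE' t : t <= 2^-1 -> s t = sp (2 * t) /\ cpcat p q t = p (2 * t).
    by move=> h; rewrite /s /= /cpcat_fun h.
  move=> i t It Vi.
  have lo : \forall t' \near t, t' <= 2^-1 -> 0 <= t' <= 1 ->
    (s t' * f i (cpcat p q t') = s t * f i (cpcat p q t))%g.
    have [ht|ht] := leP t 2^-1; last first.
      by near=> t' => h; exfalso; move: h; apply/negP; rewrite -ltNge;
        near: t'; exact: lt_nbhsr.
    move: Vi; have [-> ->] := sE' _ ht => Vi.
    have h : 0 <= 2 * t <= 1 by lra.
    have := lp i (2 * t) h Vi; rewrite -{1}[2 * t]addr0 => /near_affine.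
    apply: filterS => t' {}h h2 It'.
    have [-> ->] := sE' _ h2; rewrite addr0 in h; apply: h; lra.
  have hi : \forall t' \near t, 2^-1 <= t' -> 0 <= t' <= 1 ->
    (s t' * f i (cpcat p q t') = s t * f i (cpcat p q t))%g.
    have [ht|ht] := leP 2^-1 t; last first.
      by near=> t' => h; exfalso; move: h; apply/negP; rewrite -ltNge;
        near: t'; exact: lt_nbhsl.
    move: Vi; have [-> ->] := sE _ ht => Vi.
    have h : 0 <= 2 * t - 1 <= 1 by lra.
    have /near_affine := lq i (2 * t - 1) h Vi.
    apply: filterS => t' {}h h2 It'.
    have [-> ->] := sE _ h2; rewrite -!mulgA; congr (_ * _)%g; apply: h; lra.
  near=> t' => It'; have [h|h] := leP t' 2^-1.
    by move: h It'; near: t'.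
  by move: (ltW h) It'; near: t'.
- by rewrite /s invr_ge0 ler0n mulr0.
Unshelve. all: by end_near. Qed.

(** Monodromy theorem. Each slice [h s] of the homotopy is lifted; the lifts over slices near a
    given one agree in chart coordinates, which is propagated from t = 0 to t = 1. So the final
    value is locally constant in s. *)
Lemma holonomy_homotopic x y (p q : cpath R U x y) :
  cpath_homotopic p q -> holonomy p = holonomy q.
Proof.
case=> H [cH UH H0 H1 Hb].
pose h s : R -> T := fun t => H (clamp s, t).
have ch s : continuous (h s).
  move=> t; apply: (@continuous_comp R (R * R)%type T (fun t =>
    (clamp s, t)) H); last exact: cH.
  by apply: (@pair_continuous R) => {}t; [exact: cvg_cst|exact: cvg_id].
have ch' t : continuous (h^~ t).
  move=> s; apply: (@continuous_comp R (R * R)%type T (fun s =>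
    (clamp s, t)) H); last exact: cH.
  by apply: (@pair_continuous R) => {}s; [exact: continuous_clamp|exact: cvg_cst].
have Uh s t : U (h s t) by exact: UH.
have h0 s : h s 0 = x by have [] := Hb _ (clampP s).
have h1 s : h s 1 = y by have [] := Hb _ (clampP s).
pose k s : cpath R U x y := CPath (ch s) (Uh s) (h0 s) (h1 s).
have [|l lP] := choice (P := fun s l => holonomy_lift (h s) 1 l /\ l 0 = 1%g).
  move=> s; by have [l ? ?] := holonomy_lift_exists (ch s) (Uh s) ler01; exists l.
have kE s : holonomy (k s) = l s 1 by have [? ?] := lP s;
  rewrite (@holonomyE _ _ _ (l s)).
have -> : holonomy p = holonomy (k 0).
  rewrite kE; have [l0 l00] := lP 0; apply: holonomyE => // i t It.
  have e u : 0 <= u <= 1 -> h 0 u = p u by move=> Iu; rewrite /h clamp0 H0.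
  rewrite -e// => Vi; have := l0 i t It Vi.
  by apply: filterS => t' {}h' It'; rewrite -e//; exact: h'.
have -> : holonomy q = holonomy (k 1).
  rewrite kE; have [l1 l10] := lP 1; apply: holonomyE => // i t It.
  have e u : 0 <= u <= 1 -> h 1 u = q u by move=> Iu; rewrite /h clamp1 H1.
  rewrite -e// => Vi; have := l1 i t It Vi.
  by apply: filterS => t' {}h' It'; rewrite -e//; exact: h'.
rewrite !kE; apply/esym.
apply: (itv_locally_constant (P := fun s => l s 1 = l 0 1) ler01) => // s0 _.
(* The neighbourhood of [s0] may depend on t: connectedness of [0, 1] carries the property to t = 1,
   without a uniform choice. *)
pose E i t := \forall s \near s0, (l s t * f i (h s t) = l s0 t * f i (h s0 t))%g.
have Eij i j t : V i (h s0 t) -> V j (h s0 t) -> E i t -> E j t.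
  move=> Vi Vj Ei; near=> s.
  have ei : (l s t * f i (h s t) = l s0 t * f i (h s0 t))%g by near: s.
  have eij : ((f i (h s t))^-1 * f j (h s t) = (f i (h s0 t))^-1 * f j (h s0 t))%g.
    by near: s; exact: (floc_path (ch' t) (fun s => Uh s t)).
  by rewrite -[f j (h s t)](mulVKg (f i (h s t))) eij mulgA ei -mulgA mulVKg.
suff : exists2 i, V i (h s0 1) & E i 1.
  case=> i _ Ei; near=> s => _.
  suff -> : l s 1 = l s0 1 by [].
  apply: (mulIg (f i y)); rewrite -{1}(h1 s) -(h1 s0).
  by near: s.
apply: (itv_locally_constant (P := fun t =>
  exists2 i, V i (h s0 t) & E i t) ler01); last first.
  have [i Vi] := Vcover (Uh s0 0); exists i => //; near=> s.
  by have [_ ->] := lP s; have [_ ->] := lP s0; rewrite !h0.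
move=> t It; have [i Vi] := Vcover (Uh s0 t).
pose hh z := H (clamp z.1, z.2).
have chh : continuous hh.
  move=> z; apply: (@continuous_comp (R * R)%type (R * R)%type T (fun z =>
    (clamp z.1, z.2)) H); last exact: cH.
  apply: (@pair_continuous (R * R)%type) => {}z; last exact: cvg_snd.
  by apply: continuous_comp; [exact: cvg_fst|exact: continuous_clamp].
have /nbhs_ballP[e /= e0 he] : nbhs (s0, t) [set z | V i (hh z)].
  by apply: (continuous_near chh (t := (s0, t))); apply: Vopen.
have hV s u : `|s0 - s| < e -> `|t - u| < e -> V i (h s u).
  by move=> hs hu; apply: (he (s, u)).
have E_iff t' : 0 <= t' <= 1 -> `|t - t'| < e -> E i t' <-> E i t.
  move=> It' tt'.
  have e1 s : `|s0 - s| < e -> (l s t * f i (h s t) = l s t' * f i (h s t'))%g.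
    move=> hs; have [ls _] := lP s.
    have [ttt|/ltW ttt] := leP t t'; [apply/esym|];
      apply: (holonomy_lift_chart ls) ttt _ _; try lra;
      by move=> u Iu; apply: hV => //; move: tt'; rewrite !ltr_norml => /andP[? ?]; lra.
  have hs0 : `|s0 - s0| < e by rewrite subrr normr0.
  split=> Et; near=> s; have hs : `|s0 - s| < e.
  - by near: s; exact: (nbhsx_ballx s0 e e0).
  - by rewrite !e1//; near: s.
  - by near: s; exact: (nbhsx_ballx s0 e e0).
  - by rewrite -!e1//; near: s.
near=> t' => It'.
have tt' : `|t - t'| < e by near: t'; exact: (nbhsx_ballx t e e0).
have Vi' : V i (h s0 t') by apply: hV => //; rewrite subrr normr0.
split => -[j Vj Ej]; exists i => //.
  by apply/(E_iff t') => //; exact: Eij Vj Vi' Ej.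
by apply/(E_iff t') => //; exact: Eij Vj Vi Ej.
Unshelve. all: by end_near. Qed.

Lemma holonomy_hom (x0 : U) : exists phi : {multiplicative pi1 R x0 -> G},
  forall p, phi (cpath_class p) = holonomy p.
Proof.
by apply: cpath_hom => p q; [exact: holonomy_homotopic|exact: holonomy_cat].
Qed.

End Holonomy.

(** * Segments and generation of the fundamental group *)

Section Continuity.
Context (R : realType) (X : topologicalType).
Implicit Types f g : X -> R.

Lemma continuousD f g : continuous f -> continuous g -> continuous (fun x => f x + g x).
Proof. by move=> cf cg x; apply: cvgD; [exact: cf|exact: cg]. Qed.

Lemma continuousN f : continuous f -> continuous (fun x => - f x).
Proof. by move=> cf x; apply: cvgN; exact: cf. Qed.

Lemma continuousM f g : continuous f -> continuous g -> continuous (fun x => f x * g x).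
Proof. by move=> cf cg x; apply: cvgM; [exact: cf|exact: cg]. Qed.

Lemma near_lt f g x : continuous f -> continuous g -> f x < g x ->
  \forall y \near x, f y < g y.
Proof.
move=> cf cg fg; have ch := continuousD cg (continuousN cf).
have : \forall z \near g x - f x, 0 < z by apply: lt_nbhsr; rewrite subr_gt0.
by move/(continuous_near ch (t := x)); apply: filterS => y; rewrite subr_gt0.
Qed.
End Continuity.

Section Space.
Context (R : realType).
Local Notation E3 := (R * R * R)%type.

Lemma continuous_a : continuous (fun p : E3 => p.1.1).
Proof.
move=> p; apply: (@continuous_comp E3 (R * R)%type R fst fst); exact: cvg_fst.
Qed.

Lemma continuous_b : continuous (fun p : E3 => p.1.2).
Proof.
move=> p; apply: (@continuous_comp E3 (R * R)%type R fst snd);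
  [exact: cvg_fst|exact: cvg_snd].
Qed.

Lemma continuous_z : continuous (fun p : E3 => p.2).
Proof. by move=> p; exact: cvg_snd. Qed.

Definition lin (p q : E3) (c : R) : E3 :=
  ((1 - c) * p.1.1 + c * q.1.1, (1 - c) * p.1.2 + c * q.1.2, (1 - c) * p.2 + c * q.2).

Lemma lin0 p q : lin p q 0 = p.
Proof. by case: p => -[a b] z; rewrite /lin /= subr0 !mul1r !mul0r !addr0. Qed.

Lemma lin1 p q : lin p q 1 = q.
Proof. by case: q => -[a b] z; rewrite /lin /= subrr !mul1r !mul0r !add0r. Qed.

Lemma linpp p c : lin p p c = p.
Proof. by case: p => -[a b] z; rewrite /lin /=; congr (_, _, _); ring. Qed.

Lemma continuous_lin (X : topologicalType) (p q : X -> E3) (c : X -> R) :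
  continuous p -> continuous q -> continuous c ->
  continuous (fun x => lin (p x) (q x) (c x)).
Proof.
move=> cp cq cc.
have cl (u : E3 -> R) : continuous u ->
    continuous (fun x => (1 - c x) * u (p x) + c x * u (q x)).
  move=> cu; apply: continuousD; apply: continuousM => //.
  - by apply: continuousD; [move=> x; exact: cvg_cst|exact: continuousN].
  - by move=> x; apply: continuous_comp; [exact: cp|exact: cu].
  - by move=> x; apply: continuous_comp; [exact: cq|exact: cu].
apply: (@pair_continuous X (R * R)%type); first apply: (@pair_continuous X).
- exact: (cl _ continuous_a).
- exact: (cl _ continuous_b).
- exact: (cl _ continuous_z).
Qed.

Definition convex3 (A : set E3) : Prop :=
  forall p q c, A p -> A q -> 0 <= c <= 1 -> A (lin p q c).

Lemma convex3I A B : convex3 A -> convex3 B -> convex3 (A `&` B).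
Proof. by move=> cA cB p q c [? ?] [? ?] Ic; split; [exact: cA|exact: cB]. Qed.

Section Runs.
Context (U : set E3).

Definition runs (A : set E3) x y (p : cpath R U x y) : Prop :=
  forall t, 0 <= t <= 1 -> A (p t).

Lemma runs_cat A x y z (p : cpath R U x y) (q : cpath R U y z) :
  runs A p -> runs A q -> runs A (cpcat p q).
Proof.
by move=> Ap Aq t It /=; rewrite /cpcat_fun; case: (leP t) => h;
  [apply: Ap|apply: Aq]; lra.
Qed.

Lemma runs_inv A x y (p : cpath R U x y) : runs A p -> runs A (cpinv p).
Proof. by move=> Ap t It /=; apply: Ap; lra. Qed.

Lemma runs_cst (A : set E3) x (Ux : U x) : A x -> runs A (cpcst R Ux).
Proof. by move=> Ax t It. Qed.

Lemma seg_continuous (x y : E3) : continuous (fun t => lin x y (clamp t)).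
Proof.
apply: continuous_lin;
  [exact: cst_continuous|exact: cst_continuous|exact: continuous_clamp].
Qed.

Lemma seg0 (x y : E3) : lin x y (clamp 0) = x.
Proof. by rewrite clamp0 lin0. Qed.

Lemma seg1 (x y : E3) : lin x y (clamp 1) = y.
Proof. by rewrite clamp1 lin1. Qed.

Definition seg x y (h : forall c, 0 <= c <= 1 -> U (lin x y c)) : cpath R U x y :=
  CPath (@seg_continuous x y) (fun t => h _ (clampP t)) (seg0 x y) (seg1 x y).

Lemma runs_seg (A : set E3) x y (h : forall c, 0 <= c <= 1 -> U (lin x y c)) :
  (forall c, 0 <= c <= 1 -> A (lin x y c)) -> runs A (seg h).
Proof. by move=> Ah t It; apply: Ah; exact: clampP. Qed.

Lemma convex_homotopic (A : set E3) x y (p q : cpath R U x y) :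
  convex3 A -> A `<=` U -> runs A p -> runs A q -> cpath_homotopic p q.
Proof.
move=> cA AU Ap Aq.
have cc (X : topologicalType) (u : X -> R) : continuous u ->
  continuous (fun z => clamp (u z)).
  by move=> cu z; apply: continuous_comp; [exact: cu|exact: continuous_clamp].
have cs : continuous (@snd R R) by move=> ?; exact: cvg_snd.
have cf : continuous (@fst R R) by move=> ?; exact: cvg_fst.
exists (fun z => lin (p (clamp z.2)) (q (clamp z.2)) (clamp z.1)); split.
- apply: continuous_lin.
  + move=> z; apply: (@continuous_comp (R * R)%type R E3 (fun z =>
    clamp z.2) p); [exact: (cc _ _ cs)|exact: cpath_continuous].
  + move=> z; apply: (@continuous_comp (R * R)%type R E3 (fun z =>
    clamp z.2) q); [exact: (cc _ _ cs)|exact: cpath_continuous].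
  + exact: cc.
- by move=> z; apply: AU; apply: cA; [exact/Ap/clampP|exact/Aq/clampP|exact: clampP].
- by move=> t It /=; rewrite clamp0 lin0 clamp_id.
- by move=> t It /=; rewrite clamp1 lin1 clamp_id.
- by move=> s Is /=; rewrite clamp0 clamp1 !cpath0 !cpath1 !linpp.
Qed.

Lemma convex_seg (A : set E3) x y : convex3 A -> A `<=` U -> A x -> A y ->
  exists p : cpath R U x y, runs A p.
Proof.
move=> cA AU Ax Ay; have h c : 0 <= c <= 1 -> A (lin x y c) by exact: cA.
by exists (seg (fun c Ic => AU _ (h c Ic))); exact: runs_seg.
Qed.

End Runs.
End Space.

Section Subpath.
Context (R : realType) (T : topologicalType) (U : set T).

Lemma subpath_continuous x y (p : cpath R U x y) (a b : R) :
  continuous (fun t : R => p (a + t * (b - a))).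
Proof.
move=> t; apply: (@continuous_comp R R T (fun t : R => a + t * (b - a)) p);
  last exact: cpath_continuous.
by apply: cvgD; [exact: cvg_cst|apply: cvgM; [exact: cvg_id|exact: cvg_cst]].
Qed.

Lemma subpath0 x y (p : cpath R U x y) (a b : R) : p (a + 0 * (b - a)) = p a.
Proof. by rewrite mul0r addr0. Qed.

Lemma subpath1 x y (p : cpath R U x y) (a b : R) : p (a + 1 * (b - a)) = p b.
Proof. by rewrite mul1r subrKC. Qed.

Definition subpath x y (p : cpath R U x y) (a b : R) u v (ea : p a = u) (eb : p b = v)
    : cpath R U u v :=
  CPath (@subpath_continuous x y p a b) (fun t => cpath_in p (a + t * (b - a)))
    (etrans (subpath0 p a b) ea) (etrans (subpath1 p a b) eb).

(** The times a, b, c may come in any order, since the two changes of time are homotopic in R. This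
    is used with neighbouring times on either side of a given one. *)
Lemma subpath_cat x y (p : cpath R U x y) (a b c : R) u v w
    (ea : p a = u) (eb : p b = v) (ec : p c = w) :
  cpath_homotopic (subpath ea ec) (cpcat (subpath ea eb) (subpath eb ec)).
Proof.
apply: (@cpath_homotopic_reparam _ _ _ _ _ p _ _ (fun t => a + t * (c - a))
  (fun t => if t <= 2^-1 then a + 2 * t * (b - a) else b + (2 * t - 1) * (c - b))).
- exact: cpath_continuous.
- exact: cpath_in.
- by move=> t; apply: cvgD; [exact: cvg_cst|apply: cvgM;
  [exact: cvg_id|exact: cvg_cst]].
- apply: (continuous_glue (u := idfun)).
  + by move=> t; exact: cvg_id.
  + move=> t; apply: cvgD; [exact: cvg_cst|apply: cvgM; last exact: cvg_cst].
    by apply: cvgM; [exact: cvg_cst|exact: cvg_id].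
  + move=> t; apply: cvgD; [exact: cvg_cst|apply: cvgM; last exact: cvg_cst].
    exact: continuous_affine.
  + by move=> t /= ->; field.
- by rewrite invr_ge0 ler0n; ring.
- rewrite ifN; last by rewrite -ltNge; lra.
  by ring.
- by [].
- by move=> t It /=; rewrite /cpcat_fun /=; case: ifP.
Qed.

Lemma subpath_id x y (p : cpath R U x y) : cpath_homotopic (subpath (cpath0 p)
  (cpath1 p)) p.
Proof. by apply: cpath_homotopic_ext => t /=; rewrite subr0 mulr1 add0r. Qed.

End Subpath.

(* The part of van Kampen's theorem saying that the loops passing from one chart
   to another generate the fundamental group. *)
Section Generation.
Context (R : realType) (U : set (R * R * R)%type) (x0 : U) (I : Type).
Local Notation E3 := (R * R * R)%type.
Context (V : I -> set E3) (c : I -> E3) (i0 : I).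
Hypothesis VU : forall i, V i `<=` U.
Hypothesis Vconvex : forall i, convex3 (V i).
Hypothesis Vopen : forall i x, V i x -> nbhs x (V i).
Hypothesis Vcover : forall x, U x -> exists i, V i x.
Hypothesis Vc : forall i, V i (c i).
Context (alpha : forall i, cpath R U (\val x0) (c i)).
Hypothesis Vi0 : V i0 (\val x0).
Hypothesis alpha0 : runs (V i0) (alpha i0).
Context (H : groupType) (psi1 psi2 : {multiplicative pi1 R x0 -> H}).

Definition chart_loop i j q (u : cpath R U (c i) q) (v : cpath R U q (c j)) :=
  cpcat (alpha i) (cpcat u (cpcat v (cpinv (alpha j)))).

Hypothesis psi12 : forall i j q (u : cpath R U (c i) q) (v : cpath R U q (c j)),
  V i q -> V j q -> runs (V i) u -> runs (V j) v ->
  psi1 (cpath_class (chart_loop u v)) = psi2 (cpath_class (chart_loop u v)).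

(** [L t i u] follows [p] up to time t, then [u] to the centre of chart [i], and returns along
    [alpha i]. That [psi1] and [psi2] agree on it is locally constant in t: moving within a chart
    changes [u] only, and changing the chart multiplies by a chart loop. At time 0 the loop is
    trivial, at time 1 it is [p]. *)
Lemma chart_loops_generate : psi1 =1 psi2.
Proof.
move=> a; have [p ->] := cpath_class_surj a.
pose L t i (u : cpath R U (p t) (c i)) :=
  cpcat (subpath (cpath0 p) (erefl (p t))) (cpcat u (cpinv (alpha i))).
pose Q t i := forall u : cpath R U (p t) (c i), runs (V i) u ->
  psi1 (cpath_class (L t i u)) = psi2 (cpath_class (L t i u)).
have Qij t i j : V i (p t) -> V j (p t) -> Q t i -> Q t j.
  move=> Vi Vj Qi u ru.
  have [v rv] := convex_seg (@Vconvex i) (@VU i) Vi (Vc i).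
  have e : cpath_homotopic (L t j u) (cpcat (L t i v) (chart_loop (cpinv v) u)).
    rewrite /L /chart_loop -!cpcatA [cpcat (cpinv (alpha i)) _]cpcatA.
    rewrite (cpcatVp (VU (Vc i))) (cpcat1p (VU (Vc i))) [cpcat v _]cpcatA.
    by rewrite (cpcatpV (VU Vi)) (cpcat1p (VU Vi)); reflexivity.
  have {e} -> := (cpath_classP _ _).2 e.
  by rewrite cpath_class_cat !gmulfM Qi// psi12//; exact: runs_inv.
have Qtt i t t' : (forall u, Num.min t t' <= u <= Num.max t t' -> V i (p u)) ->
    Q t i -> Q t' i.
  move=> Vp Qt u ru.
  pose s := subpath (erefl (p t)) (erefl (p t')).
  have rs : runs (V i) s.
    move=> k Ik; apply: Vp; case: (leP t t') => tt; apply/andP; split => //=; nra.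
  have e : cpath_homotopic (L t' i u) (L t i (cpcat s u)).
    by rewrite /L (subpath_cat (cpath0 p) (erefl (p t)) (erefl (p t')))
      -!cpcatA; reflexivity.
  have {e} -> := (cpath_classP _ _).2 e.
  by apply: Qt; exact: runs_cat.
suff : exists2 i, V i (p 1) & Q 1 i.
  move=> [i Vi /(@Qij _ _ i0 Vi)]; rewrite {1}cpath1 => /(_ Vi0) Q1.
  (* A constant path from [\val x0] to [p 1]. These points are equal but not convertible, and [e1]
     mediates between the two types of paths. *)
  pose e1 := subpath (cpath1 p) (erefl (p 1)).
  have re : runs (V i0) (cpcat (cpinv e1) (alpha i0)).
    apply: runs_cat => // t It; rewrite /e1 /= subrr mulr0 addr0 cpath1.
    exact: Vi0.
  have e : cpath_homotopic (L 1 i0 (cpcat (cpinv e1) (alpha i0))) p.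
    rewrite /L (subpath_cat (cpath0 p) (cpath1 p) (erefl (p 1))) -!cpcatA.
    rewrite -/e1 [cpcat e1 _]cpcatA (cpcatpV (VU Vi0)) (cpcat1p (VU Vi0)).
    rewrite (cpcatpV (VU Vi0)) (cpcatp1 (VU Vi0)).
    exact: subpath_id.
  by rewrite -((cpath_classP _ _).2 e); exact: Q1.
apply: (itv_locally_constant (P := fun t => exists2 i, V i (p t) & Q t i) ler01).
  move=> t It; have [i Vi] := Vcover (cpath_in p t).
  near=> t' => It'.
  have Vp : forall u, Num.min t t' <= u <= Num.max t t' -> V i (p u).
    by near: t'; apply: near_chart => //; exact: cpath_continuous.
  have Vi' : V i (p t') by apply: Vp; lra_minmax.
  split=> -[j Vj Qj]; exists i => //.
    apply: (@Qtt i t') (Qij _ _ _ Vj Vi' Qj).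
    by move=> u; rewrite minC maxC; exact: Vp.
  exact: (@Qtt i t) (Qij _ _ _ Vj Vi Qj).
exists i0; first by rewrite cpath0.
move=> u ru.
have e : cpath_homotopic (L 0 i0 u) (cpcst R (VU Vi0)).
  pose e0 := subpath (cpath0 p) (erefl (p 0)).
  rewrite -(cpcatpV (VU Vi0) (alpha i0)) /L cpcatA -/e0.
  apply: cpcat_homotopic; last by reflexivity.
  apply: (convex_homotopic (@Vconvex i0)) => //; apply: runs_cat => // t It.
  by rewrite /e0 /= subrr mulr0 addr0 cpath0.
have {e} -> := (cpath_classP _ _).2 e.
have psi_cst (psi : {multiplicative pi1 R x0 -> H}) :
    psi (cpath_class (cpcst R (VU Vi0))) = 1%g.
  set k := cpath_class _; apply: (mulgI (psi k)); rewrite mulg1 -gmulfM.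
  by rewrite -cpath_class_cat; congr (psi _); apply/cpath_classP; exact: cpcat1p.
by rewrite !psi_cst.
Unshelve. all: by end_near. Qed.

End Generation.

(** * The twice punctured plane *)

(** The existence clause says that [b1] and [b2] satisfy no relation, the uniqueness clause that
    they generate. *)
Definition free_on_two (G : groupType) : Prop := exists b1 b2 : G,
  (forall (H : groupType) (g1 g2 : H),
     exists phi : {multiplicative G -> H}, phi b1 = g1 /\ phi b2 = g2) /\
  (forall (H : groupType) (psi1 psi2 : {multiplicative G -> H}),
     psi1 b1 = psi2 b1 -> psi1 b2 = psi2 b2 -> psi1 =1 psi2).

Lemma free_on_two_free (G : groupType) : free_on_two G -> free_group G.
Proof.
case=> b1 [b2 [ex uniq]]; exists [set b1; b2] => H f.
have B1 : b1 \in [set b1; b2] by rewrite inE; left.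
have B2 : b2 \in [set b1; b2] by rewrite inE; right.
have [phi [phi1 phi2]] := ex H (f (SigSub B1)) (f (SigSub B2)).
exists phi; split.
  case=> b Bb /=; have := Bb; rewrite inE /= => -[] e; subst b.
    by rewrite phi1; congr f; apply: val_inj.
  by rewrite phi2; congr f; apply: val_inj.
move=> psi psif; apply: uniq; first by rewrite phi1 -(psif (SigSub B1)).
by rewrite phi2 -(psif (SigSub B2)).
Qed.

Lemma free_on_two_isomorphic (G H : groupType) :
  isomorphic_groups G H -> free_on_two G -> free_on_two H.
Proof.
move=> GH [b1 [b2 [ex uniq]]]; have [g bg] := isomorphic_sym GH.
case: GH => f [f' fK f'K]; exists (f b1), (f b2); split=> [K k1 k2|K p q p1 p2].
  have [phi [phi1 phi2]] := ex K k1 k2.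
  have f'M : {morph f' : a b / (a * b)%g}.
    by move=> a b; apply: (can_inj fK); rewrite f'K gmulfM !f'K.
  pose F := HB.pack_for {multiplicative H -> G} f' (isMultiplicative.Build _ _ f' f'M).
  by exists (phi \o F); rewrite /= !fK.
move=> a; rewrite -(f'K a).
by apply: (uniq K (p \o f) (q \o f)).
Qed.

Section TwoPunctures.
Context (R : realType).
Local Notation E3 := (R * R * R)%type.

Definition two_punctures : set E3 :=
  [set p | ~ (p.1.1 = 0 /\ p.1.2 = 0) /\ ~ (p.1.1 = 1 /\ p.1.2 = 0)].

(** Two half spaces joined through the three gaps in the line b = 0. No three charts meet, and the
    nerve is a graph with five vertices and six edges, hence with two independent cycles. *)
Inductive chart := Lower | Upper | West | Middle | East.

Definition chart_dom (i : chart) : set E3 :=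
  match i with
  | Lower => [set p | p.1.2 < 0]
  | Upper => [set p | 0 < p.1.2]
  | West => [set p | p.1.1 < 0]
  | Middle => [set p | 0 < p.1.1] `&` [set p | p.1.1 < 1]
  | East => [set p | 1 < p.1.1]
  end.

(** West, Middle and East are centred inside Lower, and Upper inside Middle: the corresponding four
    overlaps form a maximal tree of the nerve, along which chart loops are trivial. *)
Definition center (i : chart) : E3 :=
  match i with
  | Lower => (2^-1, -1, 0)
  | Upper => (2^-1, 1, 0)
  | West => (-1, -1, 0)
  | Middle => (2^-1, -1, 0)
  | East => (2, -1, 0)
  end.

Lemma chart_dom_sub i : chart_dom i `<=` two_punctures.
Proof.
by case: i => p /=; rewrite /two_punctures /=; first [case=> h1 h2|move=> h1];
  split=> -[]; lra.
Qed.

Lemma convex_comb_lt (k x y c : R) : 0 <= c <= 1 -> x < k -> y < k ->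
  (1 - c) * x + c * y < k.
Proof.
case/andP; rewrite le_eqVlt => /predU1P[<- _|c0 c1 xk yk].
  by rewrite subr0 mul1r mul0r addr0.
by nra.
Qed.

Lemma convex_comb_gt (k x y c : R) : 0 <= c <= 1 -> k < x -> k < y ->
  k < (1 - c) * x + c * y.
Proof.
move=> Ic kx ky; have : (1 - c) * - x + c * - y < - k.
  by apply: convex_comb_lt; rewrite ?ltrN2.
lra.
Qed.

Lemma chart_dom_convex i : convex3 (chart_dom i).
Proof.
case: i => p q c /=; try by (move=> ? ? ?;
  first [exact: convex_comb_lt|exact: convex_comb_gt]).
by move=> [? ?] [? ?] ?; split; [exact: convex_comb_gt|exact: convex_comb_lt].
Qed.

Lemma chart_dom_open i p : chart_dom i p -> nbhs p (chart_dom i).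
Proof.
have ca := @continuous_a R; have cb := @continuous_b R.
have ck (k : R) : continuous (fun _ : E3 => k) by move=> ?; exact: cvg_cst.
have nl (u : E3 -> R) (k : R) : continuous u -> u p < k -> nbhs p [set q | u q < k].
  by move=> cu; exact: (@near_lt R E3 u (fun=> k) p cu (ck k)).
have ng (u : E3 -> R) (k : R) : continuous u -> k < u p -> nbhs p [set q | k < u q].
  by move=> cu; exact: (@near_lt R E3 (fun=> k) u p (ck k) cu).
case: i => /=; [exact: nl|exact: ng|exact: nl| |exact: ng].
by case=> h1 h2; apply: filterI; [exact: ng|exact: nl].
Qed.

Lemma chart_dom_cover p : two_punctures p -> exists i, chart_dom i p.
Proof.
case=> p0 p1.
have [h|h|hb] := ltgtP p.1.2 0; [by exists Lower|by exists Upper|].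
have [h|h|h] := ltgtP p.1.1 0; [by exists West| |by case: p0].
have [h'|h'|h'] := ltgtP p.1.1 1; [by exists Middle|by exists East|by case: p1].
Qed.

Lemma center_in i : chart_dom i (center i).
Proof. by case: i => //=; try split => /=; lra. Qed.

Section BasePoint.
Variable x0 : two_punctures.
Hypothesis x0E : \val x0 = center Lower.

Lemma seg_in_chart x y i : chart_dom i x -> chart_dom i y ->
  exists p : cpath R two_punctures x y, runs (chart_dom i) p.
Proof. exact: convex_seg (@chart_dom_convex i) (@chart_dom_sub i). Qed.

Definition tree_dom (i : chart) : set E3 :=
  match i with
  | Lower | Middle => chart_dom Lower `&` chart_dom Middle
  | Upper => chart_dom Middle
  | West | East => chart_dom Lower
  end.

Lemma tree_path i : exists p : cpath R two_punctures (\val x0) (center i),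
  runs (tree_dom i) p.
Proof.
have LM := convex3I (@chart_dom_convex Lower) (@chart_dom_convex Middle).
have LMs p : (chart_dom Lower `&` chart_dom Middle) p -> two_punctures p.
  by case=> /chart_dom_sub.
rewrite x0E; case: i => /=.
- by apply: (convex_seg LM LMs); split=> /=; try split=> /=; lra.
- by apply: (@seg_in_chart _ _ Middle); split=> /=; lra.
- by apply: (@seg_in_chart _ _ Lower) => /=; lra.
- by apply: (convex_seg LM LMs); split=> /=; try split=> /=; lra.
- by apply: (@seg_in_chart _ _ Lower) => /=; lra.
Qed.

Definition alpha i := projT1 (cid (tree_path i)).

Lemma alpha_runs i : runs (tree_dom i) (alpha i).
Proof. by rewrite /alpha; case: cid. Qed.

Lemma alpha_runs_lower i : i <> Upper -> runs (chart_dom Lower) (alpha i).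
Proof.
by have := @alpha_runs i; case: i => // h _ t It; have := h t It => // -[].
Qed.

Lemma alpha_runs_middle i : i = Upper \/ i = Middle ->
  runs (chart_dom Middle) (alpha i).
Proof.
by have h := @alpha_runs i; case=> e; subst i => t It; have := h t It => // -[].
Qed.

Local Notation loop_at := (chart_loop alpha).

(** Inside chart [i], the path [u] can be pushed into the convex overlap with chart [j]; then the
    whole loop lies in chart [j]. *)
Lemma chart_loop_trivial i j q (u : cpath R two_punctures (center i) q)
    (v : cpath R two_punctures q (center j)) :
  chart_dom i q -> chart_dom j q -> runs (chart_dom i) u -> runs (chart_dom j) v ->
  chart_dom j (center i) -> runs (chart_dom j) (alpha i) ->
    runs (chart_dom j) (alpha j) ->
  cpath_homotopic (loop_at u v) (cpcst R (set_valP x0)).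
Proof.
move=> Vi Vj ru rv Vji ri rj.
have [w rw] := convex_seg (convex3I (@chart_dom_convex i) (@chart_dom_convex j))
   (fun _ h => @chart_dom_sub i _ h.1) (conj (@center_in i) Vji) (conj Vi Vj).
have uw : cpath_homotopic u w.
  apply: (convex_homotopic (@chart_dom_convex i)) => //; first exact: chart_dom_sub.
  by move=> t /rw[].
have Vx : chart_dom j (\val x0) by rewrite -(cpath0 (alpha j)); apply: rj;
  rewrite lexx ler01.
rewrite /chart_loop uw; apply: (convex_homotopic (@chart_dom_convex j)).
- exact: chart_dom_sub.
- by do !apply: runs_cat => //; [move=> t /rw[]|exact: runs_inv].
- exact: runs_cst.
Qed.

(** The overlap is convex: a path [w] in it joins [q] to [q'] and is inserted together with its
    inverse. *)
Lemma chart_loop_indep i j q q' (u : cpath R two_punctures (center i) q)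
    (v : cpath R two_punctures q (center j)) (u' : cpath R two_punctures (center i) q')
    (v' : cpath R two_punctures q' (center j)) :
  chart_dom i q -> chart_dom j q -> runs (chart_dom i) u -> runs (chart_dom j) v ->
  chart_dom i q' -> chart_dom j q' -> runs (chart_dom i) u' -> runs (chart_dom j) v' ->
  cpath_homotopic (loop_at u v) (loop_at u' v').
Proof.
move=> Vi Vj ru rv Vi' Vj' ru' rv'.
have [w rw] := convex_seg (convex3I (@chart_dom_convex i) (@chart_dom_convex j))
   (fun _ h => @chart_dom_sub i _ h.1) (conj Vi Vj) (conj Vi' Vj').
have uw : cpath_homotopic u (cpcat u' (cpinv w)).
  apply: (convex_homotopic (@chart_dom_convex i)) => //; first exact: chart_dom_sub.
  by apply: runs_cat => //; apply: runs_inv => t /rw[].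
have vw : cpath_homotopic v' (cpcat (cpinv w) v).
  apply: (convex_homotopic (@chart_dom_convex j)) => //; first exact: chart_dom_sub.
  by apply: runs_cat => //; apply: runs_inv => t /rw[].
by rewrite /chart_loop uw vw -!cpcatA; reflexivity.
Qed.

Lemma chart_loop_sym i j q (u : cpath R two_punctures (center i) q)
    (v : cpath R two_punctures q (center j)) :
  cpath_homotopic (cpcat (loop_at u v) (loop_at (cpinv v) (cpinv u)))
    (cpcst R (set_valP x0)).
Proof.
have Uq := cpath_in v 0; rewrite cpath0 in Uq.
have Uj := chart_dom_sub (@center_in j); have Ui := chart_dom_sub (@center_in i).
rewrite /chart_loop -!cpcatA [cpcat (cpinv (alpha j)) _]cpcatA.
rewrite (cpcatVp Uj) (cpcat1p Uj) [cpcat v _]cpcatA (cpcatpV Uq) (cpcat1p Uq).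
by rewrite [cpcat u _]cpcatA (cpcatpV Ui) (cpcat1p Ui) cpcatpV; reflexivity.
Qed.

(** The transitions from Upper to West and East are [g1] and [g2], all others between distinct
    charts being trivial. The label of Upper jumps only at a = 0 and a = 1, where Upper meets no
    other chart. *)
Definition chart_label (H : groupType) (g1 g2 : H) (i : chart) (p : E3) : H :=
  if i is Upper then
    if p.1.1 < 0 then g1^-1%g else if p.1.1 <= 1 then 1%g else g2^-1%g
  else 1%g.

Lemma chart_label_loc (H : groupType) (g1 g2 : H) i j p :
  chart_dom i p -> chart_dom j p -> \forall q \near p,
  ((chart_label g1 g2 i q)^-1 * chart_label g1 g2 j q
    = (chart_label g1 g2 i p)^-1 * chart_label g1 g2 j p)%g.
Proof.
move=> Vi Vj.
have [iU|iU] := pselect (i = Upper); have [jU|jU] := pselect (j = Upper).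
- by near=> q; rewrite iU jU !mulVg.
- have : \forall q \near p, chart_label g1 g2 Upper q = chart_label g1 g2 Upper p.
    subst i; have := chart_dom_open Vj; apply: filterS => q; move: Vi Vj.
    case: j jU => //=; first by move=> _ h1 h2; exfalso; lra.
    + by move=> _ _ -> ->.
    + by move=> _ _ [p0 p1] [q0 q1];
      rewrite !ltNge !(ltW p0) !(ltW q0) /= (ltW p1) (ltW q1).
    + by move=> _ _ p1 q1;
      rewrite !ltNge (ltW (lt_trans ltr01 p1)) (ltW (lt_trans ltr01 q1)) /=
      !leNgt p1 q1.
  apply: filterS => q; rewrite iU => ->; congr (_ * _)%g; by case: j jU Vj.
- have : \forall q \near p, chart_label g1 g2 Upper q = chart_label g1 g2 Upper p.
    subst j; have := chart_dom_open Vi; apply: filterS => q; move: Vj Vi.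
    case: i iU => //=; first by move=> _ h1 h2; exfalso; lra.
    + by move=> _ _ -> ->.
    + by move=> _ _ [p0 p1] [q0 q1];
      rewrite !ltNge !(ltW p0) !(ltW q0) /= (ltW p1) (ltW q1).
    + by move=> _ _ p1 q1;
      rewrite !ltNge (ltW (lt_trans ltr01 p1)) (ltW (lt_trans ltr01 q1)) /=
      !leNgt p1 q1.
  apply: filterS => q; rewrite jU => ->; congr (_^-1 * _)%g; by case: i iU Vi.
- by near=> q; case: i iU Vi => // _ _; case: j jU Vj.
Unshelve. all: by end_near. Qed.

Lemma pi1_two_punctures_base : free_on_two (pi1 R x0).
Proof.
(* One point in each of the two overlaps outside the maximal tree; the loops through them are the
   basis. *)
pose q1 : E3 := (-1, 1, 0); pose q2 : E3 := (2, 1, 0).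
have [Uq1 Wq1 Uq2 Eq2] : [/\ chart_dom Upper q1, chart_dom West q1,
    chart_dom Upper q2 & chart_dom East q2] by split=> /=; lra.
have [u1 ru1] := seg_in_chart (@center_in Upper) Uq1.
have [v1 rv1] := seg_in_chart Wq1 (@center_in West).
have [u2 ru2] := seg_in_chart (@center_in Upper) Uq2.
have [v2 rv2] := seg_in_chart Eq2 (@center_in East).
exists (cpath_class (loop_at u1 v1)), (cpath_class (loop_at u2 v2)); split.
  move=> H g1 g2.
  have loc i j (x : E3) : two_punctures x -> chart_dom i x -> chart_dom j x ->
      \forall y \near x, two_punctures y ->
      ((chart_label g1 g2 i y)^-1 * chart_label g1 g2 j y
       = (chart_label g1 g2 i x)^-1 * chart_label g1 g2 j x)%g.
    by move=> _ Vi Vj; have := chart_label_loc g1 g2 Vi Vj; exact: filterS.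
  have [phi phiE] := holonomy_hom R chart_dom_cover chart_dom_open loc x0.
  have tree i : i <> Upper ->
    holonomy chart_dom_cover chart_dom_open loc (alpha i) = 1%g.
    by move=> iU; rewrite (holonomy_chart _ _ _ (alpha_runs_lower iU)) /= mulgV.
  have treeV i : i <> Upper ->
      holonomy chart_dom_cover chart_dom_open loc (cpinv (alpha i)) = 1%g.
    by move=> iU; rewrite (holonomy_chart _ _ _ (runs_inv (alpha_runs_lower
      iU))) /= mulgV.
  exists phi; rewrite !phiE /chart_loop !holonomy_cat !treeV//.
  rewrite !(holonomy_chart _ _ _ (alpha_runs_middle (or_introl erefl))).
  rewrite (holonomy_chart _ _ _ ru1) (holonomy_chart _ _ _ rv1).
  rewrite (holonomy_chart _ _ _ ru2) (holonomy_chart _ _ _ rv2) /=.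
  have -> : (2^-1 < 0 :> R) = false by lra.
  have -> : (2^-1 <= 1 :> R) by lra.
  have -> : (-1 < 0 :> R) by lra.
  have -> : (2 < 0 :> R) = false by lra.
  have -> : (2 <= 1 :> R) = false by lra.
  by rewrite !mulgV !mulg1 !mul1g !invgK.
move=> H psi1 psi2 e1 e2.
apply: (@chart_loops_generate _ _ x0 _ chart_dom center Lower chart_dom_sub
  chart_dom_convex chart_dom_open chart_dom_cover center_in alpha _ _).
- by rewrite x0E; exact: center_in.
- exact: alpha_runs_lower.
pose agree i j := forall q (u : cpath R two_punctures (center i) q)
    (v : cpath R two_punctures q (center j)),
  chart_dom i q -> chart_dom j q -> runs (chart_dom i) u -> runs (chart_dom j) v ->
  psi1 (cpath_class (loop_at u v)) = psi2 (cpath_class (loop_at u v)).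
have psi_cst (psi : {multiplicative pi1 R x0 -> H}) :
    psi (cpath_class (cpcst R (set_valP x0))) = 1%g.
  set k := cpath_class _; apply: (mulgI (psi k)); rewrite mulg1 -gmulfM.
  by rewrite -cpath_class_cat; congr (psi _); apply/cpath_classP; exact: cpcat1p.
have agreeC i j : agree i j -> agree j i.
  move=> ij q u v Vj Vi ru rv.
  have := ij q (cpinv v) (cpinv u) Vi Vj (runs_inv rv) (runs_inv ru).
  have inv (psi : {multiplicative pi1 R x0 -> H}) :
      (psi (cpath_class (loop_at u v)) * psi (cpath_class (loop_at (cpinv v)
        (cpinv u))) = 1)%g.
    rewrite -gmulfM -cpath_class_cat -(psi_cst psi); congr (psi _).
    by apply/cpath_classP; exact: chart_loop_sym.
  move=> e; apply: (mulIg (psi1 (cpath_class (loop_at (cpinv v) (cpinv u))))).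
  by rewrite inv e inv.
have trivial i j : chart_dom j (center i) -> runs (chart_dom j) (alpha i) ->
    runs (chart_dom j) (alpha j) -> agree i j.
  move=> Vji ri rj q u v Vi Vj ru rv.
  have /cpath_classP -> := chart_loop_trivial Vi Vj ru rv Vji ri rj.
  by rewrite !psi_cst.
have disjoint i j : (forall q, chart_dom i q -> chart_dom j q -> False) -> agree i j.
  by move=> ij q u v Vi Vj; case: (ij q Vi Vj).
(* For the overlaps outside the tree, every chart loop is homotopic to a basis loop; on the tree and
   within one chart the loops are trivial, and the remaining pairs of charts are disjoint. *)
have agU1 : agree Upper West.
  move=> q u v Vi Vj ru rv.
  by have /cpath_classP -> := chart_loop_indep Vi Vj ru rv Uq1 Wq1 ru1 rv1.
have agU2 : agree Upper East.
  move=> q u v Vi Vj ru rv.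
  by have /cpath_classP -> := chart_loop_indep Vi Vj ru rv Uq2 Eq2 ru2 rv2.
have low i : i <> Upper -> agree i Lower.
  move=> iU; apply: trivial (alpha_runs_lower _) (alpha_runs_lower _) => //.
  by case: i iU => //= _; lra.
have upmid : agree Upper Middle.
  apply: trivial (alpha_runs_middle _) (alpha_runs_middle _); last 2 first.
  - by left.
  - by right.
  by split=> /=; lra.
have dis i j : (forall q, chart_dom i q -> chart_dom j q -> False) -> agree i j.
  exact: disjoint.
have uplow : agree Upper Lower by apply: dis => q /= h1 h2; clear -h1 h2; lra.
have wm : agree West Middle by apply: dis => q /= h1 [h2 h3]; clear -h1 h2 h3; lra.
have we : agree West East by apply: dis => q /= h1 h2; clear -h1 h2; lra.
have me : agree Middle East by apply: dis => q /= [h1 h2] h3; clear -h1 h2 h3; lra.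
have self i : agree i i.
  move=> q u v Vi _ ru rv.
  have e : cpath_homotopic (cpcat u v) (cpcst R (chart_dom_sub (@center_in i))).
    apply: (convex_homotopic (@chart_dom_convex i)); first exact: chart_dom_sub.
      exact: runs_cat.
    by apply: runs_cst; exact: center_in.
  have /cpath_classP -> : cpath_homotopic (loop_at u v) (cpcst R (set_valP x0)).
    rewrite /chart_loop [cpcat u _]cpcatA e cpcat1p cpcatpV; reflexivity.
  by rewrite !psi_cst.
have ag i j : agree i j.
  by case: i; case: j; first [exact: self|exact: low|exact: (agreeC _ _ (low _
    _))|done|apply: agreeC].
by move=> i j q u v; exact: ag.
Qed.

End BasePoint.

Theorem pi1_two_punctures (y : two_punctures) : free_on_two (pi1 R y).
Proof.
have L0 : center Lower \in two_punctures.
  by rewrite inE; apply: (chart_dom_sub (@center_in Lower)).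
have [i Vi] := chart_dom_cover (set_valP y).
have [p _] := seg_in_chart Vi (@center_in i).
pose x0 : two_punctures := SigSub L0.
have x0E : \val x0 = center Lower by [].
apply: free_on_two_isomorphic (pi1_two_punctures_base x0E).
apply: pi1_base_change; exact: (cpcat (alpha x0E i) (cpinv p)).
Qed.

End TwoPunctures.

(** * The knot and its strands *)

Section Knot.
Context (R : realType).
Local Notation E3 := (R * R * R)%type.

Definition acoord (t : R) : R := t ^+ 3 - 3 * t.
Definition bcoord (t : R) : R := t ^+ 4 - 4 * t ^+ 2 - 1.
Definition zcoord (t : R) : R := 115 * t - 11 * t ^+ 5.
Definition knot (t : R) : E3 := (acoord t, bcoord t, zcoord t).

Definition knot_complement : set E3 :=
  [set p | ~ (p.1.1 = 0 /\ p.1.2 = 0) /\ forall t, p <> knot t].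

(** Square roots of negative numbers are 0, so the strands are continuous on all of R, beyond the
    levels where they exist: below b = -5 they coincide in the pairs S1, S2 and S3, S4, and above b
    = -1 both S2 and S3 sit at parameter 0. *)
Definition rad (b : R) : R := Num.sqrt (b + 5).
Definition outer (b : R) : R := Num.sqrt (2 + rad b).
Definition inner (b : R) : R := Num.sqrt (2 - rad b).

(* As [b t + 5 = (t ^ 2 - 2) ^ 2], the knot meets each level set of [b] in at
   most four points. *)
Inductive strand := S1 | S2 | S3 | S4.

Definition param (i : strand) (b : R) : R :=
  match i with
  | S1 => - outer b
  | S2 => - inner b
  | S3 => inner b
  | S4 => outer b
  end.

Definition present (i : strand) (b : R) : Prop :=
  match i with
  | S1 | S4 => -5 <= b
  | S2 | S3 => -5 <= b <= -1
  end.

Definition sa i b := acoord (param i b).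
Definition sz i b := zcoord (param i b).

Lemma rad_ge0 b : 0 <= rad b. Proof. exact: sqrtr_ge0. Qed.
Lemma outer_ge0 b : 0 <= outer b. Proof. exact: sqrtr_ge0. Qed.
Lemma inner_ge0 b : 0 <= inner b. Proof. exact: sqrtr_ge0. Qed.

Lemma rad2 b : -5 <= b -> rad b ^+ 2 = b + 5.
Proof. by move=> h; rewrite sqr_sqrtr//; lra. Qed.

Lemma rad_junk b : b <= -5 -> rad b = 0.
Proof. by move=> h; rewrite /rad ler0_sqrtr//; lra. Qed.

Lemma outer2 b : outer b ^+ 2 = 2 + rad b.
Proof. by rewrite sqr_sqrtr//; have := rad_ge0 b; lra. Qed.

Lemma rad_le2 b : b <= -1 -> rad b <= 2.
Proof.
move=> h; have [h5|h5] := leP (-5) b; last by rewrite rad_junk; lra.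
have := rad2 h5; have := rad_ge0 b; move: (rad b) => r r0 e; nra.
Qed.

Lemma rad_gt2 b : -1 < b -> 2 < rad b.
Proof.
move=> h; have h5 : -5 <= b by lra.
by have := rad2 h5; have := rad_ge0 b; nra.
Qed.

Lemma inner2 b : b <= -1 -> inner b ^+ 2 = 2 - rad b.
Proof. by move=> /rad_le2 h; rewrite sqr_sqrtr//; lra. Qed.

Lemma inner_junk b : -1 <= b -> inner b = 0.
Proof.
rewrite le_eqVlt => /predU1P[<-|/rad_gt2 h].
  rewrite /inner /rad (_ : -1 + 5 = 2 ^+ 2); last by ring.
  by rewrite sqrtr_sqr ger0_norm// subrr sqrtr0.
by rewrite /inner ler0_sqrtr//; lra.
Qed.

Lemma outer_gt0 b : 0 < outer b.
Proof. by rewrite /outer sqrtr_gt0; have := rad_ge0 b; lra. Qed.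

Lemma bcoordE t : bcoord t + 5 = (t ^+ 2 - 2) ^+ 2.
Proof. by rewrite /bcoord; ring. Qed.

Lemma param_b i b : present i b -> bcoord (param i b) = b.
Proof.
move=> h; apply: (addIr 5); rewrite bcoordE; case: i h => /= h; rewrite ?sqrrN.
- by rewrite outer2 -rad2//; ring.
- by case/andP: h => h1 h2; rewrite inner2// -rad2//; ring.
- by case/andP: h => h1 h2; rewrite inner2// -rad2//; ring.
- by rewrite outer2 -rad2//; ring.
Qed.

Lemma knot_strand i b : present i b -> (sa i b, b, sz i b) = knot (param i b).
Proof. by move=> h; rewrite /knot param_b. Qed.

Lemma strand_knot t : exists i, present i (bcoord t) /\ param i (bcoord t) = t.
Proof.
have b5 : -5 <= bcoord t by have := sqr_ge0 (t ^+ 2 - 2); rewrite -bcoordE; lra.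
have rE : rad (bcoord t) = `|t ^+ 2 - 2| by rewrite /rad bcoordE sqrtr_sqr.
have oE : 2 <= t ^+ 2 -> outer (bcoord t) = `|t|.
  by move=> h; rewrite /outer rE ger0_norm ?subrKC ?sqrtr_sqr//; lra.
have [h|h] := leP 2 (t ^+ 2).
  have [t0|t0] := leP 0 t; [exists S4|exists S1]; split=> //=; rewrite oE//.
    by rewrite ger0_norm.
  by rewrite ltr0_norm// opprK.
have iE : inner (bcoord t) = `|t|.
  rewrite /inner rE ltr0_norm; last lra.
  by rewrite (_ : 2 - - (t ^+ 2 - 2) = t ^+ 2) ?sqrtr_sqr//; ring.
have b1 : bcoord t <= -1.
  rewrite (_ : bcoord t = t ^+ 2 * (t ^+ 2 - 4) - 1); last by rewrite /bcoord; ring.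
  by have := sqr_ge0 t; move: (t ^+ 2) h => s hs s0; nra.
have [t0|t0] := leP 0 t; [exists S3|exists S2]; split=> /=; rewrite ?b5// iE.
  by rewrite ger0_norm.
by rewrite ltr0_norm// opprK.
Qed.

Lemma complement_strand p : knot_complement p <->
  ~ (p.1.1 = 0 /\ p.1.2 = 0) /\
  forall i, present i p.1.2 -> p.1.1 = sa i p.1.2 -> p.2 <> sz i p.1.2.
Proof.
case: p => -[a b] z /=; split=> -[p0 pK]; split=> //=.
  move=> i h /= aE zE; apply: (pK (param i b)).
  by rewrite -knot_strand// aE zE.
move=> t [aE bE zE]; have [i [h tE]] := strand_knot t.
by apply: (pK i); rewrite bE ?/sa ?/sz ?tE.
Qed.

(** Division by t - s leaves t^2 + t s + s^2 = 3 and (t + s)(t^2 + s^2 - 4) = 0. *)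
Lemma double_point t s : t <> s -> acoord t = acoord s -> bcoord t = bcoord s ->
  (s = - t /\ t ^+ 2 = 3) \/ (t ^+ 2 + s ^+ 2 = 4 /\ t * s = -1).
Proof.
move=> ts ea eb; have ts0 : t - s != 0 by rewrite subr_eq0; apply/eqP.
have e1 : t ^+ 2 + t * s + s ^+ 2 = 3.
  apply: (mulfI ts0); move: ea; rewrite /acoord => ea.
  lra.
have e2 : (t + s) * (t ^+ 2 + s ^+ 2 - 4) = 0.
  apply: (mulfI ts0); move: eb; rewrite /bcoord mulr0 => eb.
  by move: eb; lra.
move/eqP: e2; rewrite mulf_eq0 => /orP[] /eqP e2; [left|right].
  have es : s = - t by lra.
  by split=> //; rewrite es in e1; lra.
by split; lra.
Qed.

(** The divided difference of [zcoord] is 115 - 11 * 11 = -6 at these crossings, but 115 - 11 * 9 =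
    16 at the crossing with s = -t and t^2 = 3. Thus the smaller parameter passes over at the former
    and under at the latter, which makes the diagram alternating. *)
Lemma strand_z_double t s : t ^+ 2 + s ^+ 2 = 4 -> t * s = -1 ->
  zcoord t - zcoord s = 6 * (s - t).
Proof.
move=> e1 e2; rewrite /zcoord.
have -> : 115 * t - 11 * t ^+ 5 - (115 * s - 11 * s ^+ 5) =
  (t - s) * (115 - 11 * ((t ^+ 2 + s ^+ 2) ^+ 2 - (t * s) ^+ 2
    + t * s * (t ^+ 2 + s ^+ 2))) by ring.
by rewrite e1 e2; ring.
Qed.

End Knot.

(** * Charts of the knot complement and Wirtinger labels *)

Section KnotCharts.
Context (R : realType).
Local Notation E3 := (R * R * R)%type.
Implicit Types (b : R) (p q : E3).

Lemma sa_sym14 b : sa S1 b = - sa S4 b.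
Proof. by rewrite /sa /acoord /=; ring. Qed.

Lemma sa_sym23 b : sa S2 b = - sa S3 b.
Proof. by rewrite /sa /acoord /=; ring. Qed.

Lemma sz_sym14 b : sz S1 b = - sz S4 b.
Proof. by rewrite /sz /zcoord /=; ring. Qed.

Lemma sa4E b : sa S4 b = (rad b - 1) * outer b.
Proof.
by rewrite /sa /acoord /= (_ : _ - _ = (outer b ^+ 2 - 3) * outer b);
  [rewrite outer2; ring|ring].
Qed.

Lemma sa3E b : b <= -1 -> sa S3 b = - (1 + rad b) * inner b.
Proof.
move=> h; rewrite /sa /acoord /= (_ : _ - _ = (inner b ^+ 2 - 3) * inner b).
  by rewrite inner2//; ring.
by ring.
Qed.

Lemma sa3_junk b : -1 <= b -> sa S3 b = 0.
Proof. by move=> h; rewrite /sa /acoord /= inner_junk//; ring. Qed.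

Lemma sa34_junk b : b <= -5 -> sa S3 b = sa S4 b.
Proof.
move=> h; rewrite /sa /= (_ : inner b = outer b)// /inner /outer rad_junk//.
by rewrite subr0 addr0.
Qed.

Lemma sa4_gt0 b : -4 < b -> 0 < sa S4 b.
Proof.
move=> h; rewrite sa4E mulr_gt0 ?outer_gt0// subr_gt0.
have h5 : -5 <= b by lra.
have := rad2 h5; have := rad_ge0 b; move: (rad b) => r r0 e; nra.
Qed.

Lemma sa4_gt1 b : -1 < b -> 1 < sa S4 b.
Proof.
move=> h; rewrite sa4E; have r2 := rad_gt2 h.
have := outer2 b; have := outer_ge0 b; move: (outer b) (rad b) r2 => u r r2 u0 e.
have u1 : 1 < u by nra.
nra.
Qed.

Lemma sa3_le0 b : sa S3 b <= 0.
Proof.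
have [h|h] := leP b (-1); last by rewrite sa3_junk// ltW.
by rewrite sa3E//; have := inner_ge0 b; have := rad_ge0 b; nra.
Qed.

(** Keeps the inner strands out of [Cross14]. With r = [rad b], the square is (1 + r)^2 (2 - r) = 2
    + r (3 - r^2), where 0 < r and r^2 < 2. *)
Lemma sa3_low b : -5 < b -> b < -3 -> sa S3 b < 0 /\ 2 < sa S3 b ^+ 2.
Proof.
move=> h5 h3; have h1 : b <= -1 by lra.
have h5' : -5 <= b by lra.
have := rad2 h5'; have := rad_ge0 b; have := inner2 h1; have := inner_ge0 b.
rewrite sa3E//; move: (inner b) (rad b) => v r v0 e r0 e'.
have r0' : 0 < r by nra.
have r32 : r < 3/2 by nra.
have v0' : 0 < v by nra.
split; first by nra.
have -> : (- (1 + r) * v) ^+ 2 = (1 + r) ^+ 2 * v ^+ 2 by ring.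
rewrite e (_ : (1 + r) ^+ 2 * (2 - r) = 2 + r * (3 - r ^+ 2)); last by ring.
have : 0 < r * (3 - r ^+ 2) by apply: mulr_gt0 => //; nra.
lra.
Qed.

Lemma continuous_param i : continuous (@param R i).
Proof.
have cr : continuous (@rad R).
  move=> b; apply: (@continuous_comp R R R (fun b => b + 5) Num.sqrt);
    last exact: sqrt_continuous.
  by apply: cvgD; [exact: cvg_id|exact: cvg_cst].
have co : continuous (@outer R).
  move=> b; apply: (@continuous_comp R R R (fun b => 2 + rad b) Num.sqrt);
    last exact: sqrt_continuous.
  by apply: cvgD; [exact: cvg_cst|exact: cr].
have ci : continuous (@inner R).
  move=> b; apply: (@continuous_comp R R R (fun b => 2 - rad b) Num.sqrt);
    last exact: sqrt_continuous.
  by apply: cvgB; [exact: cvg_cst|exact: cr].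
by case: i => /=; [exact: continuousN|exact: continuousN| |].
Qed.

Lemma continuousX (X : topologicalType) (f : X -> R) n :
  continuous f -> continuous (fun x => f x ^+ n).
Proof.
move=> cf; elim: n => [|n IH]; first by move=> x; exact: cvg_cst.
rewrite (_ : (fun x => _) = fun x => f x * f x ^+ n); first exact: continuousM.
by apply/funext => x; rewrite exprS.
Qed.

Lemma continuous_sa i : continuous (fun p : E3 => sa i p.1.2).
Proof.
have c : continuous (fun p : E3 => param i p.1.2).
  move=> p; apply: (@continuous_comp E3 R R (fun p => p.1.2) (param i)).
    exact: continuous_b.
  exact: continuous_param.
rewrite /sa /acoord; apply: continuousD; first exact: continuousX.
by apply: continuousN; apply: continuousM => // x; exact: cvg_cst.
Qed.

Lemma continuous_sz i : continuous (fun p : E3 => sz i p.1.2).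
Proof.
have c : continuous (fun p : E3 => param i p.1.2).
  move=> p; apply: (@continuous_comp E3 R R (fun p => p.1.2) (param i)).
    exact: continuous_b.
  exact: continuous_param.
have k (x : R) : continuous (fun _ : E3 => x) by move=> ?; exact: cvg_cst.
rewrite /sz /zcoord; apply: continuousD; first exact: continuousM.
by apply: continuousN; apply: continuousM => //; exact: continuousX.
Qed.

Definition beta i p : bool := sa i p.1.2 < p.1.1.

Lemma near_beta i p : p.1.1 <> sa i p.1.2 -> \forall q \near p, beta i q = beta i p.
Proof.
move=> /eqP; rewrite neq_lt /beta => /orP[] h.
  have := near_lt (@continuous_a R) (@continuous_sa i) h.
  by apply: filterS => q hq; rewrite !ltNge !ltW.
have := near_lt (@continuous_sa i) (@continuous_a R) h.
by apply: filterS => q hq; rewrite h hq.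
Qed.

Lemma near_gtb (k : R) p : k < p.1.2 -> \forall q \near p, k < q.1.2.
Proof.
by apply: (@near_lt R E3 (fun=> k) (fun p => p.1.2));
  [exact: cst_continuous|exact: continuous_b].
Qed.

Lemma near_ltb (k : R) p : p.1.2 < k -> \forall q \near p, q.1.2 < k.
Proof.
by apply: (@near_lt R E3 (fun p => p.1.2) (fun=> k));
  [exact: continuous_b|exact: cst_continuous].
Qed.

Lemma near_gta (k : R) p : k < p.1.1 -> \forall q \near p, k < q.1.1.
Proof.
by apply: (@near_lt R E3 (fun=> k) (fun p => p.1.1));
  [exact: cst_continuous|exact: continuous_a].
Qed.

Lemma near_lta (k : R) p : p.1.1 < k -> \forall q \near p, q.1.1 < k.
Proof.
by apply: (@near_lt R E3 (fun p => p.1.1) (fun=> k));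
  [exact: continuous_a|exact: cst_continuous].
Qed.

(** Vacuous off the vertical sheet through the strand, so that [above] and [below] are open
    conditions. [Top] thus omits the curtain hanging down from the knot, and [Bottom] the one rising
    from it. *)
Definition above i p : Prop := p.1.1 = sa i p.1.2 -> sz i p.1.2 < p.2.
Definition below i p : Prop := p.1.1 = sa i p.1.2 -> p.2 < sz i p.1.2.

Lemma near_off i p : p.1.1 <> sa i p.1.2 -> \forall q \near p, q.1.1 <> sa i q.1.2.
Proof.
move=> /eqP; rewrite neq_lt => /orP[] h.
  have := near_lt (@continuous_a R) (@continuous_sa i) h.
  by apply: filterS => q hq; apply/eqP; rewrite lt_eqF.
have := near_lt (@continuous_sa i) (@continuous_a R) h.
by apply: filterS => q hq; apply/eqP; rewrite gt_eqF.
Qed.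

Lemma near_above i p : above i p -> \forall q \near p, above i q.
Proof.
move=> h; have [e|/near_off] := pselect (p.1.1 = sa i p.1.2); last first.
  by apply: filterS => q ne /ne.
have := near_lt (@continuous_sz i) (@continuous_z R) (h e).
by apply: filterS => q hq _.
Qed.

Lemma near_below i p : below i p -> \forall q \near p, below i q.
Proof.
move=> h; have [e|/near_off] := pselect (p.1.1 = sa i p.1.2); last first.
  by apply: filterS => q ne /ne.
have := near_lt (@continuous_z R) (@continuous_sz i) (h e).
by apply: filterS => q hq _.
Qed.

Lemma near_absent i p : ~ present i p.1.2 -> \forall q \near p, ~ present i q.1.2.
Proof.
have lo : ~ -5 <= p.1.2 -> \forall q \near p, ~ -5 <= q.1.2.
  by move=> /negP; rewrite -ltNge => /near_ltb; apply: filterS => q;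
    rewrite ltNge => /negP.
case: i => //= /negP; rewrite negb_and => /orP[/negP/lo|].
- by apply: filterS => q h /andP[].
- by rewrite -ltNge => /near_gtb; apply: filterS => q h /andP[_]; rewrite leNgt h.
- by apply: filterS => q h /andP[].
- by rewrite -ltNge => /near_gtb; apply: filterS => q h /andP[_]; rewrite leNgt h.
Qed.

(* [knot_complement] also omits the axis a = b = 0; the ray is its curtain. *)
Definition on_ray p : Prop := p.1.1 = 0 /\ 0 <= p.1.2.

Lemma near_off_ray p : ~ on_ray p -> \forall q \near p, ~ on_ray q.
Proof.
move=> h; have [hb|hb] := leP 0 p.1.2; last first.
  by have := near_ltb hb; apply: filterS => q ? [? ?]; lra.
have /eqP : p.1.1 <> 0 by move=> e; apply: h.
rewrite neq_lt => /orP[/near_lta|/near_gta]; apply: filterS => q ? [? ?]; lra.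
Qed.

(* [Crossij] is the neighbourhood of the crossing of strands i and j, between the
   over- and the underpass; [Neck] contains the points on the ray. *)
Inductive kchart := Top | Bottom | Cross14 | Cross13 | Cross24 | Neck.

(** The crossings lie at b = -4, a = 0 and at b = -2 with a of either sign. The bounds on a and b
    keep the two other strands away, by [sa3_low], [sa3_le0] and [sa4_gt0]; in [Neck] only the outer
    strands are present. *)
Definition kdom (c : kchart) : set E3 := fun p =>
  match c with
  | Top => (forall i, present i p.1.2 -> above i p) /\ ~ on_ray p
  | Bottom => (forall i, present i p.1.2 -> below i p) /\ ~ on_ray p
  | Cross14 => [/\ -5 < p.1.2, p.1.2 < -3, p.1.1 ^+ 2 < 2, below S4 p & above S1 p]
  | Cross13 => [/\ -3 < p.1.2, p.1.2 < -1, p.1.1 < 0, below S1 p & above S3 p]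
  | Cross24 => [/\ -3 < p.1.2, p.1.2 < -1, 0 < p.1.1, below S2 p & above S4 p]
  | Neck => [/\ 0 < p.1.2, sa S1 p.1.2 < p.1.1 & p.1.1 < sa S4 p.1.2]
  end.

Lemma near_forall (P : strand -> E3 -> Prop) p :
  (forall i, \forall q \near p, P i q) -> \forall q \near p, forall i, P i q.
Proof.
move=> h; have h1 := h S1; have h2 := h S2; have h3 := h S3; have h4 := h S4.
by near=> q; case; near: q.
Unshelve. all: by end_near. Qed.

Lemma near_kdom c p : kdom c p -> \forall q \near p, kdom c q.
Proof.
case: c.
- case=> h /near_off_ray hr.
  have hi : \forall q \near p, forall i, present i q.1.2 -> above i q.
    apply: near_forall => i.
    have [/h/near_above|/near_absent] := pselect (present i p.1.2);
      apply: filterS => //.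
  by near=> q; split; near: q.
- case=> h /near_off_ray hr.
  have hi : \forall q \near p, forall i, present i q.1.2 -> below i q.
    apply: near_forall => i.
    have [/h/near_below|/near_absent] := pselect (present i p.1.2);
      apply: filterS => //.
  by near=> q; split; near: q.
- case=> /near_gtb h1 /near_ltb h2 h3 /near_below h4 /near_above h5.
  have {}h3 : \forall q \near p, q.1.1 ^+ 2 < 2.
    apply: (@near_lt R E3 (fun p => p.1.1 ^+ 2) (fun=> 2)) => //.
      by apply: continuousX; exact: continuous_a.
    exact: cst_continuous.
  by near=> q; split; near: q.
- case=> /near_gtb h1 /near_ltb h2 /near_lta h3 /near_below h4 /near_above h5.
  by near=> q; split; near: q.
- case=> /near_gtb h1 /near_ltb h2 /near_gta h3 /near_below h4 /near_above h5.
  by near=> q; split; near: q.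
- case=> /near_gtb h1.
  move=> /(near_lt (@continuous_sa S1) (@continuous_a R)) h2.
  move=> /(near_lt (@continuous_a R) (@continuous_sa S4)) h3.
  by near=> q; split; near: q.
Unshelve. all: by end_near. Qed.

Section Labels.
Context (G : groupType) (x1 x2 x3 h : G).
(** The Wirtinger relations at [Cross13] and [Cross24]. At [Cross14] the labels fit by the choice of
    x3 * x2 for the central region. *)
Hypothesis x13 : (x1 * x3 = x3 * x2)%g.
Hypothesis x21 : (x2 * x1 = x3 * x2)%g.

(* The projected knot cuts the plane into five regions, told apart by the strands
   they lie to the right of; the label is the product of the Wirtinger generators
   of the arcs crossed on the way in from the unbounded region below. *)
Definition region_label (b1 b2 b3 b4 : bool) : G :=
  match b1, b2, b3, b4 with
  | false, false, true, false => x3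
  | true, false, true, false => (x3 * x2)%g
  | true, false, true, true => x2
  | true, false, false, false => x1
  | true, true, true, false => x1
  | _, _, _, _ => 1%g
  end.

(** A crossing chart has its jump on the sheet of its overstrand, below which it lies. The jump by
    [h] in [Neck] is at a = 0, exactly over the ray removed from [Top] and [Bottom]: it is the
    monodromy around the axis. *)
Definition klabel (c : kchart) p : G :=
  match c with
  | Top => 1%g
  | Bottom => region_label (beta S1 p) (beta S2 p) (beta S3 p) (beta S4 p)
  | Cross14 => if beta S4 p then 1%g else x3
  | Cross13 => if beta S1 p then x1 else 1%g
  | Cross24 => if beta S2 p then 1%g else x2
  | Neck => if 0 < p.1.1 then h else 1%g
  end.

(** The default positions of absent strands still enter [region_label]. Below b = -5 they coincide
    in pairs, and every pattern that occurs has label 1; above b = -1, S2 and S3 both sit at a = 0,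
    which does not affect the label. *)
Lemma near_bottom_label p :
  (forall i, present i p.1.2 -> p.1.1 <> sa i p.1.2) ->
  \forall q \near p, klabel Bottom q = klabel Bottom p.
Proof.
move=> off.
have [h5|h5] := ltP p.1.2 (-5).
  have w1 q : q.1.2 < -5 -> klabel Bottom q = 1%g.
    move=> hq; have e := sa34_junk (ltW hq).
    rewrite /= /beta sa_sym14 sa_sym23 e.
    by case: (_ < _); case: (_ < _).
  by have := near_ltb h5; apply: filterS => q hq; rewrite !w1.
have [h1|h1] := ltP (-1) p.1.2; last first.
  have n i : \forall q \near p, beta i q = beta i p.
    by apply/near_beta/off; case: i => //=; rewrite h5 h1.
  have n1 := n S1; have n2 := n S2; have n3 := n S3; have n4 := n S4.
  near=> q => /=.
  have -> : beta S1 q = beta S1 p by near: q.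
  have -> : beta S2 q = beta S2 p by near: q.
  have -> : beta S3 q = beta S3 p by near: q.
  by have -> : beta S4 q = beta S4 p by near: q.
have w q : -1 < q.1.2 ->
  klabel Bottom q = if beta S1 q && ~~ beta S4 q then x1 else 1%g.
  move=> hq; rewrite /= {2}/beta sa_sym23 {2}/beta sa3_junk ?ltW// oppr0.
  by case: (beta S1 q); case: (beta S4 q); case: (0 < _).
have n1 := near_beta (off S1 h5); have n4 := near_beta (off S4 h5).
have nb := near_gtb h1.
near=> q; rewrite !w//; last by near: q.
have -> : beta S1 q = beta S1 p by near: q.
by have -> : beta S4 q = beta S4 p by near: q.
Unshelve. all: by end_near. Qed.

Definition label_loc (c d : kchart) := forall p, kdom c p -> kdom d p ->
  \forall q \near p, ((klabel c q)^-1 * klabel d q = (klabel c p)^-1 * klabel d p)%g.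

Lemma label_loc_sym c d : label_loc c d -> label_loc d c.
Proof.
move=> cd p dp cp; have := cd p cp dp; apply: filterS => q e.
by rewrite -[LHS]invgK -[RHS]invgK; congr (_^-1)%g; rewrite !invgM !invgK.
Qed.

Lemma label_loc_refl c : label_loc c c.
Proof. by move=> p _ _; near=> q; rewrite !mulVg. Unshelve. all: by end_near. Qed.

Lemma above_below_off i p : above i p -> below i p -> p.1.1 <> sa i p.1.2.
Proof. by move=> h1 h2 e; have := h1 e; have := h2 e; lra. Qed.

(** A point both above and below a strand is off its sheet, and sheets and ray are the only places
    where the labels of the other charts jump. *)
Lemma label_loc_top d : label_loc Top d.
Proof.
move=> p [T ray] Dp.
suff : \forall q \near p, klabel d q = klabel d p.
  by apply: filterS => q /= ->.
case: d Dp => /=.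
- by move=> _; near=> q.
- case=> B _; apply: near_bottom_label => i ip.
  by apply: above_below_off; [exact: T|exact: B].
- case=> ? ? _ b4 _; have /near_beta : p.1.1 <> sa S4 p.1.2.
    by apply: above_below_off b4; apply: T => /=; lra.
  by apply: filterS => q ->.
- case=> ? ? _ b1 _; have /near_beta : p.1.1 <> sa S1 p.1.2.
    by apply: above_below_off b1; apply: T => /=; lra.
  by apply: filterS => q ->.
- case=> ? ? _ b2 _; have /near_beta : p.1.1 <> sa S2 p.1.2.
    by apply: above_below_off b2; apply: T => /=; lra.
  by apply: filterS => q ->.
- case=> b0 _ _; have /eqP : p.1.1 <> 0 by move=> e; apply: ray; split => //;
  exact: ltW.
  rewrite neq_lt => /orP[] h0.
    by have := near_lta h0; apply: filterS => q hq; rewrite !ltNge !ltW.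
  by have := near_gta h0; apply: filterS => q hq; rewrite h0 hq.
Unshelve. all: by end_near. Qed.

(** Both labels jump across the sheet of the overstrand S4, but the jumps cancel. The quotient
    depends only on the side of the understrand S1, and the point is off the sheet of S1. *)
Lemma label_loc_bottom14 : label_loc Bottom Cross14.
Proof.
move=> p [B ray] [h5 h3 ha b4 a1].
have off : p.1.1 <> sa S1 p.1.2.
  by apply: above_below_off a1 _; apply: B => /=; lra.
have lE q : -5 < q.1.2 -> q.1.2 < -3 -> q.1.1 ^+ 2 < 2 ->
    ((klabel Bottom q)^-1 * klabel Cross14 q)%g = if beta S1 q then x2^-1%g else 1%g.
  move=> q5 q3 qa; have [s0 s2] := sa3_low q5 q3.
  have b3 : beta S3 q by rewrite /beta; nra.
  have b2 : beta S2 q = false by apply/negbTE; rewrite /beta -leNgt sa_sym23; nra.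
  rewrite /= b3 b2; case: (beta S1 q); case: (beta S4 q);
    rewrite /= ?mulg1 ?invg1 ?mulVg//.
  by rewrite invgM mulgVK.
have D := near_kdom (c := Cross14) (And5 h5 h3 ha b4 a1).
have n1 := near_beta off.
near=> q; have [q5 q3 qa _ _] : kdom Cross14 q by near: q.
rewrite !lE//; have -> // : beta S1 q = beta S1 p by near: q.
Unshelve. all: by end_near. Qed.

Lemma label_loc_bottom13 : label_loc Bottom Cross13.
Proof.
move=> p [B ray] [h3 h1 ha b1 a3].
have off : p.1.1 <> sa S3 p.1.2.
  by apply: above_below_off a3 _; apply: B => /=; lra.
have lE q : -3 < q.1.2 -> q.1.2 < -1 -> q.1.1 < 0 ->
    ((klabel Bottom q)^-1 * klabel Cross13 q)%g = if beta S3 q then x3^-1%g else 1%g.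
  move=> q3 q1 qa.
  have b4 : beta S4 q = false.
    have q4 : -4 < q.1.2 by lra.
    by have := sa4_gt0 q4; rewrite /beta => ?; apply/negbTE; rewrite -leNgt; lra.
  have b2 : beta S2 q = false.
    by have := sa3_le0 q.1.2; rewrite /beta sa_sym23 => ?; apply/negbTE;
      rewrite -leNgt; lra.
  rewrite /= b4 b2; case: (beta S1 q); case: (beta S3 q);
    rewrite /= ?mulg1 ?invg1 ?mulVg//.
  (* Read as x1 * x3, the central label differs from the label x3 of the left lobe by the generator
     x1 of the overstrand. *)
  by rewrite -x13 invgM mulgVK.
have D := near_kdom (c := Cross13) (And5 h3 h1 ha b1 a3).
have n1 := near_beta off.
near=> q; have [q5 q3 qa _ _] : kdom Cross13 q by near: q.
rewrite !lE//; have -> // : beta S3 q = beta S3 p by near: q.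
Unshelve. all: by end_near. Qed.

Lemma label_loc_bottom24 : label_loc Bottom Cross24.
Proof.
move=> p [B ray] [h3 h1 ha b2 a4].
have off : p.1.1 <> sa S4 p.1.2.
  by apply: above_below_off a4 _; apply: B => /=; lra.
have lE q : -3 < q.1.2 -> q.1.2 < -1 -> 0 < q.1.1 ->
    ((klabel Bottom q)^-1 * klabel Cross24 q)%g = if beta S4 q then 1%g else x1^-1%g.
  move=> q3 q1 qa.
  have b1 : beta S1 q.
    have q4 : -4 < q.1.2 by lra.
    by have := sa4_gt0 q4; rewrite /beta sa_sym14; lra.
  have b3 : beta S3 q.
    by have := sa3_le0 q.1.2; rewrite /beta; lra.
  rewrite /= b1 b3; case: (beta S2 q); case: (beta S4 q);
    rewrite /= ?mulg1 ?invg1 ?mulVg//.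
  by rewrite -x21 invgM mulgVK.
have D := near_kdom (c := Cross24) (And5 h3 h1 ha b2 a4).
have n1 := near_beta off.
near=> q; have [q5 q3 qa _ _] : kdom Cross24 q by near: q.
rewrite !lE//; have -> // : beta S4 q = beta S4 p by near: q.
Unshelve. all: by end_near. Qed.

Lemma label_loc_bottom_neck : label_loc Bottom Neck.
Proof.
move=> p [B ray] N; have [h0 h1 h4] := N.
have lE q : kdom Neck q -> klabel Bottom q = x1.
  case=> q0 q1 q4; rewrite /= /beta q1 sa_sym23 sa3_junk; last lra.
  have -> : (sa S4 q.1.2 < q.1.1) = false by apply/negbTE; rewrite -leNgt ltW.
  by rewrite oppr0; case: (0 < _).
have D := near_kdom N.
have nh : \forall q \near p, klabel Neck q = klabel Neck p.
  have /eqP : p.1.1 <> 0 by move=> e; apply: ray; split => //; exact: ltW.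
  rewrite neq_lt => /orP[] ha.
    by have := near_lta ha; apply: filterS => q hq /=; rewrite !ltNge !ltW.
  by have := near_gta ha; apply: filterS => q hq /=; rewrite ha hq.
near=> q; have Nq : kdom Neck q by near: q.
by rewrite !lE//; congr (_ * _)%g; near: q.
Unshelve. all: by end_near. Qed.

Lemma label_loc_all c d : label_loc c d.
Proof.
have dis c' d' : (forall p, kdom c' p -> kdom d' p -> False) -> label_loc c' d'.
  by move=> h' p /h' hc /hc.
have d1 : label_loc Cross14 Cross13 by apply: dis => p [? ? _ _ _] [? _ _ _ _]; lra.
have d2 : label_loc Cross14 Cross24 by apply: dis => p [? ? _ _ _] [? _ _ _ _]; lra.
have d3 : label_loc Cross13 Cross24 by apply: dis => p [? ? ? _ _] [? _ ? _ _]; lra.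
have d4 : label_loc Cross14 Neck by apply: dis => p [? ? ? _ _] [? _ ?]; lra.
have d5 : label_loc Cross13 Neck by apply: dis => p [? ? ? _ _] [? _ ?]; lra.
have d6 : label_loc Cross24 Neck by apply: dis => p [? ? ? _ _] [? _ ?]; lra.
have b1 := label_loc_bottom14; have b2 := label_loc_bottom13.
have b3 := label_loc_bottom24; have b4 := label_loc_bottom_neck.
by case: c; case: d; first [exact: label_loc_refl|exact: label_loc_top
  |exact: (label_loc_sym (@label_loc_top _))|done|exact: label_loc_sym].
Qed.

End Labels.

Lemma kdom_sub c : kdom c `<=` @knot_complement R.
Proof.
case: c => p.
- case=> ab ray; apply/complement_strand; split.
    by case=> a0 b0; apply: ray; split => //; rewrite b0.
  by move=> i ip /(ab i ip) h e; rewrite e ltxx in h.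
- case=> ab ray; apply/complement_strand; split.
    by case=> a0 b0; apply: ray; split => //; rewrite b0.
  by move=> i ip /(ab i ip) h e; rewrite e ltxx in h.
- case=> h5 h3 ha b4 a1; apply/complement_strand; split; first by case; lra.
  have [s0 s2] := sa3_low h5 h3.
  case=> _ e ez; [have := a1 e|exfalso|exfalso|have := b4 e]; rewrite ?ez ?ltxx//.
    by move: e; rewrite sa_sym23 => e; rewrite e in ha; lra.
  by rewrite e in ha; lra.
- case=> h3 h1 ha b1 a3; apply/complement_strand; split; first by case; lra.
  have h4 : -4 < p.1.2 by lra.
  have s4 := sa4_gt0 h4; have s3 := sa3_le0 p.1.2.
  case=> _ e ez; [have := b1 e|exfalso|have := a3 e|exfalso];
    rewrite ?ez ?ltxx//; last lra.
  by move: e; rewrite sa_sym23; lra.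
- case=> h3 h1 ha b2 a4; apply/complement_strand; split; first by case; lra.
  have h4 : -4 < p.1.2 by lra.
  have s4 := sa4_gt0 h4; have s3 := sa3_le0 p.1.2.
  case=> _ e ez; [exfalso|have := b2 e|exfalso|have := a4 e];
    rewrite ?ez ?ltxx//; last lra.
  by move: e; rewrite sa_sym14; lra.
- case=> h0 h1 h4; apply/complement_strand; split; first by case; lra.
  case=> ip e; try by (rewrite -e ltxx in h1) || (rewrite -e ltxx in h4).
    by case/andP: ip; lra.
  by case/andP: ip; lra.
Qed.

(** The three crossings, with [i] passing over [j]. Opposite parameters with square 3 must be outer,
    and [zcoord] is positive at the positive one. In the other case the overstrand has the smaller
    parameter, and the product -1 leaves only an outer and an inner strand of opposite signs. *)
Lemma strands_meet i j b : present i b -> present j b -> sa i b = sa j b ->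
  sz j b < sz i b ->
  [\/ [/\ i = S4, j = S1, b = -4 & sa i b = 0],
      [/\ i = S1, j = S3, b = -2 & sa i b < 0] |
      [/\ i = S2, j = S4, b = -2 & 0 < sa i b]].
Proof.
move=> ip jp sab szb; have o2 := outer2 b; have o0 := outer_gt0 b;
  have i0 := inner_ge0 b.
have r0 := rad_ge0 b.
have i2 : i = S2 \/ i = S3 \/ j = S2 \/ j = S3 -> inner b ^+ 2 = 2 - rad b.
  move=> ij; apply: inner2; move: ip jp; case: ij => [->|[->|[->|->]]] /=.
  - by case/andP.
  - by case/andP.
  - by move=> _ /andP[].
  - by move=> _ /andP[].
have b5 : -5 <= b by case: i ip {i2 sab szb} => //= /andP[].
have rE := rad2 b5.
have ts : param i b <> param j b.
  by move=> e; move: szb; rewrite /sz e ltxx.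
have bE : bcoord (param i b) = bcoord (param j b) by rewrite !param_b.
have [[se t3]|[e1 e2]] := double_point ts sab bE.
- have s3 : param j b ^+ 2 = 3 by rewrite se sqrrN.
  have noin k : k = S2 \/ k = S3 -> (k = i \/ k = j) -> param k b ^+ 2 = 3 -> False.
    move=> k23 kij; have : inner b ^+ 2 = 2 - rad b.
      by apply: i2; case: kij k23 => -> [] ->; tauto.
    by case: k23 => -> /=; rewrite ?sqrrN => ->; lra.
  have i14 : i = S1 \/ i = S4.
    have := @noin i; case: (i) t3 => /= t3 h; try tauto; exfalso; apply: h; tauto.
  have j14 : j = S1 \/ j = S4.
    have := @noin j; case: (j) s3 => /= s3 h; try tauto; exfalso; apply: h; tauto.
  have u3 : outer b ^+ 2 = 3 by case: i14 t3 => -> /=; rewrite ?sqrrN.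
  have r1 : rad b = 1 by lra.
  have z4 : 0 < sz S4 b.
    rewrite /sz /zcoord /= (_ : _ - _ =
      outer b * (115 - 11 * (outer b ^+ 2) ^+ 2)); last by ring.
    by rewrite u3; apply: mulr_gt0 => //; lra.
  case: i14 ts szb sab => ->; case: j14 => -> // _; rewrite sz_sym14; first lra.
  move=> _; rewrite sa_sym14 => s0; apply: Or31; split=> //; [|lra].
  by rewrite r1 in rE; lra.
- have := strand_z_double e1 e2; rewrite -/(sz i b) -/(sz j b) => zE.
  have st : param i b < param j b by lra.
  (* Here outer * inner = 1, and the square of this product is (2 + r)(2 - r), where r^2 = b + 5. *)
  have r3 : (i = S1 /\ j = S3) \/ (i = S2 /\ j = S4) -> b = -2.
    move=> ij; have v2 : inner b ^+ 2 = 2 - rad b by apply: i2; tauto.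
    have : (outer b * inner b) ^+ 2 = 1.
      by case: ij e2 => -[-> ->] /=; rewrite ?mulNr ?mulrN => e; nra.
    rewrite exprMn o2 v2 => e.
    have : rad b ^+ 2 = 3 by nra.
    by rewrite rE; lra.
  have s4 : b = -2 -> 0 < sa S4 b by move=> bb; apply: sa4_gt0; rewrite bb; lra.
  have v2' : i = S2 /\ j = S3 -> inner b ^+ 2 = 2 - rad b by move=> ij;
    apply: i2; tauto.
  case: i j {ip jp szb ts bE zE i2} sab e1 e2 st r3 v2' =>
    -[] /= sab e1 e2 st r3 v2'; try (exfalso; nra).
  + have b2 := r3 (or_introl (conj erefl erefl)).
    by apply: Or32; split=> //; rewrite sa_sym14; have := s4 b2; lra.
  + have b2 := r3 (or_intror (conj erefl erefl)).
    by apply: Or33; split=> //; rewrite sab; exact: s4.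
Qed.

Variant kcover_spec p : Prop :=
  | KTop of kdom Top p
  | KBottom of kdom Bottom p
  | KRay of p.1.1 = 0 & 0 < p.1.2
  | KCross14 of kdom Cross14 p & p.1.2 = -4 & p.1.1 = 0
  | KCross13 of kdom Cross13 p & p.1.2 = -2 & p.1.1 = sa S1 p.1.2
  | KCross24 of kdom Cross24 p & p.1.2 = -2 & p.1.1 = sa S4 p.1.2.

(** Off the ray, a point in neither [Top] nor [Bottom] has one strand above it and another below it,
    hence lies at a crossing. The exact position is recorded because [kconnected] moves such
    points. *)
Lemma kcoverP p : @knot_complement R p -> kcover_spec p.
Proof.
case/complement_strand => ax off.
have [[a0 b0]|ray] := pselect (on_ray p).
  apply: KRay => //; rewrite lt_neqAle b0 andbT; apply/eqP => e; exact: ax.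
have [top|ntop] := pselect (forall i, present i p.1.2 -> above i p); first exact: KTop.
have [bot|nbot] := pselect (forall i, present i p.1.2 -> below i p);
  first exact: KBottom.
have [i ip [aE zi]] : exists2 i, present i p.1.2 & p.1.1 =
  sa i p.1.2 /\ p.2 < sz i p.1.2.
  apply: contrapT => h; apply: ntop => i ip aE; rewrite ltNge; apply/negP => zi.
  apply: h; exists i => //; split=> //; rewrite lt_neqAle zi andbT; apply/eqP.
  exact: off.
have [j jp [aE' zj]] : exists2 j, present j p.1.2 & p.1.1 =
  sa j p.1.2 /\ sz j p.1.2 < p.2.
  apply: contrapT => h; apply: nbot => j jp aE'; rewrite ltNge; apply/negP => zj.
  apply: h; exists j => //; split=> //; rewrite lt_neqAle zj andbT; apply/eqP => e.
  exact: off (esym e).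
have sij : sa i p.1.2 = sa j p.1.2 by rewrite -aE -aE'.
have [[ei ej bE s0]|[ei ej bE s0]|[ei ej bE s0]] :=
  strands_meet ip jp sij (lt_trans zj zi);
  subst i j.
- apply: KCross14 => //; last by rewrite aE.
  split; try by [move=> _|rewrite bE; lra].
  by rewrite aE s0 expr0n /=; lra.
- apply: KCross13 => //.
  by split; try by [move=> _|rewrite ?bE ?aE; lra].
- apply: KCross24 => //.
  by split; try by [move=> _|rewrite ?bE ?aE; lra].
Qed.

Lemma kcover p : @knot_complement R p -> exists c, kdom c p.
Proof.
case/kcoverP => [h|h|a0 b0|h _ _|h _ _|h _ _]; [by exists Top|by exists Bottom| |
  by exists Cross14|by exists Cross13|by exists Cross24].
have h1 : -1 < p.1.2 by lra.
have s4 := sa4_gt1 h1.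
by exists Neck; split=> //; rewrite ?sa_sym14 a0; lra.
Qed.

End KnotCharts.

(** * Connectedness of the knot complement and loops with prescribed holonomy *)

Section KnotLoops.
Context (R : realType).
Local Notation E3 := (R * R * R)%type.
Local Notation U := (@knot_complement R).
Implicit Types (b : R) (p q : E3).

Arguments kdom : simpl never.

(** A bound for the height of the knot on all levels up to [b], obtained from |t| <= [outer b];
    beyond it a path meets no strand. *)
Definition zbound b : R := 115 * outer b + 11 * outer b ^+ 5.

Lemma outer_mono b b' : b <= b' -> outer b <= outer b'.
Proof.
move=> h; rewrite /outer; apply: ler_wsqrtr; rewrite lerD2l; apply: ler_wsqrtr.
by rewrite lerD2r.
Qed.

Lemma param_bound i b : `|param i b| <= outer b.
Proof.
have io : inner b <= outer b.
  by rewrite /inner /outer; apply: ler_wsqrtr; have := rad_ge0 b; lra.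
have := outer_ge0 b; have := inner_ge0 b.
by case: i => /= h1 h2; rewrite ?normrN ger0_norm.
Qed.

Lemma sz_bound i b b' : b <= b' -> `|sz i b| <= zbound b'.
Proof.
move=> /outer_mono ob; have tb := le_trans (param_bound i b) ob.
rewrite /sz /zcoord /zbound; apply: le_trans (ler_normB _ _) _.
rewrite (normrM 115) (normrM 11) normrX !(ger0_norm (ler0n _ _)).
apply: lerD; apply: ler_wpM2l => //.
by apply: lerXn2r; rewrite ?nnegrE ?outer_ge0.
Qed.

Lemma kdom_high p b : p.1.2 <= b -> zbound b < p.2 -> ~ on_ray p -> kdom Top p.
Proof.
move=> pb zb ray; split=> // i _ _.
by have := sz_bound i pb; rewrite ler_norml => /andP[_]; lra.
Qed.

Lemma kdom_deep p b : p.1.2 <= b -> p.2 < - zbound b -> ~ on_ray p -> kdom Bottom p.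
Proof.
move=> pb zb ray; split=> // i _ _.
by have := sz_bound i pb; rewrite ler_norml => /andP[]; lra.
Qed.

Lemma kdom_off p : (forall i, present i p.1.2 -> p.1.1 <> sa i p.1.2) -> ~ on_ray p ->
  kdom Top p.
Proof. by move=> off ray; split=> // i /off ne /ne. Qed.

Lemma kseg c p q : (forall k, 0 <= k <= 1 -> kdom c (lin p q k)) ->
  exists s : cpath R U p q, runs (kdom c) s.
Proof.
by move=> h; exists (seg (fun k Ik => @kdom_sub R c _ (h k Ik))); exact: runs_seg.
Qed.

Let M : R := 1 + zbound 1.

(** The level -1/2 lies above the end b = -1 of the inner strands and below the axis. The vertical
    line over (0, -1/2) therefore avoids all sheets and joins great heights to great depths within
    [Top]. *)
Definition kbase : E3 := (0, -2^-1, M).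

Lemma off_half i : present i (-2^-1 : R) -> 0 <> sa i (-2^-1 : R).
Proof.
have h : -1 < -2^-1 :> R by lra.
have s4 := sa4_gt1 h.
case: i => /=; rewrite ?sa_sym14; [lra|move=> /andP[_ ?];
  lra|move=> /andP[_ ?]; lra|lra].
Qed.

Lemma kbase_in_complement : U kbase.
Proof.
apply: (kdom_sub (c := Top)).
by apply: kdom_off => [i|[/= _]]; [exact: off_half|lra].
Qed.

Lemma kpath_half z z' : exists s : cpath R U (0, -2^-1, z) (0, -2^-1, z'),
  runs (kdom Top) s.
Proof.
apply: kseg => k Ik; rewrite /lin /=.
have -> : (1 - k) * 0 + k * 0 = 0 :> R by ring.
have -> : (1 - k) * - 2^-1 + k * - 2^-1 = - 2^-1 :> R by ring.
by apply: kdom_off => [i|[/= _]]; [exact: off_half|lra].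
Qed.

(** Rising never leaves [Top]; above the whole knot up to level [m] the point then travels to (0,
    -1/2) without crossing the ray, and comes to height [M] on the vertical line. *)
Lemma kpath_top p : kdom Top p -> exists s : cpath R U p kbase, True.
Proof.
case: p => -[a b] z T; have [ab ray] := T.
pose m := Num.max b 1; pose z' := Num.max z (1 + zbound m).
have zz' : z <= z' by rewrite le_max lexx.
have zb : zbound m < z'.
  by apply: (@lt_le_trans _ _ (1 + zbound m)); [lra|rewrite le_max lexx orbT].
have bm : b <= m by rewrite le_max lexx.
have m1 : 1 <= m by rewrite le_max lexx orbT.
have [s1 _] : exists s : cpath R U (a, b, z) (a, b, z'), runs (kdom Top) s.
  apply: kseg => k Ik; rewrite /lin /=.
  have -> : (1 - k) * a + k * a = a by ring.
  have -> : (1 - k) * b + k * b = b by ring.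
  split=> //= i ip /= aE; have := ab i ip aE => /= h.
  by apply: lt_le_trans h _; nra.
have [s2 _] : exists s : cpath R U (a, b, z') (a, -2^-1, z'), runs (kdom Top) s.
  apply: kseg => k Ik; rewrite /lin /=.
  have -> : (1 - k) * a + k * a = a by ring.
  have -> : (1 - k) * z' + k * z' = z' by ring.
  apply: (@kdom_high _ m) => //=; first by nra.
  by case=> /= a0 b0; apply: ray; split=> //=; nra.
have [s3 _] : exists s : cpath R U (a, -2^-1, z') (0, -2^-1, z'), runs (kdom Top) s.
  apply: kseg => k Ik; rewrite /lin /=.
  have -> : (1 - k) * - 2^-1 + k * - 2^-1 = - 2^-1 :> R by ring.
  have -> : (1 - k) * z' + k * z' = z' by ring.
  by apply: (@kdom_high _ m) => //=; [lra|case=> /=; lra].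
have [s4 _] := kpath_half z' M.
by exists (cpcat s1 (cpcat s2 (cpcat s3 s4))).
Qed.

Lemma kpath_bottom p : kdom Bottom p -> exists s : cpath R U p kbase, True.
Proof.
case: p => -[a b] z T; have [ab ray] := T.
pose m := Num.max b 1; pose z' := Num.min z (- (1 + zbound m)).
have zz' : z' <= z by rewrite ge_min lexx.
have zb : z' < - zbound m.
  by apply: (@le_lt_trans _ _ (- (1 + zbound m))); [rewrite ge_min lexx orbT|lra].
have bm : b <= m by rewrite le_max lexx.
have m1 : 1 <= m by rewrite le_max lexx orbT.
have [s1 _] : exists s : cpath R U (a, b, z) (a, b, z'), runs (kdom Bottom) s.
  apply: kseg => k Ik; rewrite /lin /=.
  have -> : (1 - k) * a + k * a = a by ring.
  have -> : (1 - k) * b + k * b = b by ring.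
  split=> //= i ip /= aE; have := ab i ip aE => /= h.
  by apply: le_lt_trans h; nra.
have [s2 _] : exists s : cpath R U (a, b, z') (a, -2^-1, z'), runs (kdom Bottom) s.
  apply: kseg => k Ik; rewrite /lin /=.
  have -> : (1 - k) * a + k * a = a by ring.
  have -> : (1 - k) * z' + k * z' = z' by ring.
  apply: (@kdom_deep _ m) => //=; first by nra.
  by case=> /= a0 b0; apply: ray; split=> //=; nra.
have [s3 _] : exists s : cpath R U (a, -2^-1, z') (0, -2^-1, z'), runs (kdom Bottom) s.
  apply: kseg => k Ik; rewrite /lin /=.
  have -> : (1 - k) * - 2^-1 + k * - 2^-1 = - 2^-1 :> R by ring.
  have -> : (1 - k) * z' + k * z' = z' by ring.
  by apply: (@kdom_deep _ m) => //=; [lra|case=> /=; lra].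
have [s4 _] := kpath_half z' M.
by exists (cpcat s1 (cpcat s2 (cpcat s3 s4))).
Qed.

(** Two crossings lie on this level, so the four strands have two positions only. For u = outer and
    v = inner, u v = 1 and u^2 + v^2 = 4 give u^3 + v^3 = 3 (u + v), that is, acoord v = - acoord
    u. *)
Lemma strands_at_m2 i : present i (-2 : R) ->
  sa i (-2 : R) = sa S1 (-2) \/ sa i (-2 : R) = sa S4 (-2).
Proof.
move=> _.
suff e : sa S3 (-2) = sa S1 (-2) :> R.
  by case: i; [left|right; rewrite sa_sym23 e sa_sym14 opprK|left|right].
have h5 : -5 <= -2 :> R by lra.
have h1 : -2 <= -1 :> R by lra.
have := rad2 h5; have := rad_ge0 (-2 : R); have := outer2 (-2 : R); have := inner2 h1.
have := outer_ge0 (-2 : R); have := inner_ge0 (-2 : R).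
rewrite sa_sym14 sa3E// sa4E;
  move: (rad _) (outer _) (inner _) => r u v v0 u0 v2 u2 r0 rE.
have uv : u * v = 1.
  have : (u * v) ^+ 2 = 1 by rewrite exprMn u2 v2; lra.
  by have := mulr_ge0 u0 v0; move: (u * v) => w w0 /eqP; rewrite sqrp_eq1// => /eqP.
have e : (u + v) * (u ^+ 2 - u * v + v ^+ 2 - 3) = 0 by rewrite uv u2 v2; ring.
have ur : r = u ^+ 2 - 2 by lra.
have vr : r = 2 - v ^+ 2 by lra.
rewrite {2}ur {1}vr; lra.
Qed.

(** A point caught between two strands, or on the ray, moves sideways at constant level and height
    to a place where no sheet passes, hence into [Top]. *)
Lemma kconnected p : U p -> exists s : cpath R U p kbase, True.
Proof.
case/kcoverP => [|||c14 b4 a0|c13 b2 a1|c24 b2 a4];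
  [exact: kpath_top|exact: kpath_bottom|..].
- case: p => -[a b] z /= -> b0.
  have b1 : -1 < b by lra.
  have s4 := sa4_gt1 b1.
  have [s _] : exists s : cpath R U (0, b, z) (1, b, z), runs (kdom Neck) s.
    apply: kseg => k Ik; rewrite /lin /=.
    have -> : (1 - k) * b + k * b = b by ring.
    by split=> //=; rewrite ?sa_sym14; lra.
  have [|s' _] := @kpath_top (1, b, z).
    apply: kdom_off => [i /=|[/=]]; last lra.
    by case: i => /=; rewrite ?sa_sym14; [lra|case/andP; lra|case/andP; lra|lra].
  by exists (cpcat s s').
- case: p c14 b4 a0 => -[a b] z /= c14 bE aE; subst a b.
  have [_ _ _ b4 a1] := c14.
  have h5 : -5 <= -4 :> R by lra.
have h1 : -4 <= -1 :> R by lra.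
  have r1 : rad (-4) = 1 :> R.
    by have := rad2 h5; have := rad_ge0 (-4 : R); nra.
  have s4 : sa S4 (-4) = 0 :> R by rewrite sa4E r1 subrr mul0r.
  have s3 : sa S3 (-4) < -1 :> R.
    rewrite sa3E// r1; have := inner2 h1; have := inner_ge0 (-4 : R); rewrite r1; nra.
  have [s _] : exists s : cpath R U (0, -4, z) (1, -4, z), runs (kdom Cross14) s.
    apply: kseg => k Ik; rewrite /lin /=.
    have -> : (1 - k) * - 4 + k * - 4 = - 4 :> R by ring.
    have -> : (1 - k) * z + k * z = z by ring.
    split=> /=; [lra|lra|nra| |] => /= e; [apply: b4|apply: a1] => /=.
      by rewrite s4.
    by rewrite sa_sym14 s4 oppr0.
  have [|s' _] := @kpath_top (1, -4, z).
    apply: kdom_off => [i /= _|[/=]]; last lra.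
    by case: i; rewrite ?sa_sym14 ?sa_sym23 ?s4; lra.
  by exists (cpcat s s').
- case: p c13 b2 a1 => -[a b] z /= c13 bE aE; subst b.
  have [_ _ /= a0 b1 a3] := c13.
  have [s _] : exists s : cpath R U (a, -2, z) (a / 2, -2, z), runs (kdom Cross13) s.
    apply: kseg => k Ik; rewrite /lin /=.
    have -> : (1 - k) * - 2 + k * - 2 = - 2 :> R by ring.
    have -> : (1 - k) * z + k * z = z by ring.
    split=> /=; [lra|lra|nra| |] => /= e; [apply: b1|apply: a3] => //=.
    have p3 : present S3 (-2 : R) by rewrite /=; lra.
    have [-> //|s34] := strands_at_m2 p3.
    have h4 : -4 < -2 :> R by lra.
    by have := @sa3_le0 R (-2); have := sa4_gt0 h4; rewrite s34; lra.
  have [|s' _] := @kpath_top (a / 2, -2, z).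
    apply: kdom_off => [i /= ip e|[/=]]; last lra.
    by have [] := strands_at_m2 ip; rewrite -e ?sa_sym14; move: aE;
      rewrite sa_sym14; lra.
  by exists (cpcat s s').
- case: p c24 b2 a4 => -[a b] z /= c24 bE aE; subst b.
  have [_ _ /= a0 b2 a4] := c24.
  have [s _] : exists s : cpath R U (a, -2, z) (a / 2, -2, z), runs (kdom Cross24) s.
    apply: kseg => k Ik; rewrite /lin /=.
    have -> : (1 - k) * - 2 + k * - 2 = - 2 :> R by ring.
    have -> : (1 - k) * z + k * z = z by ring.
    split=> /=; [lra|lra|nra| |] => /= e; [apply: b2|apply: a4] => //=.
    have p2 : present S2 (-2 : R) by rewrite /=; lra.
    have [s21|-> //] := strands_at_m2 p2.
    move: e; rewrite s21 sa_sym14 -aE => e.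
    have ka : k * a <= a by nra.
    by move: e => /= e; lra.
  have [|s' _] := @kpath_top (a / 2, -2, z).
    apply: kdom_off => [i /= ip e|[/=]]; last lra.
    by have [] := strands_at_m2 ip; rewrite -e ?sa_sym14; move: aE; lra.
  by exists (cpcat s s').
Qed.

Let zM b k : b <= 1 -> 0 <= k <= 1 -> zbound b < (1 - k) * M + k * M.
Proof.
move=> b1 _; have -> : (1 - k) * M + k * M = M by ring.
have := outer_mono b1; have := outer_ge0 b; rewrite /M /zbound => o0 o1.
have : outer b ^+ 5 <= outer 1 ^+ 5 by apply: lerXn2r; rewrite ?nnegrE ?outer_ge0.
lra.
Qed.

Let top_seg p q : p.2 = M -> q.2 = M -> p.1.2 <= 1 -> q.1.2 <= 1 ->
    (forall k, 0 <= k <= 1 -> ~ on_ray (lin p q k)) ->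
    exists s : cpath R U p q, runs (kdom Top) s.
Proof.
move=> pM qM p1 q1 ray; apply: kseg => k Ik; apply: (@kdom_high _ 1) (ray _ Ik).
  by rewrite /lin /=; nra.
by rewrite /lin /= pM qM; exact: zM.
Qed.

Let bottom_seg p q : p.2 = - M -> q.2 = - M -> p.1.2 < 0 -> q.1.2 < 0 ->
    exists s : cpath R U p q, runs (kdom Bottom) s.
Proof.
move=> pM qM p1 q1; apply: kseg => k Ik.
have l0 : (lin p q k).1.2 < 0 by rewrite /lin /=; nra.
apply: (@kdom_deep _ 1) => //; [lra| |by case=> _; lra].
by rewrite /lin /= pM qM !mulrN -opprD ltrN2; exact: zM.
Qed.

Let low_ray p q k : p.1.2 < 0 -> q.1.2 < 0 -> 0 <= k <= 1 -> ~ on_ray (lin p q k).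
Proof. by move=> ? ? ?; case=> _; rewrite /lin /=; nra. Qed.

(** Corners of three loops. Two go down over (0, -1/2) and (1, -4), in the regions with labels x1
    and x2, and come up again over (0, -6), below all strands of the diagram. The third circles the
    axis at height [M], crossing the ray at b = 1. *)
Let p1 : E3 := (0, -2^-1, - M).
Let o1 : E3 := (0, -6, - M).
Let o2 : E3 := (0, -6, M).
Let q1 : E3 := (1, -4, - M).
Let q2 : E3 := (1, -4, M).
Let b1 : E3 := (1, -2^-1, M).
Let b2 : E3 := (1, 1, M).
Let b3 : E3 := (-1, 1, M).
Let b4 : E3 := (-1, -2^-1, M).

Let path_up : exists s : cpath R U o1 kbase, exists2 t : cpath R U o1 o2,
  runs (kdom Top) t & exists2 u : cpath R U o2 kbase, runs (kdom Top) u & s = cpcat t u.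
Proof.
have [t rt] : exists s : cpath R U o1 o2, runs (kdom Top) s.
  apply: kseg => k Ik; rewrite /lin /=; apply: kdom_off => [i /=|[/= _]]; last lra.
  by case: i => /=; lra.
have [u ru] : exists s : cpath R U o2 kbase, runs (kdom Top) s.
  apply: top_seg => //=; try lra.
  by move=> k; apply: low_ray => /=; lra.
by exists (cpcat t u); exists t => //; exists u.
Qed.

Let path_p : exists s : cpath R U p1 o1, runs (kdom Bottom) s.
Proof. by apply: bottom_seg => //=; lra. Qed.

Let path_q2 : exists s : cpath R U kbase q2, runs (kdom Top) s.
Proof.
apply: top_seg => //=; try lra.
by move=> k; apply: low_ray => /=; lra.
Qed.

Let sa4_m4 : sa S4 (-4) = 0 :> R.
Proof.
have h5 : -5 <= -4 :> R by lra.
have r1 : rad (-4) = 1 :> R by have := rad2 h5; have := rad_ge0 (-4 : R); nra.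
by rewrite sa4E r1 subrr mul0r.
Qed.

Let sa3_m4 : sa S3 (-4) < -1 :> R.
Proof.
have h5 : -5 < -4 :> R by lra.
have h3 : -4 < -3 :> R by lra.
have [] := sa3_low h5 h3; nra.
Qed.

Let path_q : exists s : cpath R U q2 q1, runs (kdom Top) s.
Proof.
apply: kseg => k Ik; rewrite /lin /=.
have -> : (1 - k) * - 4 + k * - 4 = - 4 :> R by ring.
have -> : (1 - k) * 1 + k * 1 = 1 :> R by ring.
apply: kdom_off => [i /= _|[/=]]; last lra.
by have := sa3_m4; case: i; rewrite ?sa_sym14 ?sa_sym23 ?sa4_m4; lra.
Qed.

Let path_q1 : exists s : cpath R U q1 o1, runs (kdom Bottom) s.
Proof. by apply: bottom_seg => //=; lra. Qed.

Let path_b1 : exists s : cpath R U kbase b1, runs (kdom Top) s.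
Proof.
apply: top_seg => //=; try lra.
by move=> k; apply: low_ray => /=; lra.
Qed.

Let path_b2 : exists s : cpath R U b1 b2, runs (kdom Top) s.
Proof. by apply: top_seg => //=; try lra; move=> k Ik; case; rewrite /lin /=; lra. Qed.

Let path_b3 : exists s : cpath R U b2 b3, runs (kdom Neck) s.
Proof.
have h0 : -1 < 1 :> R by lra.
have s41 := sa4_gt1 h0.
apply: kseg => k Ik; rewrite /lin /=.
have -> : (1 - k) * 1 + k * 1 = 1 :> R by ring.
by split=> /=; rewrite ?sa_sym14; lra.
Qed.

Let path_b4 : exists s : cpath R U b3 b4, runs (kdom Top) s.
Proof. by apply: top_seg => //=; try lra; move=> k Ik; case; rewrite /lin /=; lra. Qed.

Let path_b5 : exists s : cpath R U b4 kbase, runs (kdom Top) s.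
Proof.
apply: top_seg => //=; try lra.
by move=> k; apply: low_ray => /=; lra.
Qed.

Section Loops.
Context (G : groupType) (x1 x2 x3 h : G).

Let bottom_o : klabel x1 x2 x3 h Bottom o1 = 1%g.
Proof.
have h6 : -6 <= -5 :> R by lra.
by rewrite /= /beta sa_sym14 sa_sym23 (sa34_junk h6); case: (_ < _); case: (_ < _).
Qed.

Let bottom_p : klabel x1 x2 x3 h Bottom p1 = x1.
Proof.
have h6 : -1 < -2^-1 :> R by lra.
have g1 := sa4_gt1 h6.
rewrite /= /beta /= sa_sym14 sa_sym23 (sa3_junk (ltW h6)) oppr0 ltxx.
have -> : - sa S4 (-2^-1) < 0 :> R by lra.
by have -> : (sa S4 (-2^-1) < 0 :> R) = false by lra.
Qed.

Let bottom_q : klabel x1 x2 x3 h Bottom q1 = x2.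
Proof.
have s3 := sa3_m4.
rewrite /= /beta /= sa_sym14 sa_sym23 sa4_m4 oppr0 ltr01.
have -> : (- sa S3 (-4) < 1 :> R) = false by lra.
by have -> : sa S3 (-4) < 1 :> R by lra.
Qed.

Let neck_b2 : klabel x1 x2 x3 h Neck b2 = h.
Proof. by rewrite /= ltr01. Qed.

Let neck_b3 : klabel x1 x2 x3 h Neck b3 = 1%g.
Proof. by rewrite /=; have -> : (0 < -1 :> R) = false by lra. Qed.

Hypothesis x13 : (x1 * x3 = x3 * x2)%g.
Hypothesis x21 : (x2 * x1 = x3 * x2)%g.

(** Stretches in [Top] have trivial holonomy, so each loop picks up only the label difference along
    its stretch in [Bottom] or in [Neck]. *)
Theorem knot_hom (x : @knot_complement R) : \val x = kbase ->
  exists (phi : {multiplicative pi1 R x -> G}) (c1 c2 c3 : pi1 R x),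
    [/\ phi c1 = x1, phi c2 = x2 & phi c3 = h].
Proof.
case: x => _p Up /= xE; subst _p; set x := SigSub Up.
have loc i j p : U p -> kdom i p -> kdom j p -> \forall q \near p, U q ->
    ((klabel x1 x2 x3 h i q)^-1 * klabel x1 x2 x3 h j q
     = (klabel x1 x2 x3 h i p)^-1 * klabel x1 x2 x3 h j p)%g.
  move=> _ ip jp; have := label_loc_all h x13 x21 ip jp.
  exact: filterS.
have [phi phiE] := holonomy_hom R (@kcover R) (@near_kdom R) loc x.
pose hol p q := @holonomy R _ _ _ _ _ _ (@kcover R) (@near_kdom R) loc p q.
have holE c p q (s : cpath R U p q) : runs (kdom c) s ->
    hol p q s = (klabel x1 x2 x3 h c p * (klabel x1 x2 x3 h c q)^-1)%g.
  by move=> rs; rewrite /hol (holonomy_chart _ _ _ rs).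
have holT p q (s : cpath R U p q) : runs (kdom Top) s -> hol p q s = 1%g.
  by move=> /holE -> /=; rewrite mulgV.
have hol_cat p q r (s : cpath R U p q) (t : cpath R U q r) :
    hol _ _ (cpcat s t) = (hol _ _ s * hol _ _ t)%g by exact: holonomy_cat.
have [_ [d3 rd3 [d4 rd4 _]]] := path_up.
have [d1 rd1] : exists s : cpath R U kbase p1, runs (kdom Top) s := kpath_half M (- M).
have [d2 rd2] := path_p.
have [e1 re1] := path_q2; have [e2 re2] := path_q; have [e3 re3] := path_q1.
have [f1 rf1] := path_b1; have [f2 rf2] := path_b2; have [f3 rf3] := path_b3.
have [f4 rf4] := path_b4; have [f5 rf5] := path_b5.
have E1 : hol kbase kbase (cpcat d1 (cpcat d2 (cpcat d3 d4))) = x1.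
  rewrite !hol_cat (holT _ _ _ rd1) (holE _ _ _ _ rd2) (holT _ _ _ rd3) (holT _
    _ _ rd4).
  by rewrite bottom_o bottom_p invg1 !mulg1 mul1g.
have E2 : hol kbase kbase (cpcat e1 (cpcat e2 (cpcat e3 (cpcat d3 d4)))) = x2.
  rewrite !hol_cat (holT _ _ _ re1) (holT _ _ _ re2) (holE _ _ _ _ re3).
  rewrite (holT _ _ _ rd3) (holT _ _ _ rd4).
  by rewrite bottom_o bottom_q invg1 !mulg1 !mul1g.
have E3 : hol kbase kbase (cpcat f1 (cpcat f2 (cpcat f3 (cpcat f4 f5)))) = h.
  rewrite !hol_cat (holT _ _ _ rf1) (holT _ _ _ rf2) (holE _ _ _ _ rf3).
  rewrite (holT _ _ _ rf4) (holT _ _ _ rf5).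
  by rewrite neck_b2 neck_b3 invg1 !mulg1 !mul1g.
exists phi, (cpath_class (x0 := x) (cpcat d1 (cpcat d2 (cpcat d3 d4)))),
  (cpath_class (x0 := x) (cpcat e1 (cpcat e2 (cpcat e3 (cpcat d3 d4))))),
  (cpath_class (x0 := x) (cpcat f1 (cpcat f2 (cpcat f3 (cpcat f4 f5))))).
by split; rewrite phiE; [exact: E1|exact: E2|exact: E3].
Qed.

End Loops.
End KnotLoops.

(** * The group of the knot complement *)

(* The generalized dihedral group of [V]: (true, v) is the reflection
   x |-> v - x and (false, v) the translation x |-> v + x. *)
Definition gdih (V : zmodType) : Type := (bool * V)%type.
HB.instance Definition _ (V : zmodType) := Choice.on (gdih V).

Section GeneralizedDihedral.
Context (V : zmodType).
Implicit Types x y z : gdih V.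

Definition gdih_mul x y : gdih V := (x.1 (+) y.1, x.2 + (if x.1 then - y.2 else y.2)).
Definition gdih_one : gdih V := (false, 0).
Definition gdih_inv x : gdih V := (x.1, if x.1 then x.2 else - x.2).

Lemma gdih_mulA : associative gdih_mul.
Proof.
move=> [a u] [b v] [c w]; rewrite /gdih_mul /=; congr (_, _); first exact: addbA.
by case: a; case: b; rewrite /= ?opprD ?opprK addrA.
Qed.

Lemma gdih_mul1 : left_id gdih_one gdih_mul.
Proof. by case=> a u; rewrite /gdih_mul /= add0r. Qed.

Lemma gdih_1mul : right_id gdih_one gdih_mul.
Proof. by case=> -[] u; rewrite /gdih_mul /= ?oppr0 addr0. Qed.

Lemma gdih_mulV : left_inverse gdih_one gdih_inv gdih_mul.
Proof. by case=> -[] u; rewrite /gdih_mul /= ?subrr ?addNr. Qed.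

Lemma gdih_Vmul : right_inverse gdih_one gdih_inv gdih_mul.
Proof. by case=> -[] u; rewrite /gdih_mul /= subrr. Qed.

HB.instance Definition _ :=
  isGroup.Build (gdih V) gdih_mulA gdih_mul1 gdih_1mul gdih_mulV gdih_Vmul.
End GeneralizedDihedral.

Lemma gdih_map (V W : zmodType) (f : V -> W) :
  {morph f : u v / u + v} -> {morph f : u / - u} ->
  exists phi : {multiplicative gdih V -> gdih W}, forall x, phi x = (x.1, f x.2).
Proof.
move=> fD fN; pose g (x : gdih V) : gdih W := (x.1, f x.2).
have gM : {morph g : x y / (x * y)%g}.
  case=> [a u] [b v]; congr (_, _) => /=; rewrite fD.
  by case: a; rewrite ?fN.
by exists (HB.pack_for {multiplicative gdih V -> gdih W} g
  (isMultiplicative.Build _ _ g gM)).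
Qed.

Lemma common_kernel (F : fieldType) (v w : 'rV[F]_3) :
  exists2 u : 'rV[F]_3, u != 0 & u *m v^T = 0 /\ u *m w^T = 0.
Proof.
pose A := row_mx v^T w^T; exists (nz_row (kermx A)).
  rewrite nz_row_eq0 -mxrank_eq0 mxrank_ker subn_eq0 -ltnNge.
  by apply: leq_ltn_trans (rank_leq_col A) _.
have : nz_row (kermx A) *m A = 0 by apply/sub_kermxP; exact: nz_row_sub.
by rewrite mul_mx_row -[0]row_mx0 => /eq_row_mx.
Qed.

(* x1, x2, x3 give a Fox 3-colouring of the trefoil. The vectors of the images of
   two generators would lie in the kernel of a nonzero linear form on F_3^3, but
   those of x1, x2, h do not. *)
Theorem knot_group_not_free_on_two (R : realType) (x : @knot_complement R) :
  ~ free_on_two (pi1 R x).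
Proof.
have B : kbase R \in @knot_complement R.
  by rewrite inE; exact: kbase_in_complement.
have [p _] := kconnected (set_valP x).
move=> /(free_on_two_isomorphic (pi1_base_change (x := x) (y := SigSub B) p)).
move=> [b1 [b2 [_ uniq]]].
pose V : zmodType := 'rV['F_3]_3.
pose e (i : 'I_3) : V := delta_mx 0 i.
have F3 : 3 = 0 :> 'F_3 by apply/val_inj.
pose x1 : gdih V := (true, e 0); pose x2 : gdih V := (true, e 1).
(* The product of two reflections is the translation by the difference of their vectors v1, v2, v3,
   so the relations read v1 - v3 = v3 - v2 = v2 - v1. In characteristic 3 this says v1 + v2 + v3 =
   0. *)
pose x3 : gdih V := (true, - e 0 - e 1); pose h : gdih V := (false, e 2%:R).
have x13 : (x1 * x3 = x3 * x2)%g.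
  congr (_, _) => /=; apply/rowP => i; rewrite !mxE; apply/subr0_eq.
  by rewrite -(mul0r ((e 0) 0 i + (e 1) 0 i)) -F3 !mxE; ring.
have x21 : (x2 * x1 = x3 * x2)%g.
  congr (_, _) => /=; apply/rowP => i; rewrite !mxE; apply/subr0_eq.
  by rewrite -(mul0r ((e 1) 0 i)) -F3 !mxE; ring.
have [phi [c1 [c2 [c3 [E1 E2 E3]]]]] :=
  @knot_hom R _ x1 x2 x3 h x13 x21 (SigSub B) erefl.
have [u u0 [uv uw]] := common_kernel (phi b1).2 (phi b2).2.
pose f (v : V) : 'F_3 := (u *m v^T) 0 0.
have fD : {morph f : v w / v + w} by move=> v w; rewrite /f linearD /= mulmxDr mxE.
have fN : {morph f : v / - v} by move=> v; rewrite /f linearN /= mulmxN mxE.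
have [F FE] := gdih_map fD fN.
have [F0 F0E] : exists phi : {multiplicative gdih V ->
  gdih 'F_3}, forall x, phi x = (x.1, 0).
  by apply: (@gdih_map V 'F_3 (fun=> 0)) => [v w|v]; rewrite ?addr0 ?oppr0.
(* [F] applies the form [u] to vectors and [F0] the zero form. They agree on the images of the two
   generators, so [u] kills the vector of every element in the image of [phi]. *)
have FF0 : F \o phi =1 F0 \o phi.
  by apply: uniq; rewrite /= FE F0E /f ?uv ?uw mxE.
have fc c : f (phi c).2 = 0 by have := FF0 c; rewrite /= FE F0E => -[].
have fe i : f (e i) = u 0 i.
  rewrite /f mxE (bigD1 i)//= big1 ?addr0 => [|j ji]; first by rewrite !mxE !eqxx mulr1.
  by rewrite !mxE (negbTE ji) andbF mulr0.
case/eqP: u0; apply/rowP => i; rewrite mxE -fe.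
have := fc c1; have := fc c2; have := fc c3; rewrite E1 E2 E3 /= => f2 f1 f0.
by case: i => -[|[|[|//]]] i3; [rewrite -[RHS]f0|rewrite -[RHS]f1|rewrite -[RHS]f2];
  congr (f (e _)); apply/val_inj.
Qed.

(** * Real points of SL_2 *)

Section RealPoints.
Context (R : realType).

Lemma rv_continuous_at (X : topologicalType) n (f : X -> 'rV[R]_n) x :
  (forall j, {for x, continuous (fun y => f y 0 j)}) -> {for x, continuous f}.
Proof.
move=> cf A [P nP PA].
have : \forall y \near x, forall j, P 0 j (f y 0 j).
  by apply: filter_forall => j; exact: (cf j _ (nP 0 j)).
by apply: filterS => y Py; apply: PA => i j; rewrite ord1.
Qed.

Lemma continuous_sum (X : topologicalType) (I : Type) (r : seq I) (F : I -> X -> R) :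
  (forall i, continuous (F i)) -> continuous (fun x => \sum_(i <- r) F i x).
Proof.
move=> cF; elim: r => [|i r IH].
  by under eq_fun do rewrite big_nil; exact: cst_continuous.
under eq_fun do rewrite big_cons.
exact: continuousD.
Qed.

Lemma continuous_prod (X : topologicalType) (I : Type) (r : seq I) (F : I -> X -> R) :
  (forall i, continuous (F i)) -> continuous (fun x => \prod_(i <- r) F i x).
Proof.
move=> cF; elim: r => [|i r IH].
  by under eq_fun do rewrite big_nil; exact: cst_continuous.
under eq_fun do rewrite big_cons.
exact: continuousM.
Qed.

Lemma continuous_meval n (q : mpoly n R) : continuous (fun x : 'rV[R]_n =>
  meval (x 0) q).
Proof.
under eq_fun do rewrite mevalE.
apply: continuous_sum => m; apply: continuousM; first exact: cst_continuous.
by apply: continuous_prod => i; apply: continuousX; exact: coord_continuous.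
Qed.

Lemma continuous_on_points m n (p : n.-tuple (mpoly m R)) : continuous (on_points p).
Proof.
move=> x; apply: rv_continuous_at => j.
have -> : (fun y : 'rV[R]_m => on_points p y 0 j) = fun y => meval (y 0) (tnth p j).
  by apply/funext => y; rewrite mxE.
exact: continuous_meval.
Qed.

Lemma meval_comp_mpoly m n (p : n.-tuple (mpoly m R)) (q : mpoly n R) (x : 'rV[R]_m) :
  meval (x 0) (comp_mpoly p q) = meval (on_points p x 0) q.
Proof. by rewrite comp_mpoly_meval; apply: meval_eq => i; rewrite mxE. Qed.

Lemma on_points_comp l m n (q : n.-tuple (mpoly m R)) (p : m.-tuple (mpoly l R)) x :
  on_points (comp_morphism q p) x = on_points q (on_points p x).
Proof. by apply/rowP => i; rewrite !mxE tnth_mktuple meval_comp_mpoly. Qed.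

Lemma on_points_id n (x : 'rV[R]_n) : on_points (id_morphism R n) x = x.
Proof. by apply/rowP => i; rewrite !mxE tnth_mktuple mevalXU. Qed.

Lemma on_points_rational m n (X : affine_scheme R m) (Y : affine_scheme R n) p x :
  is_morphism X Y p -> rational_points X x -> rational_points Y (on_points p x).
Proof. by move=> pXY Xx q /pXY /Xx; rewrite meval_comp_mpoly. Qed.

Lemma on_points_eq m n (X : affine_scheme R m) (p p' : n.-tuple (mpoly m R)) x :
  eq_morphism X p p' -> rational_points X x -> on_points p x = on_points p' x.
Proof.
move=> pp' Xx; apply/rowP => i; rewrite !mxE; apply/subr0_eq.
by rewrite -mevalB; exact: Xx.
Qed.

Definition mx4 (a b c d : R) : 'rV[R]_4 := \row_j nth 0 [:: a; b; c; d] j.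

Lemma mx4P (x : 'rV[R]_4) :
  x = mx4 (x 0 (ord4 0)) (x 0 (ord4 1)) (x 0 (ord4 2)) (x 0 (ord4 3)).
Proof.
apply/rowP => j; rewrite mxE.
by case: j => -[|[|[|[|//]]]] j4 /=; congr (x 0 _); apply/val_inj; rewrite /= inordK.
Qed.

Lemma mx4E a b c d : [/\ mx4 a b c d 0 (ord4 0) = a, mx4 a b c d 0 (ord4 1) = b,
  mx4 a b c d 0 (ord4 2) = c & mx4 a b c d 0 (ord4 3) = d].
Proof. by rewrite !mxE !inordK. Qed.

Lemma mx4_inj a b c d a' b' c' d' : mx4 a b c d = mx4 a' b' c' d' ->
  [/\ a = a', b = b', c = c' & d = d'].
Proof.
have [ea eb ec ed] := mx4E a b c d; have [ea' eb' ec' ed'] := mx4E a' b' c' d'.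
by move=> e; move: ea eb ec ed; rewrite e ea' eb' ec' ed'.
Qed.

Lemma SL2_pointP a b c d : rational_points (SL2 R) (mx4 a b c d) <-> a * d - b * c = 1.
Proof.
have [e0 e1 e2 e3] := mx4E a b c d.
have fE : meval (mx4 a b c d 0) (mpolyX R (mnm1 (ord4 0)) * mpolyX R (mnm1 (ord4 3))
   - mpolyX R (mnm1 (ord4 1)) * mpolyX R (mnm1 (ord4 2)) - 1) = a * d - b * c - 1.
  by rewrite !mevalB !mevalM meval1 !mevalXU e0 e1 e2 e3.
split=> [h|h q [r ->]].
  by apply/subr0_eq; rewrite -fE; apply: h; exists 1; rewrite mul1r.
by rewrite mevalM fE h subrr mulr0.
Qed.

Lemma mevalXn n (v : 'I_n -> R) (q : mpoly n R) k : meval v (q ^+ k) = meval v q ^+ k.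
Proof. by elim: k => [|k IH]; rewrite ?expr0 ?meval1// !exprS mevalM IH. Qed.

Lemma meval_nat n (v : 'I_n -> R) k : meval v (k%:R : mpoly n R) = k%:R.
Proof. by rewrite mevalMn meval1. Qed.

Definition tau_c (t : R) : R :=
  1 + 16^-1 * (t ^+ 2 * (17 * t ^+ 6 - 56 * t ^+ 4 - 137 * t ^+ 2 + 452)).
Definition tau_d (t : R) : R :=
  16^-1 * (t * (17 * t ^+ 8 - 73 * t ^+ 6 - 149 * t ^+ 4 + 609 * t ^+ 2 + 172)).

Lemma on_points_tau (x : 'rV[R]_1) : let t := x 0 0 in
  on_points (tau R) x = mx4 (acoord t) (bcoord t) (tau_c t) (tau_d t).
Proof.
move=> t; apply/rowP => j; rewrite !mxE.
case: j => -[|[|[|[|//]]]] j4; rewrite (tnth_nth 0) /=;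
  by rewrite !(meval_nat, meval1, mevalXn, mevalXU, mevalZ, mevalB, mevalM, mevalD).
Qed.

Lemma on_points_tau1 (x : 'rV[R]_1) : on_points (tau1 R) x = mx4 1 0 (x 0 0) 1.
Proof.
apply/rowP => j; rewrite !mxE.
case: j => -[|[|[|[|//]]]] j4; rewrite (tnth_nth 0) /= ?meval1 ?meval0 ?mevalXU//.
Qed.


Lemma rational_affine n (x : 'rV[R]_n) : rational_points (affine_space R n) x.
Proof. by move=> q ->; rewrite meval0. Qed.

Lemma SL2_complement_tauP a b c d : SL2_complement (tau R) (mx4 a b c d) <->
  a * d - b * c = 1 /\
  forall t, (a, b, c, d) <> (acoord t, bcoord t, tau_c t, tau_d t).
Proof.
split=> [[/SL2_pointP de nt]|[de nt]]; split => //; last 2 first.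
- exact/SL2_pointP.
- case=> x _; rewrite on_points_tau => /mx4_inj[ea eb ec ed].
  by apply: (nt (x 0 0)); rewrite ea eb ec ed.
move=> t [ea eb ec ed]; apply: nt; exists (\row_i t); first exact: rational_affine.
by rewrite on_points_tau mxE ea eb ec ed.
Qed.

Lemma SL2_complement_tau1P a b c d : SL2_complement (tau1 R) (mx4 a b c d) <->
  a * d - b * c = 1 /\ ~ (a = 1 /\ b = 0).
Proof.
split=> [[/SL2_pointP de nt]|[de nt]]; split => //; last 2 first.
- exact/SL2_pointP.
- by case=> x _; rewrite on_points_tau1 => /esym/mx4_inj[ea eb _ _]; apply: nt.
case=> ea eb; apply: nt; exists (\row_i c); first exact: rational_affine.
rewrite on_points_tau1 mxE ea eb; congr mx4.
by move: de; rewrite ea eb mul1r mul0r subr0.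
Qed.

(* Chosen so that the third coordinate of tau becomes the polynomial [zcoord] of
   degree 5: a c + b d has degree 13 along tau, and its reduction modulo
   k[a, b] only has terms in the degrees 1, 2, 5 outside the semigroup <3, 4>. *)
Definition shear (a b : R) : R :=
  17 / 16 * a ^+ 3 * b + 97 / 16 * a * b ^+ 2 + 2 * a ^+ 3 + 53 / 16 * a * b -
    73 / 2 * a.

Lemma continuous_shear (X : topologicalType) (u v : X -> R) :
  continuous u -> continuous v -> continuous (fun x => shear (u x) (v x)).
Proof.
move=> cu cv.
have kM k (w : X -> R) : continuous w -> continuous (fun x => k * w x).
  by apply: continuousM; exact: cst_continuous.
have -> : (fun x => shear (u x) (v x)) = (fun x =>
    17 / 16 * (u x ^+ 3 * v x) + 97 / 16 * (u x * v x ^+ 2) + 2 * u x ^+ 3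
    + 53 / 16 * (u x * v x) + - (73 / 2) * u x).
  by apply/funext => x; rewrite /shear; ring.
exact: (continuousD (continuousD (continuousD (continuousD
  (kM _ _ (continuousM (continuousX (n := 3) cu) cv))
  (kM _ _ (continuousM cu (continuousX (n := 2) cv))))
  (kM _ _ (continuousX (n := 3) cu))) (kM _ _ (continuousM cu cv))) (kM _ _ cu)).
Qed.

(** For a first row (a, b), the second rows of determinant 1 form the line through (-b, a) / (a^2 +
    b^2) directed by (a, b), on which a c + b d is a coordinate. *)
Definition to_space (x : 'rV[R]_4) : R * R * R :=
  let a := x 0 (ord4 0) in let b := x 0 (ord4 1) in
  (a, b, shear a b - (a * x 0 (ord4 2) + b * x 0 (ord4 3))).

Definition of_space (p : R * R * R) : 'rV[R]_4 :=
  let a := p.1.1 in let b := p.1.2 in let n := a ^+ 2 + b ^+ 2 in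
  let s := (shear a b - p.2) / n in
  mx4 a b (- b / n + s * a) (a / n + s * b).

Lemma to_space_mx4 a b c d : to_space (mx4 a b c d) =
  (a, b, shear a b - (a * c + b * d)).
Proof. by rewrite /to_space; have [-> -> -> ->] := mx4E a b c d. Qed.

Lemma sq_norm_neq0 (a b : R) : ~ (a = 0 /\ b = 0) -> a ^+ 2 + b ^+ 2 != 0.
Proof.
move=> ab; rewrite paddr_eq0 ?sqr_ge0// !sqrf_eq0; apply/negP => /andP[/eqP a0 /eqP b0].
exact: ab.
Qed.

Lemma det1_neq0 (a b c d : R) : a * d - b * c = 1 -> ~ (a = 0 /\ b = 0).
Proof. by move=> de [a0 b0]; move: de; rewrite a0 b0 !mul0r subr0 => /eqP;
  rewrite eq_sym oner_eq0. Qed.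

Lemma to_spaceK a b c d : a * d - b * c = 1 ->
  of_space (to_space (mx4 a b c d)) = mx4 a b c d.
Proof.
move=> de; have n0 := sq_norm_neq0 (det1_neq0 de).
rewrite to_space_mx4 /of_space /=; congr mx4.
  apply: (mulIf n0); rewrite mulrDl mulrVK ?unitfE// -[- b]mulr1 -de.
  by field.
apply: (mulIf n0); rewrite mulrDl mulrVK ?unitfE// -[a in X in X + _]mulr1 -de.
by field.
Qed.

Lemma of_spaceP p : ~ (p.1.1 = 0 /\ p.1.2 = 0) -> exists c d,
  [/\ of_space p = mx4 p.1.1 p.1.2 c d, p.1.1 * d - p.1.2 * c = 1
    & to_space (of_space p) = p].
Proof.
case: p => -[a b] z /= ab; have n0 := sq_norm_neq0 ab.
rewrite /of_space /=; do 2 eexists; split; first by reflexivity.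
  by field.
by rewrite to_space_mx4; congr (_, _, _); field.
Qed.

Lemma to_space_tau t :
  to_space (mx4 (acoord t) (bcoord t) (tau_c t) (tau_d t)) = knot t.
Proof.
rewrite to_space_mx4 /knot; congr (_, _, _).
by rewrite /shear /tau_c /tau_d /acoord /bcoord /zcoord; field.
Qed.

Lemma continuous_to_space : continuous to_space.
Proof.
have cc i : continuous (fun x : 'rV[R]_4 => x 0 i) by exact: coord_continuous.
apply: (@pair_continuous _ (R * R)%type).
  by apply: (@pair_continuous _ R); exact: cc.
apply: (continuousD (continuous_shear (cc _) (cc _))).
by apply: continuousN;
  exact: (continuousD (continuousM (cc _) (cc _)) (continuousM (cc _) (cc _))).
Qed.

Lemma continuous_of_space p : ~ (p.1.1 = 0 /\ p.1.2 = 0) ->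
  {for p, continuous of_space}.
Proof.
move=> ab; have n0 := sq_norm_neq0 ab.
have ca := @continuous_a R p; have cb := @continuous_b R p;
  have cz := @continuous_z R p.
have csq (u : R * R * R -> R) : {for p, continuous u} ->
  {for p, continuous (fun q => u q ^+ 2)}.
  by move=> cu; apply: cvgM.
have cn : {for p, continuous (fun q : R * R * R => (q.1.1 ^+ 2 + q.1.2 ^+ 2)^-1)}.
  by apply: cvgV => //; apply: cvgD; exact: csq.
have csh : {for p, continuous (fun q : R * R * R => shear q.1.1 q.1.2)}.
  by apply: continuous_shear; [exact: continuous_a|exact: continuous_b].
have cs : {for p, continuous (fun q : R * R * R =>
    (shear q.1.1 q.1.2 - q.2) / (q.1.1 ^+ 2 + q.1.2 ^+ 2))}.
  by apply: cvgM => //; apply: cvgB.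
apply: rv_continuous_at => j.
have eE : (fun q => of_space q 0 j) = fun q => nth 0 [:: q.1.1; q.1.2;
     - q.1.2 / (q.1.1 ^+ 2 + q.1.2 ^+ 2)
       + (shear q.1.1 q.1.2 - q.2) / (q.1.1 ^+ 2 + q.1.2 ^+ 2) * q.1.1;
     q.1.1 / (q.1.1 ^+ 2 + q.1.2 ^+ 2)
       + (shear q.1.1 q.1.2 - q.2) / (q.1.1 ^+ 2 + q.1.2 ^+ 2) * q.1.2] j.
  by apply/funext => q; rewrite mxE.
rewrite eE; case: j eE => -[|[|[|[|//]]]] j4 _ //=.
  by apply: cvgD; apply: cvgM => //; exact: cvgN.
by apply: cvgD; apply: cvgM.
Qed.

Lemma within_of_space (A : set (R * R * R)) :
  (forall p, A p -> ~ (p.1.1 = 0 /\ p.1.2 = 0)) -> {within A, continuous of_space}.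
Proof.
move=> Aab; apply: continuous_in_subspaceT => p; rewrite inE => /Aab.
exact: continuous_of_space.
Qed.

Lemma SL2_point x : rational_points (SL2 R) x -> exists a b c d,
  x = mx4 a b c d /\ a * d - b * c = 1.
Proof.
by rewrite (mx4P x) => /SL2_pointP de; do 4 eexists; split; [reflexivity|exact: de].
Qed.

Lemma pi1_to_space (p : 4.-tuple (mpoly 1 R)) (A : set (R * R * R)) :
  (forall q, A q -> ~ (q.1.1 = 0 /\ q.1.2 = 0)) ->
  (forall x, SL2_complement p x -> A (to_space x)) ->
  (forall q, A q -> SL2_complement p (of_space q)) ->
  forall x : SL2_complement p, exists y : A, isomorphic_groups (pi1 R x) (pi1 R y).
Proof.
move=> A0 toA ofA x; have Ax := toA _ (set_valP x).
have Ax' : to_space (\val x) \in A by rewrite inE.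
exists (SigSub Ax'); apply: (@pi1_homeomorphic _ _ _ _ _ to_space of_space) => //.
- by apply: continuous_subspaceT; exact: continuous_to_space.
- exact: within_of_space.
- by move=> z [/SL2_point[a [b [c [d [-> de]]]]] _]; exact: to_spaceK.
- by move=> q /A0 /of_spaceP[c [d []]].
Qed.

Lemma of_space_tau_complement q :
  @knot_complement R q -> SL2_complement (tau R) (of_space q).
Proof.
case=> q0 qt; have [c [d [oE de qE]]] := of_spaceP q0; rewrite oE in qE *.
apply/SL2_complement_tauP; split=> // t [ea eb ec ed]; apply: (qt t).
by rewrite -to_space_tau -ea -eb -ec -ed.
Qed.

Lemma pi1_tau_complement (x : SL2_complement (tau R)) :
  exists y : @knot_complement R, isomorphic_groups (pi1 R x) (pi1 R y).
Proof.
apply: pi1_to_space => [q []//|z|q]; last first.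
  exact: of_space_tau_complement.
move=> zc; have [/SL2_point[a [b [c [d [zE de]]]]] _] := zc; move: zc; rewrite zE.
case/SL2_complement_tauP => _ nt; split.
    by rewrite to_space_mx4 /=; exact: det1_neq0 de.
  move=> t e; have := to_spaceK de; rewrite e -to_space_tau.
  have det : acoord t * tau_d t - bcoord t * tau_c t = 1.
    by rewrite /acoord /bcoord /tau_c /tau_d; field.
  rewrite (to_spaceK det) => e'; apply: (nt t).
  by have [-> -> -> ->] := mx4_inj e'.
Qed.

Lemma pi1_tau1_complement (x : SL2_complement (tau1 R)) : free_on_two (pi1 R x).
Proof.
suff : exists y : @two_punctures R, isomorphic_groups (pi1 R x) (pi1 R y).
  by case=> y /isomorphic_sym xy;
    apply: free_on_two_isomorphic xy (pi1_two_punctures y).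
apply: pi1_to_space => [q []//|z|q [q0 q1]].
  move=> zc; have [/SL2_point[a [b [c [d [zE de]]]]] _] := zc; move: zc; rewrite zE.
  case/SL2_complement_tau1P => _ nt; rewrite to_space_mx4; split=> //=.
  exact: det1_neq0 de.
have [c [d [-> de qE]]] := of_spaceP q0; exact/SL2_complement_tau1P.
Qed.

Theorem pi1_complements_not_isomorphic (x : SL2_complement (tau R))
    (y : SL2_complement (tau1 R)) : ~ isomorphic_groups (pi1 R x) (pi1 R y).
Proof.
move=> xy; have [z xz] := pi1_tau_complement x.
apply: (@knot_group_not_free_on_two R z).
apply: free_on_two_isomorphic (pi1_tau1_complement y).
exact: isomorphic_trans (isomorphic_sym xy) xz.
Qed.

(** Polynomial maps are continuous on real points, so an automorphism carrying tau to tau_1 would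
    restrict to a homeomorphism of the two complements. *)
Theorem tau_not_equivalent : ~ equivalent_embeddings (affine_space R 1) (SL2 R)
  (tau R) (tau1 R).
Proof.
case=> phi [[phiS [psi [psiS psiphi phipsi]]] tauE].
have tE (y : 'rV[R]_1) : on_points (tau1 R) y = on_points phi (on_points (tau R) y).
  by rewrite -on_points_comp; apply: on_points_eq tauE _; exact: rational_affine.
have fK x : rational_points (SL2 R) x -> on_points psi (on_points phi x) = x.
  by move=> Sx; rewrite -on_points_comp (on_points_eq psiphi Sx) on_points_id.
have gK x : rational_points (SL2 R) x -> on_points phi (on_points psi x) = x.
  by move=> Sx; rewrite -on_points_comp (on_points_eq phipsi Sx) on_points_id.
have Stau (y : 'rV[R]_1) : rational_points (SL2 R) (on_points (tau R) y).
  rewrite on_points_tau; apply/SL2_pointP.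
  by rewrite /acoord /bcoord /tau_c /tau_d; field.
have fU x : SL2_complement (tau R) x -> SL2_complement (tau1 R) (on_points phi x).
  case=> Sx nx; split; first exact: on_points_rational phiS Sx.
  case=> y _ yE; apply: nx; exists y; first exact: rational_affine.
  by rewrite -(fK x)// -yE tE fK.
have gU x : SL2_complement (tau1 R) x -> SL2_complement (tau R) (on_points psi x).
  case=> Sx nx; split; first exact: on_points_rational psiS Sx.
  case=> y _ yE; apply: nx; exists y; first exact: rational_affine.
  by rewrite tE yE gK.
(* The statement on fundamental groups quantifies over base points, so it is contradictory only once
   a point exists. *)
have [x0] : exists x, SL2_complement (tau R) x.
  by exists (of_space (kbase R)); apply: of_space_tau_complement;
    exact: kbase_in_complement.
move=> Ux0.
have Ux : x0 \in SL2_complement (tau R) by rewrite inE.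
have Uy : on_points phi x0 \in SL2_complement (tau1 R) by rewrite inE; exact: fU.
apply: (@pi1_complements_not_isomorphic (SigSub Ux) (SigSub Uy)).
apply: (@pi1_homeomorphic _ _ _ _ _ (on_points phi) (on_points psi)) => //.
- by apply: continuous_subspaceT; exact: continuous_on_points.
- by apply: continuous_subspaceT; exact: continuous_on_points.
- by move=> x [Sx _]; exact: fK.
- by move=> x [Sx _]; exact: gK.
Qed.

End RealPoints.

(** * The closed embedding *)

Lemma comp_mpoly_comp (k : comNzRingType) l m n (p : m.-tuple (mpoly l k))
    (q : n.-tuple (mpoly m k)) (r : mpoly n k) :
  comp_mpoly p (comp_mpoly q r) = comp_mpoly [tuple comp_mpoly p (tnth q i) | i < n] r.
Proof.
rewrite (comp_mpolyEX r q) (comp_mpolyEX r) raddf_sum; apply: eq_bigr => mu _ /=.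
rewrite !comp_mpolyZ; congr (_ *: _); rewrite !comp_mpolyX rmorph_prod /=.
by apply: eq_bigr => i _; rewrite rmorphXn tnth_mktuple.
Qed.

Lemma comp_mpolyM (k : comNzRingType) m n (p : n.-tuple (mpoly m k)) :
  {morph comp_mpoly p : q r / q * r}.
Proof. exact: rmorphM. Qed.

Lemma comp_mpolyXn (k : comNzRingType) m n (p : n.-tuple (mpoly m k)) j :
  {morph comp_mpoly p : q / q ^+ j}.
Proof. exact: rmorphXn. Qed.

Lemma comp_mpoly_nat (k : comNzRingType) m n (p : n.-tuple (mpoly m k)) j :
  comp_mpoly p (j%:R) = j%:R.
Proof. by rewrite comp_mpolyMn comp_mpoly1. Qed.

Section KernelScheme.
Context (k : fieldType) (m n : nat) (p : n.-tuple (mpoly m k)).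

Definition kernel_ideal : set (mpoly n k) := [set q | comp_mpoly p q = 0].

Lemma kernel_ideal0 : kernel_ideal 0.
Proof. exact: raddf0. Qed.

Lemma kernel_idealD q r : kernel_ideal q -> kernel_ideal r -> kernel_ideal (q + r).
Proof. by rewrite /kernel_ideal /= raddfD /= => -> ->; rewrite addr0. Qed.

Lemma kernel_idealM q r : kernel_ideal r -> kernel_ideal (q * r).
Proof. by rewrite /kernel_ideal /= rmorphM /= => ->; rewrite mulr0. Qed.

Definition kernel_scheme : affine_scheme k n :=
  AffineScheme kernel_ideal0 kernel_idealD kernel_idealM.

(** The image is the subscheme defined by the kernel of the substitution of [p]. There [p] after [q]
    is the identity, because X_i - p_i(q) becomes p_i - p_i(q(p)) = 0 under that substitution. *)
Lemma closed_embedding_retract (Y : affine_scheme k n) (q : m.-tuple (mpoly n k)) :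
  is_morphism (affine_space k m) Y p ->
  (forall i, comp_mpoly p (tnth q i) = mpolyX k (mnm1 i)) ->
  closed_embedding (affine_space k m) Y p.
Proof.
move=> pY qp; split=> //; exists kernel_scheme; split; first by move=> r /pY.
have qpid : [tuple comp_mpoly p (tnth q i) | i < m] = id_morphism k m.
  by apply: eq_from_tnth => i; rewrite !tnth_mktuple.
split; first by move=> r.
exists q; split.
- by move=> r ->; rewrite raddf0; exact: kernel_ideal0.
- by move=> i; rewrite /= !tnth_mktuple qp subrr.
- move=> i; rewrite /= /kernel_ideal /= !tnth_mktuple raddfB /= comp_mpoly_comp qpid.
  by rewrite comp_mpoly_id comp_mpolyXU -tnth_nth subrr.
Qed.

End KernelScheme.

Section TauEmbedding.
Context (k : fieldType).
Hypothesis char2 : 2%N \notin [pchar k].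

(** The tactic [ring] treats [c] as an indeterminate; identities are therefore proved by writing the
    difference of both sides as a multiple of 16 * c - 1. *)
Let c : mpoly 1 k := mpolyC 1 16^-1.
Let t : mpoly 1 k := mpolyX k (mnm1 ord0).

Lemma natr16_neq0 : 16 != 0 :> k.
Proof.
have : 2 != 0 :> k by apply: contra char2 => h; rewrite inE h.
by rewrite -[16]/(2 * 2 * 2 * 2)%:R !natrM !mulf_neq0.
Qed.

Lemma c16 : 16 * c = 1.
Proof.
rewrite /c -[16 in LHS](mpolyC_nat 1 k) -mpolyCM divff//; last exact: natr16_neq0.
Qed.

Let A := t ^+ 3 - 3 * t.
Let B := t ^+ 4 - 4 * t ^+ 2 - 1.
Let C := 1 + c * (t ^+ 2 * (17 * t ^+ 6 - 56 * t ^+ 4 - 137 * t ^+ 2 + 452)).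
Let D := c * (t * (17 * t ^+ 8 - 73 * t ^+ 6 - 149 * t ^+ 4 + 609 * t ^+ 2 + 172)).

Lemma tauE : tau k = [tuple A; B; C; D].
Proof. by rewrite /tau /C /D /c !mul_mpolyC. Qed.

Lemma det_tau : A * D - B * C = 1.
Proof.
(* The difference is affine in [c] with constant term -(B + 1), which determines the cofactor. The
   same recipe gives the cofactors below. *)
apply/subr0_eq; transitivity ((16 * c - 1) * (B + 1)); last by rewrite c16 subrr mul0r.
by rewrite /A /B /C /D; ring.
Qed.

(* Modulo k[a, b], the entries c and d are t ^ 2 and 31 t - 3 t ^ 5, and
   t ^ 5 = a t ^ 2 + 3 a + 9 t. *)
Lemma square_tau : C - 17 * c * B ^+ 2 - 5 * A ^+ 2 - 105 * c * B - 104 * c = t ^+ 2.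
Proof.
apply/subr0_eq; transitivity ((16 * c - 1) * (5 * A ^+ 2 + t ^+ 2 - 1)).
  by rewrite /A /B /C; ring.
by rewrite c16 subrr mul0r.
Qed.

Lemma quintic_tau : D - 17 * c * A ^+ 3 - 5 * A * B - 188 * c * A = 31 * t - 3 * t ^+ 5.
Proof.
apply/subr0_eq; transitivity ((16 * c - 1) * (5 * A * B + 31 * t - 3 * t ^+ 5)).
  by rewrite /A /B /D; ring.
by rewrite c16 subrr mul0r.
Qed.

Definition tau_retraction : mpoly 4 k :=
  let X i := mpolyX k (mnm1 (ord4 i)) in
  let c := mpolyC 4 16^-1 : mpoly 4 k in
  let S := X 2 - 17 * c * X 1 ^+ 2 - 5 * X 0 ^+ 2 - 105 * c * X 1 - 104 * c in
  let E := X 3 - 17 * c * X 0 ^+ 3 - 5 * X 0 * X 1 - 188 * c * X 0 in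
  (* Along tau, [S] is t^2 and [E] is 31 t - 3 t^5 = 4 t - 3 a t^2 - 9 a, so the bracket is 4 t, and
     4 * c is 1/4. *)
  4 * c * (E + 3 * X 0 * S + 9 * X 0).

Lemma comp_tau i :
  comp_mpoly (tau k) (mpolyX k (mnm1 (ord4 i))) = nth 0 [:: A; B; C; D] (ord4 i).
Proof. by rewrite comp_mpolyXU tauE. Qed.

Lemma tau_retractionP : comp_mpoly (tau k) tau_retraction = t.
Proof.
rewrite /tau_retraction.
rewrite !(comp_mpoly_nat, comp_mpolyC, comp_mpolyXn, comp_mpolyM, comp_mpolyB,
  comp_mpolyD).
rewrite !comp_tau !inordK//= -/c square_tau quintic_tau.
apply/subr0_eq; transitivity ((16 * c - 1) * t); last by rewrite c16 subrr mul0r.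
by rewrite /A; ring.
Qed.

Theorem tau_closed_embedding : closed_embedding (affine_space k 1) (SL2 k) (tau k).
Proof.
apply: (@closed_embedding_retract _ _ _ _ _ [tuple tau_retraction]).
  move=> q [r ->]; rewrite /= comp_mpolyM !(comp_mpolyB, comp_mpolyM, comp_mpoly1).
  by rewrite !comp_tau !inordK//= det_tau subrr mulr0.
by move=> i; rewrite ord1 tau_retractionP.
Qed.

End TauEmbedding.

Theorem lemma6p2 :
  (forall k : fieldType, 2%N \notin [pchar k] ->
     closed_embedding (affine_space k 1) (SL2 k) (tau k)) /\
  (forall R : realType,
     [/\ ~ equivalent_embeddings (affine_space R 1) (SL2 R) (tau R) (tau1 R),
         forall (x : SL2_complement (tau R)) (y : SL2_complement (tau1 R)),
           ~ isomorphic_groups (pi1 R x) (pi1 R y) &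
         forall y : SL2_complement (tau1 R), free_group (pi1 R y)]).
Proof.
split; first exact: tau_closed_embedding.
move=> R; split; first exact: tau_not_equivalent.
- exact: pi1_complements_not_isomorphic.
- by move=> y; exact/free_on_two_free/pi1_tau1_complement.
Qed.
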